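(* For any $\Delta>0$, \[ \inf_{F \in \mathcal{H}_{\pi\Delta},\,F\neq 0} \frac{\|F\|_{L^2(\mathbb{R}, W_{\mathrm O})}}{\|F\|_{L^2(\mathbb{R})}} = 1 \quad\text{and}\quad \sup_{F \in \mathcal{H}_{\pi\Delta},\,F\neq 0} \frac{\|F\|_{L^2(\mathbb{R}, W_{\mathrm O})}}{\|F\|_{L^2(\mathbb{R})}} = \sqrt{1 + \tfrac{\Delta}{2}}. \]
   Context: $\mathcal{H}_{\pi\Delta}$ is the space of entire functions of exponential type at most $\pi\Delta$ that are square-integrable on $\mathbb{R}$. $W_{\mathrm O}(x)=1+\frac12\boldsymbol{\delta}_0(x)$, so $\|F\|^2_{L^2(\mathbb{R},W_{\mathrm O})}=\int_{\mathbb{R}}|F(x)|^2dx+\frac12|F(0)|^2$. *)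

(* Defs.v *)
From Stdlib Require Import Reals.
From Coquelicot Require Import Coquelicot.
Open Scope R_scope.

Definition entire (F : C -> C) : Prop :=
  forall z : C, @ex_derive C_AbsRing C_NormedModule F z.

Definition exp_type_le (F : C -> C) (tau : R) : Prop :=
  forall eps : R, 0 < eps -> exists M : R,
    forall z : C, Cmod (F z) <= M * exp ((tau + eps) * Cmod z).

Definition sq_integrable (F : C -> C) : Prop :=
  ex_RInt_gen (fun x : R => (Cmod (F (RtoC x)))^2)
    (Rbar_locally m_infty) (Rbar_locally p_infty).

Definition PW (Delta : R) (F : C -> C) : Prop :=
  entire F /\ exp_type_le F (PI * Delta) /\ sq_integrable F.

Definition L2norm2 (F : C -> C) : R :=
  RInt_gen (fun x : R => (Cmod (F (RtoC x)))^2)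
    (Rbar_locally m_infty) (Rbar_locally p_infty).

(* ||F||^2_{L^2(R, W_O)} with W_O = 1 + (1/2) delta_0 *)
Definition WOnorm2 (F : C -> C) : R :=
  L2norm2 F + / 2 * (Cmod (F (RtoC 0)))^2.

Definition ratio (F : C -> C) : R := sqrt (WOnorm2 F) / sqrt (L2norm2 F).

(* Main.v *)
Require Import Defs.
From Stdlib Require Import Reals Factorial Lra Lia.
From Coquelicot Require Import Coquelicot.
Open Scope R_scope.

(** Both claims follow from the sharp point evaluation bound
    [|F(0)|^2 <= Delta * ||F||^2], with equality for [sin (PI Delta z) / (PI Delta z)],
    and from functions of the space vanishing at [0].

    After a rotation and a symmetrisation, [F] is even and real on both axes; put
    [g x = F x] and [h y = F (i y)].  Integrating [F z * exp (- z w)] around large squares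
    in the first quadrant gives, for [u] and [v] large,
      [int_0^oo g(x) e^(-ux) cos(vx) dx = int_0^oo h(y) e^(-vy) sin(uy) dy].
    For fixed [v > tau > PI Delta] both sides are real-analytic in [u > 0], hence the identity
    persists there, and it bounds the left side by [O(u / (v - tau)^2)]: in the limit
    [u -> 0] the cosine transform of [g] vanishes beyond [PI Delta].  Integrating twice in [v]
    turns the cosine kernel into the Dirichlet and Fejer kernels.  The Fejer kernel
    recovers [g 0] as [v -> oo], while the Dirichlet kernel at height [T > PI Delta] is
    controlled by [||g||] and [int_0^oo sinc^2 = PI / 2]; let [T -> PI Delta].
    The same identity with [g = 0] shows that [F] vanishes once it vanishes on the real
    line, so that [||F|| > 0] for [F <> 0]. *)

(** * Integrals over the half-line *)

(** The factor exp (- u x) is there because g is only square-integrable, so its cosine transform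
    need not converge absolutely without it. The contour argument itself requires both u and v above
    tau, since F may grow like exp (tau |z|) throughout the quadrant; this is why small u is reached
    only by analyticity. Realness on both axes isolates one cosine integral and one sine integral in
    the real part of the contour integral. The symmetrisation averages over z -> - z and over
    conjugation; it keeps the value at 0 and does not increase the norm. The constant is sharp for
    the following reason. Up to terms that vanish with u, (PI / 2) g 0 is at most the inner product
    on the half-line of g with T sinc (T x), whose squared norm there is T PI / 2. Cauchy-Schwarz
    gives (PI / 2) (g 0)^2 <= T int_0^oo g^2, where the last integral is at most ||F||^2 / 2. At T =
    PI Delta the kernel is itself a multiple of the extremal function, so no step loses anything in
    the limit. *)

Definition half_integrable (f : R -> R) : Prop :=
  (forall x, continuous f x) /\
  exists B, forall r, 0 <= r -> RInt (fun x => Rabs (f x)) 0 r <= B.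

(** [Lim] and [real] are total, so this always denotes a number; [half_int_lim] gives it its meaning
    under [half_integrable]. *)
Definition half_int (f : R -> R) : R := real (Lim (fun r => RInt f 0 r) p_infty).

Lemma continuous_ex_RInt (f : R -> R) (a b : R) :
  (forall x, continuous f x) -> ex_RInt f a b.
Proof. intros H; apply (@ex_RInt_continuous R_CompleteNormedModule); auto. Qed.

Lemma continuous_Rabs_comp (f : R -> R) (x : R) :
  continuous f x -> continuous (fun y => Rabs (f y)) x.
Proof. intros H; apply (continuous_comp f Rabs); [exact H | apply continuous_Rabs]. Qed.

Lemma RInt_nonneg (f : R -> R) (a b : R) :
  (forall x, continuous f x) -> a <= b -> (forall x, a < x < b -> 0 <= f x) ->
  0 <= RInt f a b.
Proof.
  intros Cf Hab Hf; apply RInt_ge_0; auto; apply continuous_ex_RInt; auto.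
Qed.

Lemma RInt_le_on (f g : R -> R) (a b : R) :
  (forall x, continuous f x) -> (forall x, continuous g x) -> a <= b ->
  (forall x, a < x < b -> f x <= g x) -> RInt f a b <= RInt g a b.
Proof. intros; apply RInt_le; auto; apply continuous_ex_RInt; auto. Qed.

Lemma RInt_split (f : R -> R) (a b c : R) :
  (forall x, continuous f x) -> RInt f a c = RInt f a b + RInt f b c.
Proof.
  intros Cf; symmetry.
  apply (RInt_Chasles (V := R_CompleteNormedModule)); apply continuous_ex_RInt; auto.
Qed.

Lemma RInt_add (f g : R -> R) (a b : R) :
  (forall x, continuous f x) -> (forall x, continuous g x) ->
  RInt (fun x => f x + g x) a b = RInt f a b + RInt g a b.
Proof.
  intros Cf Cg.
  apply (RInt_plus (V := R_CompleteNormedModule)); apply continuous_ex_RInt; auto.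
Qed.

Lemma RInt_sub (f g : R -> R) (a b : R) :
  (forall x, continuous f x) -> (forall x, continuous g x) ->
  RInt (fun x => f x - g x) a b = RInt f a b - RInt g a b.
Proof.
  intros Cf Cg.
  apply (RInt_minus (V := R_CompleteNormedModule)); apply continuous_ex_RInt; auto.
Qed.

Lemma RInt_mulc (k : R) (f : R -> R) (a b : R) :
  (forall x, continuous f x) -> RInt (fun x => k * f x) a b = k * RInt f a b.
Proof.
  intros Cf.
  apply (RInt_scal (V := R_CompleteNormedModule)); apply continuous_ex_RInt; auto.
Qed.

Lemma RInt_mono_interval (f : R -> R) (a b c d : R) :
  (forall x, continuous f x) -> a <= b -> b <= c -> c <= d ->
  (forall x, a <= x <= d -> 0 <= f x) -> RInt f b c <= RInt f a d.
Proof.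
  intros Cf H1 H2 H3 Hf.
  rewrite (RInt_split f a b d), (RInt_split f b c d) by auto.
  assert (0 <= RInt f a b) by (apply RInt_nonneg; auto; intros; apply Hf; lra).
  assert (0 <= RInt f c d) by (apply RInt_nonneg; auto; intros; apply Hf; lra).
  lra.
Qed.

Lemma nondecreasing_bounded_is_lim (phi : R -> R) (B : R) :
  (forall r s, 0 <= r -> r <= s -> phi r <= phi s) -> (forall r, 0 <= r -> phi r <= B) ->
  exists l : R, is_lim phi p_infty l /\ l <= B /\ forall r, 0 <= r -> phi r <= l.
Proof.
  intros Hm Hb.
  destruct (completeness (fun y => exists r, 0 <= r /\ y = phi r)) as [l [Hl1 Hl2]].
  - exists B; intros y [r [Hr ->]]; auto.
  - exists (phi 0), 0; split; auto; lra.
  - exists l; split; [|split].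
    + apply is_lim_spec; intros eps; simpl.
      destruct (Classical_Prop.classic (exists r, 0 <= r /\ l - eps < phi r)) as [[r [Hr H]]|H].
      * exists r; intros s Hs.
        assert (phi r <= phi s) by (apply Hm; lra).
        assert (phi s <= l) by (apply Hl1; exists s; split; auto; lra).
        apply Rabs_def1; destruct eps as [e He]; simpl in *; lra.
      * exfalso. assert (l <= l - eps); [|destruct eps; simpl in *; lra].
        apply Hl2; intros y [r [Hr ->]].
        apply Rnot_lt_le; intros H'; apply H; exists r; auto.
    + apply Hl2; intros y [r [Hr ->]]; auto.
    + intros r Hr; apply Hl1; exists r; auto.
Qed.

Lemma half_int_of_lim (f : R -> R) (l : R) :
  is_lim (fun r => RInt f 0 r) p_infty l -> half_int f = l.
Proof. intros H; unfold half_int; rewrite (is_lim_unique _ _ _ H); reflexivity. Qed.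

Lemma half_integrable_continuous (f : R -> R) :
  half_integrable f -> forall x, continuous f x.
Proof. intros [H _]; exact H. Qed.

Lemma half_integrable_nonneg (f : R -> R) (B : R) :
  (forall x, continuous f x) -> (forall x, 0 <= x -> 0 <= f x) ->
  (forall r, 0 <= r -> RInt f 0 r <= B) -> half_integrable f.
Proof.
  intros Cf Hf HB; split; auto; exists B; intros r Hr.
  rewrite (RInt_ext _ f); auto.
  rewrite Rmin_left, Rmax_right by auto; intros x Hx; apply Rabs_pos_eq, Hf; lra.
Qed.

Lemma half_integrable_dom (b f : R -> R) :
  half_integrable b -> (forall x, continuous f x) ->
  (forall x, 0 <= x -> Rabs (f x) <= b x) -> half_integrable f.
Proof.
  intros [Cb [B HB]] Cf Hf; split; auto; exists B; intros r Hr.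
  apply Rle_trans with (2 := HB r Hr).
  apply RInt_le_on; auto; try (intros; apply continuous_Rabs_comp; auto).
  intros x Hx; apply Rle_trans with (1 := Hf x (Rlt_le _ _ (proj1 Hx))), Rle_abs.
Qed.

Lemma half_integrable_abs (f : R -> R) :
  half_integrable f -> half_integrable (fun x => Rabs (f x)).
Proof.
  intros [Cf [B HB]]; apply half_integrable_nonneg with B; auto.
  - intros; apply continuous_Rabs_comp; auto.
  - intros; apply Rabs_pos.
Qed.

(** Truncated integrals converge by monotonicity for nonnegative functions, so [f] is written as
    [|f| - (|f| - f)]. *)
Lemma half_int_lim (f : R -> R) :
  half_integrable f -> is_lim (fun r => RInt f 0 r) p_infty (half_int f).
Proof.
  intros [Cf [B HB]].
  assert (Ca : forall x, continuous (fun y => Rabs (f y)) x)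
    by (intros; apply continuous_Rabs_comp; auto).
  assert (Cd : forall x, continuous (fun y => Rabs (f y) - f y) x)
    by (intros; apply (continuous_minus (V := R_NormedModule)); auto).
  destruct (nondecreasing_bounded_is_lim (fun r => RInt (fun x => Rabs (f x)) 0 r) B)
    as [l1 [H1 _]]; auto.
  { intros r s Hr Hs; apply RInt_mono_interval; auto; try lra; intros; apply Rabs_pos. }
  destruct (nondecreasing_bounded_is_lim (fun r => RInt (fun x => Rabs (f x) - f x) 0 r)
              (2 * B)) as [l2 [H2 _]].
  { intros r s Hr Hs; apply RInt_mono_interval; auto; try lra; intros.
    generalize (Rle_abs (f x)); lra. }
  { intros r Hr; apply Rle_trans with (2 * RInt (fun x => Rabs (f x)) 0 r).
    - rewrite <- RInt_mulc by auto; apply RInt_le_on; auto.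
      + intros; apply (continuous_scal_r (V := R_NormedModule)); auto.
      + intros x _; generalize (Rle_abs (- f x)); rewrite Rabs_Ropp; lra.
    - specialize (HB r Hr); lra. }
  assert (H : is_lim (fun r => RInt f 0 r) p_infty (l1 - l2)).
  { apply is_lim_ext with (fun r => RInt (fun x => Rabs (f x)) 0 r
                                    - RInt (fun x => Rabs (f x) - f x) 0 r).
    - intros r; rewrite RInt_sub; auto; ring.
    - apply (is_lim_minus' _ _ _ l1 l2); auto. }
  rewrite (half_int_of_lim _ _ H); exact H.
Qed.

Lemma half_int_ext (f g : R -> R) :
  (forall x, 0 < x -> f x = g x) -> half_int f = half_int g.
Proof.
  intros H; unfold half_int; f_equal; apply Lim_ext_loc.
  exists 0; intros r Hr; apply RInt_ext.
  rewrite Rmin_left, Rmax_right by lra; intros x Hx; symmetry; apply H; lra.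
Qed.

Lemma half_integrable_plus (f g : R -> R) :
  half_integrable f -> half_integrable g -> half_integrable (fun x => f x + g x).
Proof.
  intros [Cf [B HB]] [Cg [D HD]].
  assert (C1 : forall x, continuous (fun y => Rabs (f y)) x)
    by (intros; apply continuous_Rabs_comp; auto).
  assert (C2 : forall x, continuous (fun y => Rabs (g y)) x)
    by (intros; apply continuous_Rabs_comp; auto).
  assert (Cs : forall x, continuous (fun y => f y + g y) x)
    by (intros; apply (continuous_plus (V := R_NormedModule)); auto).
  split; auto.
  exists (B + D); intros r Hr.
  apply Rle_trans with (RInt (fun x => Rabs (f x) + Rabs (g x)) 0 r).
  - apply RInt_le_on; auto.
    + intros; apply continuous_Rabs_comp; auto.
    + intros; apply (continuous_plus (V := R_NormedModule)); auto.
    + intros; apply Rabs_triang.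
  - rewrite RInt_add by auto; specialize (HB r Hr); specialize (HD r Hr); lra.
Qed.

Lemma half_integrable_scal (k : R) (f : R -> R) :
  half_integrable f -> half_integrable (fun x => k * f x).
Proof.
  intros [Cf [B HB]]; split.
  - intros; apply (continuous_scal_r (V := R_NormedModule)); auto.
  - exists (Rabs k * B); intros r Hr.
    rewrite (RInt_ext _ (fun x => Rabs k * Rabs (f x))) by (intros; apply Rabs_mult).
    rewrite RInt_mulc by (intros; apply continuous_Rabs_comp; auto).
    apply Rmult_le_compat_l; auto; apply Rabs_pos.
Qed.

Lemma half_int_plus (f g : R -> R) :
  half_integrable f -> half_integrable g ->
  half_int (fun x => f x + g x) = half_int f + half_int g.
Proof.
  intros Hf Hg; apply half_int_of_lim.
  apply is_lim_ext with (fun r => RInt f 0 r + RInt g 0 r).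
  - intros r; rewrite RInt_add; auto; apply half_integrable_continuous; auto.
  - apply (is_lim_plus' _ _ _ (half_int f) (half_int g)); apply half_int_lim; auto.
Qed.

Lemma half_int_scal (k : R) (f : R -> R) :
  half_integrable f -> half_int (fun x => k * f x) = k * half_int f.
Proof.
  intros Hf; apply half_int_of_lim.
  apply is_lim_ext with (fun r => k * RInt f 0 r).
  - intros r; rewrite RInt_mulc; auto; apply half_integrable_continuous; auto.
  - apply (is_lim_scal_l _ k _ (half_int f)); apply half_int_lim; auto.
Qed.

Lemma half_integrable_minus (f g : R -> R) :
  half_integrable f -> half_integrable g -> half_integrable (fun x => f x - g x).
Proof.
  intros Hf Hg.
  assert (H := half_integrable_plus _ _ Hf (half_integrable_scal (-1) _ Hg)).
  destruct H as [C [B HB]]; split.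
  - intros x; apply (continuous_minus (V := R_NormedModule));
      apply half_integrable_continuous; auto.
  - exists B; intros r Hr; rewrite (RInt_ext _ (fun x => Rabs (f x + -1 * g x))); auto.
    intros x _; f_equal; ring.
Qed.

Lemma half_int_minus (f g : R -> R) :
  half_integrable f -> half_integrable g ->
  half_int (fun x => f x - g x) = half_int f - half_int g.
Proof.
  intros Hf Hg; rewrite (half_int_ext _ (fun x => f x + -1 * g x)) by (intros; ring).
  rewrite half_int_plus, half_int_scal; auto; try ring; apply half_integrable_scal; auto.
Qed.

Lemma half_int_le_bound (f : R -> R) (B : R) :
  half_integrable f -> (forall r, 0 <= r -> RInt f 0 r <= B) -> half_int f <= B.
Proof.
  intros Hf HB.
  apply (is_lim_le_loc (fun r => RInt f 0 r) (fun _ => B) p_infty (half_int f) B).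
  - exists 0; intros r Hr; apply HB; lra.
  - apply half_int_lim; auto.
  - apply is_lim_const.
Qed.

Lemma half_int_ge_bound (f : R -> R) (B r0 : R) :
  half_integrable f -> (forall r, r0 <= r -> B <= RInt f 0 r) -> B <= half_int f.
Proof.
  intros Hf HB.
  apply (is_lim_le_loc (fun _ => B) (fun r => RInt f 0 r) p_infty B (half_int f)).
  - exists r0; intros r Hr; apply HB; lra.
  - apply is_lim_const.
  - apply half_int_lim; auto.
Qed.

Lemma half_int_le (f g : R -> R) :
  half_integrable f -> half_integrable g -> (forall x, 0 <= x -> f x <= g x) ->
  half_int f <= half_int g.
Proof.
  intros Hf Hg H.
  apply (is_lim_le_loc (fun r => RInt f 0 r) (fun r => RInt g 0 r) p_infty
           (half_int f) (half_int g)); try (apply half_int_lim; auto).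
  exists 0; intros r Hr; apply RInt_le_on; try lra; try (intros; apply half_integrable_continuous; auto).
  intros; apply H; lra.
Qed.

Lemma half_int_abs_le (f b : R -> R) :
  half_integrable f -> half_integrable b -> (forall x, 0 <= x -> Rabs (f x) <= b x) ->
  Rabs (half_int f) <= half_int b.
Proof.
  intros Hf Hb H; apply Rabs_le; split.
  - cut (-1 * half_int b <= half_int f); [lra|].
    rewrite <- half_int_scal by auto; apply half_int_le; auto.
    + apply half_integrable_scal; auto.
    + intros x Hx; specialize (H x Hx); apply Rabs_le_between in H; lra.
  - apply half_int_le; auto; intros x Hx; specialize (H x Hx); apply Rabs_le_between in H; lra.
Qed.

Lemma RInt_le_half_int (f : R -> R) (a b : R) :
  half_integrable f -> (forall x, 0 <= x -> 0 <= f x) -> 0 <= a -> a <= b ->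
  RInt f a b <= half_int f.
Proof.
  intros Hf Hp Ha Hb; apply half_int_ge_bound with b; auto; intros r Hr.
  apply RInt_mono_interval; auto; try lra.
  - apply half_integrable_continuous; auto.
  - intros; apply Hp; lra.
Qed.

Lemma half_int_nonneg (f : R -> R) :
  half_integrable f -> (forall x, 0 <= x -> 0 <= f x) -> 0 <= half_int f.
Proof.
  intros Hf Hp; apply Rle_trans with (RInt f 0 0).
  - rewrite (RInt_point (V := R_CompleteNormedModule)); apply Rle_refl.
  - apply RInt_le_half_int; auto; lra.
Qed.

Lemma half_int_primitive (f H : R -> R) (l : R) :
  (forall x, continuous f x) -> (forall x, is_derive H x (f x)) ->
  is_lim H p_infty l -> is_lim (fun r => RInt f 0 r) p_infty (l - H 0).
Proof.
  intros Cf HD HL; apply is_lim_ext with (fun r => H r - H 0).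
  - intros r; symmetry; apply is_RInt_unique.
    apply (is_RInt_derive (V := R_CompleteNormedModule)); auto.
  - apply (is_lim_minus' _ _ _ l (H 0)); auto; apply is_lim_const.
Qed.

Lemma continuous_derivable (f : R -> R) (x : R) : ex_derive f x -> continuous f x.
Proof. apply (ex_derive_continuous (V := R_NormedModule)). Qed.

Lemma continuity_pt_derivable (f : R -> R) (x : R) : ex_derive f x -> continuity_pt f x.
Proof. intros H; apply continuity_pt_filterlim; apply continuous_derivable; exact H. Qed.

Lemma RInt_exp_le (k r : R) : 0 < k -> 0 <= r -> RInt (fun x => exp (- k * x)) 0 r <= / k.
Proof.
  intros Hk Hr.
  rewrite (is_RInt_unique _ 0 r (- / k * exp (- k * r) - - / k * exp (- k * 0))).
  - rewrite Rmult_0_r, exp_0; generalize (exp_pos (- k * r)) (Rinv_0_lt_compat _ Hk); nra.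
  - apply (is_RInt_derive (V := R_CompleteNormedModule) (fun x => - / k * exp (- k * x))).
    + intros x _; auto_derive; auto; field; lra.
    + intros; apply continuous_derivable; auto_derive; auto.
Qed.

Lemma half_integrable_exp (k : R) : 0 < k -> half_integrable (fun x => exp (- k * x)).
Proof.
  intros Hk; apply half_integrable_nonneg with (/ k).
  - intros; apply continuous_derivable; auto_derive; auto.
  - intros; left; apply exp_pos.
  - intros r Hr; apply RInt_exp_le; auto.
Qed.

(** The derivative of exp y - y^(n+1) / (n+1)! is the same expression one degree lower, nonnegative
    by induction, and its value at 0 is 1. *)
Lemma pow_div_fact_le_exp (n : nat) (x : R) : 0 <= x -> x ^ n / INR (fact n) <= exp x.
Proof.
  revert x; induction n as [|n IH]; intros x Hx.
  - simpl; generalize (exp_ineq1_le x); lra.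
  - assert (Hn := INR_fact_neq_0 n).
    assert (Hd : INR (fact (S n)) = INR (S n) * INR (fact n))
      by (rewrite fact_simpl, mult_INR; reflexivity).
    assert (Hn' := not_0_INR (S n) (Nat.neq_succ_0 n)).
    rewrite Hd; clear Hd; set (m := INR (S n)) in *; set (d := INR (fact n)) in *.
    destruct (MVT_gen (fun y => exp y - y ^ S n / (m * d)) 0 x
                (fun y => exp y - y ^ n / d)) as [c [Hc He]].
    + intros y _; auto_derive; auto.
      change (match n with 0%nat => 1 | S _ => INR n + 1 end) with m; simpl pred.
      field; split; auto.
    + intros y _; apply continuity_pt_derivable; auto_derive; auto.
    + rewrite Rmin_left, Rmax_right in Hc by auto.
      assert (H := IH c (proj1 Hc)).
      rewrite exp_0, pow_i in He by lia.
      assert (0 <= (exp c - c ^ n / d) * (x - 0)) by (apply Rmult_le_pos; lra).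
      unfold Rdiv in *; lra.
Qed.

(** Source of the bounds n! rho^n below: n differentiations under an integral produce x^n, which the
    decay exp (- a x) turns into n! / a^n. *)
Lemma pow_exp_le (n : nat) (a x : R) :
  0 < a -> 0 <= x -> x ^ n * exp (- a * x) <= INR (fact n) / a ^ n.
Proof.
  intros Ha Hx.
  assert (Hf := INR_fact_lt_0 n). assert (Hp := pow_lt a n Ha).
  assert (H := pow_div_fact_le_exp n (a * x) (Rmult_le_pos _ _ (Rlt_le _ _ Ha) Hx)).
  replace (- a * x) with (- (a * x)) by ring; rewrite exp_Ropp.
  assert (He := exp_pos (a * x)).
  rewrite Rpow_mult_distr in H.
  apply Rmult_le_reg_r with (exp (a * x) * a ^ n / INR (fact n)).
  - apply Rdiv_lt_0_compat; auto; apply Rmult_lt_0_compat; auto.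
  - replace (x ^ n * / exp (a * x) * (exp (a * x) * a ^ n / INR (fact n)))
      with (a ^ n * x ^ n / INR (fact n)) by (field; lra).
    replace (INR (fact n) / a ^ n * (exp (a * x) * a ^ n / INR (fact n)))
      with (exp (a * x)) by (field; lra).
    exact H.
Qed.

Lemma half_integrable_pow_exp (n : nat) (k : R) :
  0 < k -> half_integrable (fun x => x ^ n * exp (- k * x)).
Proof.
  intros Hk.
  apply half_integrable_dom with
    (fun x => INR (fact n) / (k / 2) ^ n * exp (- (k / 2) * x)).
  - apply half_integrable_scal, half_integrable_exp; lra.
  - intros; apply continuous_derivable; auto_derive; auto.
  - intros x Hx; rewrite Rabs_pos_eq.
    + replace (exp (- k * x)) with (exp (- (k / 2) * x) * exp (- (k / 2) * x))
        by (rewrite <- exp_plus; f_equal; field).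
      rewrite <- Rmult_assoc; apply Rmult_le_compat_r; [left; apply exp_pos|].
      apply pow_exp_le; lra.
    + apply Rmult_le_pos; [apply pow_le; auto | left; apply exp_pos].
Qed.

(** * Differentiation under the integral and propagation of zeros *)

(** Two applications of the mean value theorem. Used with [q] depending on an integration variable,
    it supplies the domination needed to differentiate under [half_int]. *)
Lemma quadratic_remainder (q q1 q2 : R -> R) (A d K : R) :
  (forall y, Rabs (y - A) < d -> is_derive q y (q1 y)) ->
  (forall y, Rabs (y - A) < d -> is_derive q1 y (q2 y)) ->
  (forall y, Rabs (y - A) < d -> Rabs (q2 y) <= K) ->
  forall s, Rabs s < d -> Rabs (q (A + s) - q A - s * q1 A) <= s ^ 2 * K.
Proof.
  intros H1 H2 HK s Hs.
  assert (Hin : forall c y, Rmin A c <= y <= Rmax A c -> Rabs (y - A) <= Rabs (c - A)).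
  { intros c y Hy; unfold Rmin, Rmax in Hy; destruct (Rle_dec A c);
      unfold Rabs; repeat destruct Rcase_abs; lra. }
  assert (HA : A + s - A = s) by ring.
  destruct (MVT_gen q A (A + s) q1) as [c [Hc E1]].
  - intros y Hy; apply H1; eapply Rle_lt_trans; [apply (Hin (A + s)); lra | rewrite HA; auto].
  - intros y Hy; apply continuity_pt_derivable; eexists; apply H1.
    eapply Rle_lt_trans; [apply (Hin (A + s)); lra | rewrite HA; auto].
  - assert (Hcs := Hin _ _ Hc); rewrite HA in Hcs.
    destruct (MVT_gen q1 A c q2) as [e [He E2]].
    + intros y Hy; apply H2; eapply Rle_lt_trans; [apply (Hin c); lra | lra].
    + intros y Hy; apply continuity_pt_derivable; eexists; apply H2.
      eapply Rle_lt_trans; [apply (Hin c); lra | lra].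
    + assert (Hes := Hin _ _ He).
      replace (q (A + s) - q A - s * q1 A) with (s * (q2 e * (c - A)))
        by (rewrite <- E2; rewrite E1; ring).
      rewrite !Rabs_mult.
      assert (HB : Rabs (q2 e) <= K) by (apply HK; lra).
      assert (H0 := Rabs_pos (q2 e)). assert (H3 := Rabs_pos s). assert (H4 := Rabs_pos (c - A)).
      rewrite <- (pow2_abs s).
      apply Rle_trans with (Rabs s * (K * Rabs s)); [|right; ring].
      apply Rmult_le_compat_l; auto; apply Rmult_le_compat; auto.
Qed.

Lemma is_derive_quadratic (f : R -> R) (A l d B : R) :
  0 < d -> (forall s, Rabs s < d -> Rabs (f (A + s) - f A - s * l) <= s ^ 2 * B) ->
  is_derive f A l.
Proof.
  intros Hd H; apply is_derive_Reals; intros eps Heps.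
  (* [B] may vanish or be negative, so it is raised to at least 1 before dividing by it. *)
  assert (HB : 0 < Rmax B 1) by (generalize (Rmax_r B 1); lra).
  assert (Hm : 0 < Rmin d (eps / Rmax B 1)).
  { apply Rmin_pos; auto; apply Rdiv_lt_0_compat; auto. }
  exists (mkposreal _ Hm); intros s Hs0 Hs; simpl in Hs.
  assert (Hs1 : Rabs s < d) by (eapply Rlt_le_trans; [apply Hs | apply Rmin_l]).
  assert (Hs2 : Rabs s < eps / Rmax B 1) by (eapply Rlt_le_trans; [apply Hs | apply Rmin_r]).
  assert (Hp : 0 < Rabs s) by (apply Rabs_pos_lt; auto).
  replace ((f (A + s) - f A) / s - l) with ((f (A + s) - f A - s * l) / s) by (field; auto).
  unfold Rdiv; rewrite Rabs_mult, Rabs_inv.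
  apply Rmult_lt_reg_r with (Rabs s); auto.
  rewrite Rmult_assoc, Rinv_l, Rmult_1_r by lra.
  eapply Rle_lt_trans; [apply H; auto|].
  rewrite <- pow2_abs.
  apply Rle_lt_trans with (Rabs s * (Rabs s * Rmax B 1)).
  - generalize (Rmax_l B 1); intros; nra.
  - rewrite (Rmult_comm eps); apply Rmult_lt_compat_l; auto.
    apply Rmult_lt_reg_r with (/ Rmax B 1); [apply Rinv_0_lt_compat; auto|].
    rewrite Rmult_assoc, Rinv_r, Rmult_1_r by lra; exact Hs2.
Qed.

(** Integrating the pointwise remainder bounds the remainder of the integral by
    [s ^ 2 * half_int b]; this explicit estimate takes the place of dominated convergence. *)
Lemma half_int_derive (r : R -> R -> R) (r1 b : R -> R) (A d : R) :
  0 < d -> (forall y, Rabs (y - A) < d -> half_integrable (fun x => r x y)) ->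
  half_integrable r1 -> half_integrable b ->
  (forall x s, 0 <= x -> Rabs s < d ->
     Rabs (r x (A + s) - r x A - s * r1 x) <= s ^ 2 * b x) ->
  is_derive (fun y => half_int (fun x => r x y)) A (half_int r1).
Proof.
  intros Hd Hr H1 Hb H.
  apply is_derive_quadratic with d (half_int b); auto.
  intros s Hs.
  assert (HAs : half_integrable (fun x => r x (A + s)))
    by (apply Hr; replace (A + s - A) with s by ring; auto).
  assert (HA : half_integrable (fun x => r x A))
    by (apply Hr; replace (A - A) with 0 by ring; rewrite Rabs_R0; auto).
  rewrite <- half_int_scal, <- half_int_scal, <- !half_int_minus; auto.
  - apply half_int_abs_le; auto.
    + apply half_integrable_minus; [apply half_integrable_minus | apply half_integrable_scal]; auto.
    + apply half_integrable_scal; auto.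
  - apply half_integrable_minus; auto.
  - apply half_integrable_scal; auto.
Qed.

(** Translates a sequence of successive derivatives into the [Derive_n] that [Taylor_Lagrange]
    speaks about. *)
Lemma Derive_n_chain (phi : nat -> R -> R) (b : R) :
  (forall n t, t < b -> is_derive (phi n) t (phi (S n) t)) ->
  forall m t, t < b -> Derive_n (phi 0%nat) m t = phi m t /\ ex_derive_n (phi 0%nat) m t.
Proof.
  intros H m; induction m as [|m IH]; intros t Ht.
  - simpl; auto.
  - assert (HD : is_derive (Derive_n (phi 0%nat) m) t (phi (S m) t)).
    { apply is_derive_ext_loc with (phi m); [|apply H; auto].
      assert (Hp : 0 < b - t) by lra; exists (mkposreal _ Hp); intros y Hy.
      symmetry; apply IH; unfold ball in Hy; simpl in Hy.
      unfold AbsRing_ball, abs, minus, plus, opp in Hy; simpl in Hy.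
      apply Rabs_def2 in Hy; lra. }
    split.
    + simpl; apply is_derive_unique; exact HD.
    + simpl; eexists; exact HD.
Qed.

(* A jet with Cauchy-type bounds [K n! rho^n] is real-analytic with radius at least [1 / rho],
   so zeros propagate to the left by steps of length [1 / (4 rho)]. *)
Lemma analytic_jet_zero (f : nat -> R -> R) (a u0 K rho : R) :
  0 < rho ->
  (forall n u, a < u -> is_derive (f n) u (f (S n) u)) ->
  (forall n u, a < u -> Rabs (f n u) <= K * INR (fact n) * rho ^ n) ->
  (forall u, a < u -> u0 < u -> f 0%nat u = 0) ->
  forall u, a < u -> f 0%nat u = 0.
Proof.
  intros Hrho HD HB H0.
  assert (Hloc : forall w, (forall u, a < u -> w < u -> f 0%nat u = 0) ->
            forall n u, a < u -> w < u -> f n u = 0).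
  { intros w Hw n; induction n as [|n IH]; auto; intros u Hu Hwu.
    rewrite <- (is_derive_unique _ _ _ (HD n u Hu)).
    rewrite <- (Derive_const 0 u); apply Derive_ext_loc.
    assert (Hp : 0 < u - Rmax a w) by (generalize (Rmax_lub_lt a w u Hu Hwu); lra).
    exists (mkposreal _ Hp); intros y Hy.
    unfold ball in Hy; simpl in Hy.
    unfold AbsRing_ball, abs, minus, plus, opp in Hy; simpl in Hy.
    apply Rabs_def2 in Hy.
    generalize (Rmax_l a w) (Rmax_r a w); intros; apply IH; lra. }
  set (d := / (4 * rho)).
  assert (Hd : 0 < d) by (apply Rinv_0_lt_compat; lra).
  assert (Hstep : forall w, (forall u, a < u -> w < u -> f 0%nat u = 0) ->
            forall u, a < u -> w - d < u -> f 0%nat u = 0).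
  { intros w Hw u Hu Hwu.
    destruct (Rlt_dec w u) as [Hlt|Hge]; auto.
    (* At the centre [w'], to the right of [w], the whole jet vanishes, and [u] lies less than
       [2 * d] to its left. The Taylor remainder is then at most [K * (2 * d * rho) ^ S N], and
       [2 * d * rho] is 1/2. *)
    set (w' := w + d).
    assert (Hz : forall n, f n w' = 0) by (intros; apply (Hloc w); unfold w'; auto; lra).
    (* [Taylor_Lagrange] expands to the right of the centre, so the function is reflected; each
       derivative picks up a sign. *)
    set (phi := fun n t => (-1) ^ n * f n (w' - t)).
    assert (Hphi : forall n t, t < w' - a -> is_derive (phi n) t (phi (S n) t)).
    { intros n t Ht; unfold phi.
      replace ((-1) ^ S n * f (S n) (w' - t)) with ((-1) ^ n * (-1 * f (S n) (w' - t)))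
        by (simpl; ring).
      apply is_derive_scal.
      apply (is_derive_comp (f n) (fun t => w' - t)); [apply HD; lra|].
      auto_derive; auto; ring. }
    assert (Hch := Derive_n_chain phi (w' - a) Hphi).
    apply cond_eq; intros eps Heps; rewrite Rminus_0_r.
    assert (HK : 0 <= K).
    { generalize (HB 0%nat u Hu) (Rabs_pos (f 0%nat u)); simpl; lra. }
    destruct (pow_lt_1_zero (/ 2)) with (y := eps / (K + 1)) as [N HN].
    { rewrite Rabs_pos_eq; lra. }
    { apply Rdiv_lt_0_compat; lra. }
    destruct (Taylor_Lagrange (phi 0%nat) N 0 (w' - u)) as [z [Hz1 HT]].
    { unfold w'; lra. }
    { intros t Ht k _; apply Hch; lra. }
    assert (E : phi 0%nat (w' - u) = f 0%nat u).
    { unfold phi; simpl; rewrite Rmult_1_l; f_equal; ring. }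
    rewrite E in HT; rewrite HT.
    rewrite sum_eq_R0.
    2:{ intros n _; rewrite (proj1 (Hch n 0 ltac:(unfold w'; lra))).
        unfold phi; rewrite (Rminus_0_r w'), Hz; ring. }
    rewrite (proj1 (Hch (S N) z ltac:(unfold w' in *; lra))).
    rewrite Rplus_0_l, Rminus_0_r, Rabs_mult; unfold phi.
    rewrite Rabs_mult, pow_1_abs, Rmult_1_l.
    assert (Hf := INR_fact_lt_0 (S N)).
    assert (HBz := HB (S N) (w' - z) ltac:(unfold w' in *; lra)).
    assert (Hpos : 0 <= (w' - u) ^ S N / INR (fact (S N))).
    { apply Rmult_le_pos; [apply pow_le; unfold w'; lra | left; apply Rinv_0_lt_compat; auto]. }
    rewrite (Rabs_pos_eq _ Hpos).
    apply Rle_lt_trans with ((w' - u) ^ S N / INR (fact (S N))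
                             * (K * INR (fact (S N)) * rho ^ S N)).
    { apply Rmult_le_compat_l; auto. }
    replace ((w' - u) ^ S N / INR (fact (S N)) * (K * INR (fact (S N)) * rho ^ S N))
      with (K * ((w' - u) * rho) ^ S N) by (rewrite Rpow_mult_distr; field; lra).
    assert (Hq : ((w' - u) * rho) ^ S N <= (/ 2) ^ S N).
    { apply pow_incr; split.
      - apply Rmult_le_pos; unfold w'; lra.
      - apply Rle_trans with (2 * d * rho).
        + apply Rmult_le_compat_r; unfold w'; lra.
        + unfold d; right; field; lra. }
    specialize (HN (S N) ltac:(lia)).
    rewrite Rabs_pos_eq in HN by (apply pow_le; lra).
    assert (Hp2 := pow_lt (/ 2) (S N) ltac:(lra)).
    apply Rmult_lt_compat_r with (r := K + 1) in HN; [|lra].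
    unfold Rdiv in HN; rewrite Rmult_assoc, Rinv_l, Rmult_1_r in HN by lra.
    nra. }
  assert (Hall : forall k u, a < u -> u0 - INR k * d < u -> f 0%nat u = 0).
  { induction k as [|k IH].
    - intros u Hu Hu'; apply H0; auto; simpl in Hu'; lra.
    - intros u Hu Hu'; apply (Hstep (u0 - INR k * d)); auto; rewrite S_INR in Hu'; lra. }
  intros u Hu.
  destruct (INR_unbounded ((u0 - u) / d)) as [k Hk].
  apply (Hall k); auto.
  apply Rmult_lt_compat_r with (r := d) in Hk; auto.
  unfold Rdiv in Hk; rewrite Rmult_assoc, Rinv_l, Rmult_1_r in Hk; lra.
Qed.

(** * The Dirichlet and Fejer kernels *)

(* [ring] and [field] do not see through [AbsRing.sort R_AbsRing]. *)
Ltac eq_in_R :=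
  repeat match goal with x : AbsRing.sort R_AbsRing |- _ =>
    change (AbsRing.sort R_AbsRing) with R in x end;
  match goal with |- ?a = ?b => change (@eq R a b) end.

Definition sinc (x : R) : R := if Req_EM_T x 0 then 1 else sin x / x.

Lemma sinc_0 : sinc 0 = 1.
Proof. unfold sinc; destruct Req_EM_T; lra. Qed.

Lemma sinc_neq_0 (x : R) : x <> 0 -> sinc x = sin x / x.
Proof. intros H; unfold sinc; destruct Req_EM_T; [contradiction | reflexivity]. Qed.

Lemma sinc_mul (x : R) : x * sinc x = sin x.
Proof.
  destruct (Req_dec x 0) as [->|H].
  - rewrite sin_0; ring.
  - rewrite sinc_neq_0 by auto; field; auto.
Qed.

Lemma Rabs_sin_le (x : R) : Rabs (sin x) <= Rabs x.
Proof.
  destruct (MVT_gen sin 0 x cos) as [c [_ E]].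
  - intros; apply is_derive_sin.
  - intros; apply continuity_sin.
  - rewrite sin_0, !Rminus_0_r in E; rewrite E, Rabs_mult.
    assert (Rabs (cos c) <= 1) by (apply Rabs_le; apply COS_bound).
    generalize (Rabs_pos x); nra.
Qed.

Lemma Rabs_sinc_le_1 (x : R) : Rabs (sinc x) <= 1.
Proof.
  destruct (Req_dec x 0) as [->|H].
  - rewrite sinc_0, Rabs_R1; lra.
  - assert (Hx := Rabs_pos_lt x H).
    apply Rmult_le_reg_l with (Rabs x); auto.
    rewrite <- Rabs_mult, sinc_mul, Rmult_1_r; apply Rabs_sin_le.
Qed.

Lemma sinc_sqr_le_1 (x : R) : sinc x ^ 2 <= 1.
Proof. rewrite <- pow2_abs; generalize (Rabs_sinc_le_1 x) (Rabs_pos (sinc x)); nra. Qed.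

Lemma sqr_mul_sinc_sqr_le (x : R) : x ^ 2 * sinc x ^ 2 <= 1.
Proof.
  replace (x ^ 2 * sinc x ^ 2) with ((x * sinc x) ^ 2) by ring.
  rewrite sinc_mul; generalize (SIN_bound x); nra.
Qed.

Lemma continuous_sinc (x : R) : continuous sinc x.
Proof.
  destruct (Req_dec x 0) as [->|H].
  - assert (D := is_derive_sin 0); rewrite cos_0 in D.
    apply is_derive_Reals in D.
    apply continuity_pt_filterlim; intros eps Heps.
    destruct (D eps Heps) as [d Hd].
    exists d; split; [apply cond_pos|].
    intros y [[_ Hy0] Hy]; simpl in Hy |- *; unfold R_dist in *.
    rewrite Rminus_0_r in Hy; rewrite sinc_0, sinc_neq_0 by auto.
    specialize (Hd y (not_eq_sym Hy0) Hy); rewrite Rplus_0_l, sin_0, Rminus_0_r in Hd; exact Hd.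
  - apply continuous_ext_loc with (fun y => sin y / y).
    + assert (Hx := Rabs_pos_lt x H); exists (mkposreal _ Hx); intros y Hy.
      symmetry; apply sinc_neq_0; intros ->.
      unfold ball in Hy; simpl in Hy; unfold AbsRing_ball, abs, minus, plus, opp in Hy; simpl in Hy.
      rewrite Rplus_0_l, Rabs_Ropp in Hy; lra.
    + apply continuous_derivable; auto_derive; auto.
Qed.

Lemma continuous_sinc_lin (a b x : R) : continuous (fun y => sinc (a * (y - b))) x.
Proof.
  apply (continuous_comp (fun y => a * (y - b)) sinc); [|apply continuous_sinc].
  apply continuous_derivable; auto_derive; auto.
Qed.

Lemma mul_sinc (A y : R) : y <> 0 -> A * sinc (A * y) = sin (A * y) / y.
Proof. intros Hy; rewrite <- (sinc_mul (A * y)); field; auto. Qed.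

Lemma sqr_mul_sinc_sqr (A y : R) :
  y <> 0 -> A ^ 2 / 2 * sinc (A / 2 * y) ^ 2 = (1 - cos (A * y)) / y ^ 2.
Proof.
  intros Hy; replace (A * y) with (2 * (A / 2 * y)) by field.
  rewrite cos_2a_sin, <- (sinc_mul (A / 2 * y)); field; auto.
Qed.

(** Here and in the next lemma the Dirichlet kernel appears as the integral of cosines over the
    frequencies up to [A], and the Fejer kernel as the integral of Dirichlet kernels. Writing them
    through [sinc] covers y = 0. *)
Lemma is_derive_mul_sinc (A y : R) :
  is_derive (fun a => a * sinc (a * y)) A (cos (A * y)).
Proof.
  destruct (Req_dec y 0) as [->|Hy].
  - apply is_derive_ext with (fun a => a).
    + intros a; rewrite Rmult_0_r, sinc_0; eq_in_R; ring.
    + rewrite Rmult_0_r, cos_0; auto_derive; auto.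
  - apply is_derive_ext with (fun a => sin (a * y) / y).
    + intros a; symmetry; apply mul_sinc; auto.
    + auto_derive; auto; eq_in_R; field; auto.
Qed.

Lemma is_derive_sqr_mul_sinc_sqr (A y : R) :
  is_derive (fun a => a ^ 2 / 2 * sinc (a / 2 * y) ^ 2) A (A * sinc (A * y)).
Proof.
  destruct (Req_dec y 0) as [->|Hy].
  - apply is_derive_ext with (fun a => a ^ 2 / 2).
    + intros a; rewrite Rmult_0_r, sinc_0; eq_in_R; ring.
    + rewrite Rmult_0_r, sinc_0; auto_derive; auto; eq_in_R; field.
  - apply is_derive_ext with (fun a => (1 - cos (a * y)) / y ^ 2).
    + intros a; symmetry; apply sqr_mul_sinc_sqr; auto.
    + rewrite mul_sinc by auto; auto_derive; auto; eq_in_R; field; auto.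
Qed.

Lemma half_integrable_mult (p q : R -> R) (K : R) :
  half_integrable p -> (forall x, continuous q x) -> (forall x, 0 <= x -> Rabs (q x) <= K) ->
  half_integrable (fun x => p x * q x).
Proof.
  intros Hp Cq HK; apply half_integrable_dom with (fun x => K * Rabs (p x)).
  - apply half_integrable_scal, half_integrable_abs; auto.
  - intros; apply (continuous_mult (K := R_AbsRing)); auto.
    apply half_integrable_continuous; auto.
  - intros x Hx; rewrite Rabs_mult, Rmult_comm; apply Rmult_le_compat_r; auto; apply Rabs_pos.
Qed.

(** With y = x - t, the kernels of the next three definitions are (1 - cos (A y)) / y^2, sin (A y) /
    y and cos (A y), each the derivative in A of the one before. *)
Definition fejer_int (G : R -> R) (t A : R) : R :=
  half_int (fun x => G x * (A ^ 2 / 2 * sinc (A / 2 * (x - t)) ^ 2)).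

Definition dirichlet_int (G : R -> R) (t A : R) : R :=
  half_int (fun x => G x * (A * sinc (A * (x - t)))).

Definition cosine_int (G : R -> R) (t A : R) : R :=
  half_int (fun x => G x * cos (A * (x - t))).

Lemma half_integrable_fejer (G : R -> R) (t A : R) :
  half_integrable G ->
  half_integrable (fun x => G x * (A ^ 2 / 2 * sinc (A / 2 * (x - t)) ^ 2)).
Proof.
  intros HG; apply half_integrable_mult with (A ^ 2 / 2); auto.
  - intros x; apply (continuous_scal_r (V := R_NormedModule)).
    apply (continuous_comp (fun y => sinc (A / 2 * (y - t))) (fun z => z ^ 2)).
    + apply continuous_sinc_lin.
    + apply continuous_derivable; auto_derive; auto.
  - intros x _; rewrite Rabs_pos_eq.
    + generalize (sinc_sqr_le_1 (A / 2 * (x - t))) (pow2_ge_0 A); nra.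
    + generalize (pow2_ge_0 A) (pow2_ge_0 (sinc (A / 2 * (x - t)))); nra.
Qed.

Lemma half_integrable_dirichlet (G : R -> R) (t A : R) :
  half_integrable G -> half_integrable (fun x => G x * (A * sinc (A * (x - t)))).
Proof.
  intros HG; apply half_integrable_mult with (Rabs A); auto.
  - intros x; apply (continuous_scal_r (V := R_NormedModule)), continuous_sinc_lin.
  - intros x _; rewrite Rabs_mult; generalize (Rabs_sinc_le_1 (A * (x - t))) (Rabs_pos A); nra.
Qed.

Lemma half_integrable_cosine (G : R -> R) (t A : R) :
  half_integrable G -> half_integrable (fun x => G x * cos (A * (x - t))).
Proof.
  intros HG; apply half_integrable_mult with 1; auto.
  - intros x; apply continuous_derivable; auto_derive; auto.
  - intros x _; apply Rabs_le, COS_bound.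
Qed.

(** The second derivative of this kernel in [A] is a cosine, so [|G|] dominates the remainder. *)
Lemma is_derive_fejer_int (G : R -> R) (t A : R) :
  half_integrable G -> is_derive (fejer_int G t) A (dirichlet_int G t A).
Proof.
  intros HG; unfold fejer_int, dirichlet_int.
  apply half_int_derive with
    (r := fun x A => G x * (A ^ 2 / 2 * sinc (A / 2 * (x - t)) ^ 2))
    (d := 1) (b := fun x => Rabs (G x)).
  - lra.
  - intros; apply half_integrable_fejer; auto.
  - apply half_integrable_dirichlet; auto.
  - apply half_integrable_abs; auto.
  - intros x s Hx Hs.
    match goal with |- Rabs ?e <= _ =>
      replace e with (G x * ((A + s) ^ 2 / 2 * sinc ((A + s) / 2 * (x - t)) ^ 2
         - A ^ 2 / 2 * sinc (A / 2 * (x - t)) ^ 2 - s * (A * sinc (A * (x - t))))) by ring end.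
    rewrite Rabs_mult, Rmult_comm; apply Rmult_le_compat_r; [apply Rabs_pos|].
    rewrite <- (Rmult_1_r (s ^ 2)).
    apply (quadratic_remainder (fun a => a ^ 2 / 2 * sinc (a / 2 * (x - t)) ^ 2)
             (fun a => a * sinc (a * (x - t))) (fun a => cos (a * (x - t))) A 1 1); auto.
    + intros; apply is_derive_sqr_mul_sinc_sqr.
    + intros; apply is_derive_mul_sinc.
    + intros; apply Rabs_le, COS_bound.
Qed.

(** The second derivative of this kernel in [A] carries a factor x - t, whence the hypothesis on
    [x * G x]. *)
Lemma is_derive_dirichlet_int (G : R -> R) (t A : R) :
  half_integrable G -> half_integrable (fun x => x * G x) ->
  is_derive (dirichlet_int G t) A (cosine_int G t A).
Proof.
  intros HG HxG; unfold dirichlet_int, cosine_int.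
  apply half_int_derive with
    (r := fun x A => G x * (A * sinc (A * (x - t))))
    (d := 1) (b := fun x => Rabs (x * G x) + Rabs t * Rabs (G x)).
  - lra.
  - intros; apply half_integrable_dirichlet; auto.
  - apply half_integrable_cosine; auto.
  - apply half_integrable_plus; [|apply half_integrable_scal]; apply half_integrable_abs; auto.
  - intros x s Hx Hs.
    match goal with |- Rabs ?e <= _ =>
      replace e with (G x * ((A + s) * sinc ((A + s) * (x - t))
         - A * sinc (A * (x - t)) - s * cos (A * (x - t)))) by ring end.
    rewrite Rabs_mult.
    assert (H : Rabs ((A + s) * sinc ((A + s) * (x - t))
         - A * sinc (A * (x - t)) - s * cos (A * (x - t))) <= s ^ 2 * Rabs (x - t)).
    { apply (quadratic_remainder (fun a => a * sinc (a * (x - t)))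
             (fun a => cos (a * (x - t))) (fun a => - (x - t) * sin (a * (x - t))) A 1); auto.
      + intros; apply is_derive_mul_sinc.
      + intros; auto_derive; auto; eq_in_R; ring.
      + intros y _; rewrite Rabs_mult, Rabs_Ropp.
        assert (Rabs (sin (y * (x - t))) <= 1) by (apply Rabs_le, SIN_bound).
        generalize (Rabs_pos (x - t)); nra. }
    assert (H1 : Rabs (x - t) <= Rabs x + Rabs t).
    { unfold Rminus; rewrite <- (Rabs_Ropp t); apply Rabs_triang. }
    rewrite (Rabs_mult x).
    apply Rle_trans with (Rabs (G x) * (s ^ 2 * Rabs (x - t))).
    + apply Rmult_le_compat_l; auto; apply Rabs_pos.
    + replace (s ^ 2 * (Rabs x * Rabs (G x) + Rabs t * Rabs (G x)))
        with (Rabs (G x) * (s ^ 2 * (Rabs x + Rabs t))) by ring.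
      apply Rmult_le_compat_l; [apply Rabs_pos|].
      apply Rmult_le_compat_l; auto; apply pow2_ge_0.
Qed.

Lemma fejer_int_0 (G : R -> R) (t : R) : fejer_int G t 0 = 0.
Proof.
  unfold fejer_int; apply half_int_of_lim.
  apply is_lim_ext with (fun _ => 0); [|apply is_lim_const].
  intros r; rewrite (RInt_ext _ (fun _ => 0)) by (intros; simpl; field).
  rewrite (RInt_const (V := R_CompleteNormedModule)); symmetry; apply Rmult_0_r.
Qed.

Lemma dirichlet_int_0 (G : R -> R) (t : R) : dirichlet_int G t 0 = 0.
Proof.
  unfold dirichlet_int; apply half_int_of_lim.
  apply is_lim_ext with (fun _ => 0); [|apply is_lim_const].
  intros r; rewrite (RInt_ext _ (fun _ => 0)) by (intros; simpl; ring).
  rewrite (RInt_const (V := R_CompleteNormedModule)); symmetry; apply Rmult_0_r.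
Qed.

(** Normalised so that its mass to the right of [t] is [sinc_sqr_int] for every A > 0, and so that
    [fejer_int G t A / A] is the integral of [G] against it. At [A = 2 * T] it is also the squared
    Dirichlet kernel of height T divided by T. *)
Definition fejer_kernel (t A x : R) : R := A / 2 * sinc (A / 2 * (x - t)) ^ 2.

Lemma continuous_fejer_kernel (t A x : R) : continuous (fejer_kernel t A) x.
Proof.
  apply (continuous_scal_r (V := R_NormedModule)).
  apply (continuous_comp (fun y => sinc (A / 2 * (y - t))) (fun z => z ^ 2)).
  - apply continuous_sinc_lin.
  - apply continuous_derivable; auto_derive; auto.
Qed.

Lemma fejer_kernel_nonneg (t A x : R) : 0 < A -> 0 <= fejer_kernel t A x.
Proof.
  intros HA; apply Rmult_le_pos; [lra | apply pow2_ge_0].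
Qed.

Lemma RInt_cauchy_kernel_le (a t r : R) :
  0 < a -> RInt (fun x => a / (1 + (a * (x - t)) ^ 2)) 0 r <= PI.
Proof.
  intros Ha.
  assert (Hp : forall x, 1 + (a * (x - t)) ^ 2 <> 0)
    by (intros; generalize (pow2_ge_0 (a * (x - t))); lra).
  rewrite (is_RInt_unique _ 0 r (atan (a * (r - t)) - atan (a * (0 - t)))).
  - generalize (atan_bound (a * (r - t))) (atan_bound (a * (0 - t))); lra.
  - apply (is_RInt_derive (V := R_CompleteNormedModule) (fun x => atan (a * (x - t)))).
    + intros x _; auto_derive; auto; specialize (Hp x); eq_in_R; field; simpl in *; lra.
    + intros x _; apply continuous_derivable; auto_derive; auto.
      specialize (Hp x); simpl in *; lra.
Qed.

Lemma half_integrable_cauchy_kernel (a t : R) :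
  0 < a -> half_integrable (fun x => a / (1 + (a * (x - t)) ^ 2)).
Proof.
  intros Ha.
  assert (Hp : forall x, 0 < 1 + (a * (x - t)) ^ 2)
    by (intros; generalize (pow2_ge_0 (a * (x - t))); lra).
  apply half_integrable_nonneg with PI.
  - intros x; apply continuous_derivable; auto_derive; auto.
    specialize (Hp x); simpl in *; lra.
  - intros x _; left; apply Rdiv_lt_0_compat; auto.
  - intros; apply RInt_cauchy_kernel_le; auto.
Qed.

(** Adding sinc^2 <= 1 and y^2 sinc^2 <= 1 gives (1 + y^2) sinc^2 y <= 2, hence a majorant with an
    arctangent as primitive. *)
Lemma fejer_kernel_le (t A x : R) :
  0 < A -> fejer_kernel t A x <= 2 * (A / 2 / (1 + (A / 2 * (x - t)) ^ 2)).
Proof.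
  intros HA; unfold fejer_kernel.
  set (y := A / 2 * (x - t)).
  assert (Hp : 0 < 1 + y ^ 2) by (generalize (pow2_ge_0 y); lra).
  replace (2 * (A / 2 / (1 + y ^ 2))) with (A / 2 * (2 / (1 + y ^ 2))) by (field; lra).
  apply Rmult_le_compat_l; [lra|].
  apply Rmult_le_reg_r with (1 + y ^ 2); auto.
  unfold Rdiv; rewrite Rmult_assoc, Rinv_l by lra.
  generalize (sinc_sqr_le_1 y) (sqr_mul_sinc_sqr_le y); nra.
Qed.

Lemma half_integrable_fejer_kernel (t A : R) : 0 < A -> half_integrable (fejer_kernel t A).
Proof.
  intros HA.
  apply half_integrable_dom with (fun x => 2 * (A / 2 / (1 + (A / 2 * (x - t)) ^ 2))).
  - apply half_integrable_scal, half_integrable_cauchy_kernel; lra.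
  - apply continuous_fejer_kernel.
  - intros x _; rewrite Rabs_pos_eq by (apply fejer_kernel_nonneg; auto).
    apply fejer_kernel_le; auto.
Qed.

Lemma half_int_fejer_kernel_le (t A : R) : 0 < A -> half_int (fejer_kernel t A) <= 2 * PI.
Proof.
  intros HA.
  apply Rle_trans with (half_int (fun x => 2 * (A / 2 / (1 + (A / 2 * (x - t)) ^ 2)))).
  - apply half_int_le.
    + apply half_integrable_fejer_kernel; auto.
    + apply half_integrable_scal, half_integrable_cauchy_kernel; lra.
    + intros; apply fejer_kernel_le; auto.
  - rewrite half_int_scal by (apply half_integrable_cauchy_kernel; lra).
    apply Rmult_le_compat_l; [lra|].
    apply half_int_le_bound.
    + apply half_integrable_cauchy_kernel; lra.
    + intros; apply RInt_cauchy_kernel_le; lra.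
Qed.

Definition sinc_sqr_int : R := half_int (fun x => sinc x ^ 2).

Lemma half_integrable_sinc_sqr : half_integrable (fun x => sinc x ^ 2).
Proof.
  destruct (half_integrable_fejer_kernel 0 2) as [C [B HB]]; [lra|].
  assert (E : forall x, fejer_kernel 0 2 x = sinc x ^ 2).
  { intros x; unfold fejer_kernel; replace (2 / 2 * (x - 0)) with x by field; field. }
  split.
  - intros x; apply continuous_ext with (fejer_kernel 0 2); auto.
  - exists B; intros r Hr; rewrite (RInt_ext _ (fun x => Rabs (fejer_kernel 0 2 x))); auto.
    intros x _; rewrite E; reflexivity.
Qed.

Lemma RInt_fejer_kernel (t A r : R) :
  RInt (fejer_kernel t A) t r = RInt (fun x => sinc x ^ 2) 0 (A / 2 * (r - t)).
Proof.
  assert (H := RInt_comp_lin (V := R_CompleteNormedModule) (fun x => sinc x ^ 2)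
                 (A / 2) (- (A / 2 * t)) t r).
  replace (A / 2 * t + - (A / 2 * t)) with 0 in H by ring.
  replace (A / 2 * r + - (A / 2 * t)) with (A / 2 * (r - t)) in H by ring.
  rewrite <- H by (apply continuous_ex_RInt, half_integrable_continuous, half_integrable_sinc_sqr).
  apply RInt_ext; intros x _; unfold fejer_kernel.
  replace (A / 2 * x + - (A / 2 * t)) with (A / 2 * (x - t)) by ring; reflexivity.
Qed.

Lemma half_int_fejer_kernel_0 (A : R) : 0 < A -> half_int (fejer_kernel 0 A) = sinc_sqr_int.
Proof.
  intros HA; apply half_int_of_lim.
  apply is_lim_ext with (fun r => RInt (fun x => sinc x ^ 2) 0 (A / 2 * r)).
  - intros r; rewrite RInt_fejer_kernel, Rminus_0_r; reflexivity.
  - apply is_lim_comp with p_infty.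
    + apply half_int_lim, half_integrable_sinc_sqr.
    + evar_last; [apply is_lim_scal_l, is_lim_id|].
      apply (is_Rbar_mult_unique (A / 2) p_infty p_infty), is_Rbar_mult_sym.
      apply is_Rbar_mult_p_infty_pos; simpl; lra.
    + exists 0; intros; discriminate.
Qed.

(** The part of the kernel to the right of [t] is a translate of the kernel centred at 0, and the
    rest is nonnegative. *)
Lemma half_int_fejer_kernel_ge (t A : R) :
  0 < A -> 0 <= t -> sinc_sqr_int <= half_int (fejer_kernel t A).
Proof.
  intros HA Ht; rewrite <- (half_int_fejer_kernel_0 A) by auto.
  apply half_int_le_bound; [apply half_integrable_fejer_kernel; auto|].
  intros r Hr.
  replace (RInt (fejer_kernel 0 A) 0 r) with (RInt (fejer_kernel t A) t (r + t)).
  - apply RInt_le_half_int; try lra.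
    + apply half_integrable_fejer_kernel; auto.
    + intros; apply fejer_kernel_nonneg; auto.
  - rewrite !RInt_fejer_kernel; f_equal; ring.
Qed.

(** Approximate identity: continuity of [G] handles the points near [t], and far from [t] the kernel
    is O(1 / (A (x - t)^2)). The mass of the kernel is kept as it is, because on the half-line it
    depends on [A] unless [t] is 0. *)
Lemma fejer_approx (G : R -> R) (t eps : R) :
  half_integrable G -> 0 < eps ->
  exists A0, 0 < A0 /\ forall A, A0 <= A ->
    Rabs (fejer_int G t A / A - G t * half_int (fejer_kernel t A)) <= eps.
Proof.
  intros HG Heps.
  assert (HPI := PI_RGT_0).
  (* The kernel has mass at most 2 PI, so the near part costs at most eps / 2. *)
  set (e1 := eps / (4 * PI)).
  assert (He1 : 0 < e1) by (apply Rdiv_lt_0_compat; lra).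
  assert (Hc := half_integrable_continuous _ HG t).
  apply continuity_pt_filterlim in Hc.
  destruct (Hc e1 He1) as [d [Hd Hcd]].
  simpl in Hcd; unfold R_dist in Hcd.
  assert (Hcd' : forall x, Rabs (x - t) < d -> Rabs (G x - G t) <= e1).
  { intros x Hx; destruct (Req_dec x t) as [->|Hne].
    - replace (G t - G t) with 0 by ring; rewrite Rabs_R0; lra.
    - left; apply Hcd; repeat split; auto. }
  set (I1 := half_int (fun x => Rabs (G x))).
  (* For |y| >= d this constant gives 1 / y^2 <= C2 / (1 + y^2), a majorant that is integrable
     across y = 0 as well. *)
  set (C2 := 1 + / d ^ 2).
  assert (Hd2 : 0 < / d ^ 2) by (apply Rinv_0_lt_compat, pow_lt; auto).
  set (D := 2 * / d ^ 2 * I1 + 2 * Rabs (G t) * C2 * PI).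
  assert (HI1 : 0 <= I1).
  { apply half_int_nonneg; [apply half_integrable_abs; auto | intros; apply Rabs_pos]. }
  assert (HD : 0 <= D).
  { unfold D, C2; generalize (Rabs_pos (G t)); intros HGt.
    apply Rplus_le_le_0_compat.
    - apply Rmult_le_pos; lra.
    - apply Rmult_le_pos; [|lra]; apply Rmult_le_pos; lra. }
  (* The far part integrates to at most D / A, which this threshold brings below eps / 2. *)
  exists (2 * (D + 1) / eps); split; [apply Rdiv_lt_0_compat; lra|].
  intros A HA0.
  assert (HA : 0 < A).
  { eapply Rlt_le_trans; [|exact HA0]; apply Rdiv_lt_0_compat; lra. }
  assert (HKi := half_integrable_fejer_kernel t A HA).
  assert (HCi := half_integrable_cauchy_kernel 1 t Rlt_0_1).
  assert (HGK : half_integrable (fun x => G x * fejer_kernel t A x)).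
  { apply half_integrable_mult with (A / 2); auto.
    - intros; apply continuous_fejer_kernel.
    - intros x _; rewrite Rabs_pos_eq by (apply fejer_kernel_nonneg; auto).
      unfold fejer_kernel; generalize (sinc_sqr_le_1 (A / 2 * (x - t))); nra. }
  assert (E : fejer_int G t A / A = half_int (fun x => G x * fejer_kernel t A x)).
  { unfold fejer_int.
    rewrite (half_int_ext _ (fun x => A * (G x * fejer_kernel t A x))).
    - rewrite half_int_scal; auto; field; lra.
    - intros x _; unfold fejer_kernel; field. }
  rewrite E, <- half_int_scal, <- half_int_minus; auto; try (apply half_integrable_scal; auto).
  set (b := fun x => e1 * fejer_kernel t A x +
              (2 * / d ^ 2 / A * Rabs (G x)
               + 2 * Rabs (G t) * C2 / A * (1 / (1 + (1 * (x - t)) ^ 2)))).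
  assert (Hb : half_integrable b).
  { apply half_integrable_plus; [apply half_integrable_scal; auto|].
    apply half_integrable_plus; apply half_integrable_scal; auto.
    apply half_integrable_abs; auto. }
  apply Rle_trans with (half_int b).
  - apply half_int_abs_le; auto.
    + apply half_integrable_minus; auto; apply half_integrable_scal; auto.
    + intros x _; unfold b.
      rewrite <- Rmult_minus_distr_r, Rabs_mult.
      rewrite (Rabs_pos_eq (fejer_kernel t A x)) by (apply fejer_kernel_nonneg; auto).
      assert (HK0 := fejer_kernel_nonneg t A x HA).
      assert (HG0 := Rabs_pos (G x)). assert (HGt := Rabs_pos (G t)).
      assert (HiA := Rinv_0_lt_compat _ HA).
      set (y := x - t) in *.
      assert (Hy2 := pow2_ge_0 y).
      assert (Hq : 0 < 1 / (1 + (1 * y) ^ 2)).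
      { apply Rdiv_lt_0_compat; [lra|]; rewrite Rmult_1_l; lra. }
      assert (HC2 : 0 < C2) by (unfold C2; lra).
      assert (P1 : 0 <= 2 * / d ^ 2 / A * Rabs (G x)).
      { apply Rmult_le_pos; auto; apply Rmult_le_pos; lra. }
      assert (P2 : 0 <= 2 * Rabs (G t) * C2 / A * (1 / (1 + (1 * y) ^ 2))).
      { apply Rmult_le_pos; [|lra]; apply Rmult_le_pos; [|lra]; apply Rmult_le_pos; lra. }
      destruct (Rlt_dec (Rabs y) d) as [Hlt|Hge].
      * assert (Rabs (G x - G t) * fejer_kernel t A x <= e1 * fejer_kernel t A x)
          by (apply Rmult_le_compat_r; auto).
        lra.
      * assert (Hyd : d ^ 2 <= y ^ 2).
        { rewrite <- (pow2_abs y); apply pow_incr; lra. }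
        assert (Hd2' : 0 < d ^ 2) by (apply pow_lt; auto).
        assert (Hyp : 0 < y ^ 2) by lra.
        assert (Hyn : y <> 0) by (intros H0; rewrite H0 in Hyp; lra).
        assert (Hiy : / y ^ 2 <= / d ^ 2) by (apply Rinv_le_contravar; auto).
        assert (HK : fejer_kernel t A x <= 2 / A * / y ^ 2).
        { unfold fejer_kernel; fold y.
          assert (HS := sqr_mul_sinc_sqr_le (A / 2 * y)).
          apply Rmult_le_reg_r with (A / 2 * y ^ 2).
          - apply Rmult_lt_0_compat; lra.
          - replace (2 / A * / y ^ 2 * (A / 2 * y ^ 2)) with 1 by (field; lra).
            replace (A / 2 * sinc (A / 2 * y) ^ 2 * (A / 2 * y ^ 2))
              with ((A / 2 * y) ^ 2 * sinc (A / 2 * y) ^ 2) by ring.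
            exact HS. }
        assert (Hiy2 : / y ^ 2 <= C2 * (1 / (1 + (1 * y) ^ 2))).
        { rewrite Rmult_1_l; apply Rmult_le_reg_r with (1 + y ^ 2); [lra|].
          replace (C2 * (1 / (1 + y ^ 2)) * (1 + y ^ 2)) with C2 by (field; lra).
          unfold C2; rewrite Rmult_plus_distr_l, Rinv_l, Rmult_1_r, Rplus_comm by lra.
          apply Rplus_le_compat_l; exact Hiy. }
        assert (Htri : Rabs (G x - G t) <= Rabs (G x) + Rabs (G t)).
        { unfold Rminus; rewrite <- (Rabs_Ropp (G t)); apply Rabs_triang. }
        apply Rle_trans with ((Rabs (G x) + Rabs (G t)) * (2 / A * / y ^ 2)).
        { apply Rmult_le_compat; auto; apply Rabs_pos. }
        assert (Q1 : Rabs (G x) * (2 / A * / y ^ 2) <= 2 * / d ^ 2 / A * Rabs (G x)).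
        { replace (2 * / d ^ 2 / A * Rabs (G x)) with (Rabs (G x) * (2 / A * / d ^ 2))
            by (field; lra).
          apply Rmult_le_compat_l; auto; apply Rmult_le_compat_l; auto.
          apply Rmult_le_pos; lra. }
        assert (Q2 : Rabs (G t) * (2 / A * / y ^ 2)
                     <= 2 * Rabs (G t) * C2 / A * (1 / (1 + (1 * y) ^ 2))).
        { replace (2 * Rabs (G t) * C2 / A * (1 / (1 + (1 * y) ^ 2)))
            with (Rabs (G t) * (2 / A * (C2 * (1 / (1 + (1 * y) ^ 2))))).
          2:{ rewrite Rmult_1_l; field; split; lra. }
          apply Rmult_le_compat_l; auto; apply Rmult_le_compat_l; auto.
          apply Rmult_le_pos; lra. }
        assert (0 <= e1 * fejer_kernel t A x) by (apply Rmult_le_pos; lra).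
        lra.
  - unfold b; rewrite half_int_plus, half_int_plus, !half_int_scal; auto;
      try (apply half_integrable_scal; auto); try apply half_integrable_abs; auto.
    2:{ apply half_integrable_plus; apply half_integrable_scal; auto.
        apply half_integrable_abs; auto. }
    assert (HK := half_int_fejer_kernel_le t A HA).
    assert (HC : half_int (fun x => 1 / (1 + (1 * (x - t)) ^ 2)) <= PI).
    { apply half_int_le_bound; auto; intros; apply RInt_cauchy_kernel_le; lra. }
    fold I1.
    assert (T1 : e1 * half_int (fejer_kernel t A) <= eps / 2).
    { apply Rle_trans with (e1 * (2 * PI)).
      - apply Rmult_le_compat_l; lra.
      - unfold e1; right; field; lra. }
    assert (T2 : 2 * Rabs (G t) * C2 / A * half_int (fun x => 1 / (1 + (1 * (x - t)) ^ 2))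
                 <= 2 * Rabs (G t) * C2 / A * PI).
    { apply Rmult_le_compat_l; auto.
      apply Rmult_le_pos; [|left; apply Rinv_0_lt_compat; auto].
      unfold C2; generalize (Rabs_pos (G t)); intros; apply Rmult_le_pos; lra. }
    assert (T3 : 2 * / d ^ 2 / A * I1 + 2 * Rabs (G t) * C2 / A * PI = D / A).
    { unfold D; field; split; lra. }
    assert (T4 : D / A <= eps / 2).
    { apply Rmult_le_reg_r with A; auto.
      unfold Rdiv at 1; rewrite Rmult_assoc, Rinv_l, Rmult_1_r by lra.
      apply Rmult_le_compat_l with (r := eps / 2) in HA0; [|lra].
      replace (eps / 2 * (2 * (D + 1) / eps)) with (D + 1) in HA0 by (field; lra).
      lra. }
    lra.
Qed.

(** Cesaro averaging: as a primitive of the Dirichlet integral, [fejer_int] grows at most like m A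
    plus a constant, while its quotient by A tends to [sinc_sqr_int * G 0]. Convergence of the
    Dirichlet integral itself is never asked for. *)
Lemma fejer_upper (G : R -> R) (m T : R) :
  half_integrable G -> (forall A, T <= A -> dirichlet_int G 0 A <= m) ->
  sinc_sqr_int * G 0 <= m.
Proof.
  intros HG Hm; apply Rnot_lt_le; intros Hlt.
  set (e := (sinc_sqr_int * G 0 - m) / 3).
  assert (He : 0 < e) by (unfold e; lra).
  destruct (fejer_approx G 0 e HG He) as [A0 [HA0 HA]].
  set (D := fejer_int G 0 T - m * T).
  set (A := Rmax A0 (Rmax (T + 1) (Rabs D / e))).
  assert (H1 : A0 <= A) by apply Rmax_l.
  assert (H2 : T + 1 <= A) by (eapply Rle_trans; [apply Rmax_l | apply Rmax_r]).
  assert (H3 : Rabs D / e <= A) by (eapply Rle_trans; [apply Rmax_r | apply Rmax_r]).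
  specialize (HA A H1).
  rewrite half_int_fejer_kernel_0 in HA by lra.
  destruct (MVT_gen (fejer_int G 0) T A (dirichlet_int G 0)) as [c [Hc E]].
  { intros; apply is_derive_fejer_int; auto. }
  { intros; apply continuity_pt_derivable; eexists; apply is_derive_fejer_int; auto. }
  rewrite Rmin_left, Rmax_right in Hc by lra.
  assert (Hd := Hm c (proj1 Hc)).
  assert (HPsi : fejer_int G 0 A <= m * A + D) by (unfold D; nra).
  assert (HD : D <= e * A).
  { apply Rmult_le_compat_r with (r := e) in H3; [|lra].
    replace (Rabs D / e * e) with (Rabs D) in H3 by (field; lra).
    generalize (Rle_abs D); lra. }
  apply Rabs_le_between in HA.
  assert (HQ : fejer_int G 0 A / A <= m + e).
  { apply Rmult_le_reg_r with A; [lra|].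
    unfold Rdiv; rewrite Rmult_assoc, Rinv_l, Rmult_1_r by lra; lra. }
  unfold e in *; lra.
Qed.

Lemma fejer_lower (G : R -> R) (m T : R) :
  half_integrable G -> (forall A, T <= A -> m <= dirichlet_int G 0 A) ->
  m <= sinc_sqr_int * G 0.
Proof.
  intros HG Hm.
  cut (sinc_sqr_int * (-1 * G 0) <= - m); [lra|].
  apply (fejer_upper (fun x => -1 * G x) (- m) T).
  - apply half_integrable_scal; auto.
  - intros A HA; specialize (Hm A HA); unfold dirichlet_int in *.
    rewrite (half_int_ext _ (fun x => -1 * (G x * (A * sinc (A * (x - 0))))))
      by (intros; ring).
    rewrite half_int_scal by (apply half_integrable_dirichlet; auto); lra.
Qed.

(** * The integral of sinc squared, evaluated through the test function exp (- x) *)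

Lemma is_lim_exp_neg (k : R) : 0 < k -> is_lim (fun x => exp (- k * x)) p_infty 0.
Proof.
  intros Hk; apply is_lim_comp with m_infty.
  - apply is_lim_exp_m.
  - evar_last; [apply is_lim_scal_l, is_lim_id|].
    apply (is_Rbar_mult_unique (- k) p_infty m_infty), is_Rbar_mult_sym.
    apply is_Rbar_mult_p_infty_neg; simpl; lra.
  - exists 0; intros; discriminate.
Qed.

Lemma cosine_int_exp (A : R) : cosine_int (fun x => exp (- (1) * x)) 0 A = / (1 + A ^ 2).
Proof.
  assert (Hp : 0 < 1 + A ^ 2) by (generalize (pow2_ge_0 A); lra).
  set (H := fun x => exp (- (1) * x) * ((A * sin (A * x) - cos (A * x)) / (1 + A ^ 2))).
  unfold cosine_int; apply half_int_of_lim.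
  replace (/ (1 + A ^ 2)) with (0 - H 0).
  2:{ unfold H; rewrite !Rmult_0_r, exp_0, sin_0, cos_0; field; lra. }
  apply half_int_primitive.
  - apply half_integrable_continuous, half_integrable_cosine, half_integrable_exp; lra.
  - intros x; unfold H; auto_derive; auto.
    rewrite !Rminus_0_r; eq_in_R; field; lra.
  - set (K := (Rabs A + 1) / (1 + A ^ 2)).
    apply is_lim_le_le_loc with (fun x => - K * exp (- (1) * x)) (fun x => K * exp (- (1) * x)).
    + exists 0; intros x _; unfold H.
      assert (HK : Rabs ((A * sin (A * x) - cos (A * x)) / (1 + A ^ 2)) <= K).
      { unfold K, Rdiv; rewrite Rabs_mult, Rabs_inv, (Rabs_pos_eq (1 + A ^ 2)) by lra.
        apply Rmult_le_compat_r; [left; apply Rinv_0_lt_compat; auto|].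
        unfold Rminus; eapply Rle_trans; [apply Rabs_triang|].
        rewrite Rabs_Ropp, Rabs_mult.
        assert (Rabs (sin (A * x)) <= 1) by (apply Rabs_le, SIN_bound).
        assert (Rabs (cos (A * x)) <= 1) by (apply Rabs_le, COS_bound).
        generalize (Rabs_pos A); nra. }
      apply Rabs_le_between in HK; generalize (exp_pos (- (1) * x)); nra.
    + evar_last; [apply is_lim_scal_l, is_lim_exp_neg, Rlt_0_1 | simpl; f_equal; ring].
    + evar_last; [apply is_lim_scal_l, is_lim_exp_neg, Rlt_0_1 | simpl; f_equal; ring].
Qed.

(** Both sides vanish at 0 and have derivative 1 / (1 + A^2). *)
Lemma dirichlet_int_exp (A : R) :
  0 < A -> dirichlet_int (fun x => exp (- (1) * x)) 0 A = atan A.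
Proof.
  intros HA; set (G := fun x => exp (- (1) * x)).
  assert (HG : half_integrable G) by (apply half_integrable_exp; lra).
  assert (HxG : half_integrable (fun x => x * G x)).
  { assert (H := half_integrable_pow_exp 1 1 Rlt_0_1).
    apply half_integrable_dom with (2 := fun x =>
      continuous_derivable (fun x => x * G x) x ltac:(unfold G; auto_derive; auto))
      (b := fun x => x ^ 1 * exp (- (1) * x)); auto.
    intros x Hx; unfold G; rewrite pow_1, Rabs_pos_eq; [lra|].
    apply Rmult_le_pos; [auto | left; apply exp_pos]. }
  cut (dirichlet_int G 0 0 - atan 0 = dirichlet_int G 0 A - atan A).
  { rewrite dirichlet_int_0, atan_0; lra. }
  apply (eq_is_derive (fun y => dirichlet_int G 0 y - atan y)); auto.
  intros y _.
  replace (@zero R_NormedModule) with (cosine_int G 0 y - / (1 + y ^ 2)).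
  - apply (is_derive_minus (V := R_NormedModule)).
    + apply is_derive_dirichlet_int; auto.
    + evar_last; [apply is_derive_atan|]; unfold Rsqr; eq_in_R; simpl; rewrite Rmult_1_r; reflexivity.
  - unfold G; rewrite cosine_int_exp; unfold zero; simpl; ring.
Qed.

(** For the test function the Dirichlet integral is atan A, which increases to PI / 2; the upper and
    lower Fejer bounds squeeze [sinc_sqr_int] times the value 1 at the origin. *)
Lemma sinc_sqr_int_eq : sinc_sqr_int = PI / 2.
Proof.
  assert (HG : half_integrable (fun x => exp (- (1) * x))) by (apply half_integrable_exp; lra).
  replace sinc_sqr_int with (sinc_sqr_int * exp (- (1) * 0))
    by (rewrite Rmult_0_r, exp_0; ring).
  apply Rle_antisym.
  - apply (fejer_upper (fun x => exp (- (1) * x)) (PI / 2) 1); auto.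
    intros A HA; rewrite dirichlet_int_exp by lra; left; apply atan_bound.
  - apply le_epsilon; intros e He.
    assert (HPI := PI_RGT_0).
    (* The cap PI / 4 keeps [m] between 0 and PI / 2, where [tan m] is positive and [atan] inverts
       it. *)
    set (m := PI / 2 - Rmin e (PI / 4)).
    assert (Hm : 0 < Rmin e (PI / 4)) by (apply Rmin_pos; lra).
    assert (Hm1 := Rmin_l e (PI / 4)). assert (Hm2 := Rmin_r e (PI / 4)).
    cut (m <= sinc_sqr_int * exp (- (1) * 0)); [unfold m; lra|].
    apply (fejer_lower (fun x => exp (- (1) * x)) m (tan m)); auto.
    assert (Htan : 0 < tan m) by (apply tan_gt_0; unfold m; lra).
    intros A HA; rewrite dirichlet_int_exp by lra.
    rewrite <- (atan_tan m) by (unfold m; lra).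
    destruct HA as [HA| ->]; [left; apply atan_increasing; auto | lra].
Qed.

(** * Goursat's theorem on squares *)

(** Differentiability at one point of the form P dx + Q dy; the shared coefficient [be] is the
    closedness condition dP/dy = dQ/dx. No continuity of the partial derivatives is built in. *)
Definition is_closed_at (P Q : R -> R -> R) (x0 y0 : R) : Prop :=
  exists al be ga, forall eta, 0 < eta -> exists d, 0 < d /\ forall x y,
    Rabs (x - x0) < d -> Rabs (y - y0) < d ->
    Rabs (P x y - P x0 y0 - (al * (x - x0) + be * (y - y0)))
      <= eta * (Rabs (x - x0) + Rabs (y - y0)) /\
    Rabs (Q x y - Q x0 y0 - (be * (x - x0) + ga * (y - y0)))
      <= eta * (Rabs (x - x0) + Rabs (y - y0)).

Lemma linear_approx_continuous (f : R -> R) (x0 l : R) :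
  (exists d, 0 < d /\ forall x, Rabs (x - x0) < d ->
     Rabs (f x - f x0 - l * (x - x0)) <= 1 * Rabs (x - x0)) -> continuous f x0.
Proof.
  intros [d [Hd H]]; apply continuity_pt_filterlim; intros eps Heps.
  set (K := Rabs l + 1).
  assert (HK : 0 < K) by (unfold K; generalize (Rabs_pos l); lra).
  exists (Rmin d (eps / K)); split.
  - apply Rmin_pos; auto; apply Rdiv_lt_0_compat; auto.
  - intros x [_ Hx]; simpl in *; unfold R_dist in *.
    assert (H1 : Rabs (x - x0) < d) by (eapply Rlt_le_trans; [apply Hx | apply Rmin_l]).
    assert (H2 : Rabs (x - x0) < eps / K) by (eapply Rlt_le_trans; [apply Hx | apply Rmin_r]).
    specialize (H x H1).
    replace (f x - f x0) with ((f x - f x0 - l * (x - x0)) + l * (x - x0)) by ring.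
    eapply Rle_lt_trans; [apply Rabs_triang|]; rewrite Rabs_mult.
    apply Rmult_lt_compat_r with (r := K) in H2; auto.
    unfold Rdiv in H2; rewrite Rmult_assoc, Rinv_l, Rmult_1_r in H2 by lra.
    unfold K in *; lra.
Qed.

Section Goursat.

Variables P Q : R -> R -> R.
Hypothesis HPQ : forall x y, is_closed_at P Q x y.

Lemma closed_continuous_Px (x y : R) : continuous (fun t => P t y) x.
Proof.
  destruct (HPQ x y) as [al [be [ga H]]].
  destruct (H 1 Rlt_0_1) as [d [Hd Hx]].
  apply linear_approx_continuous with al; exists d; split; auto; intros t Ht.
  destruct (Hx t y Ht) as [H1 _]; [rewrite Rminus_diag, Rabs_R0; auto|].
  rewrite Rminus_diag, Rabs_R0, Rmult_0_r, !Rplus_0_r in H1; exact H1.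
Qed.

Lemma closed_continuous_Qy (x y : R) : continuous (fun t => Q x t) y.
Proof.
  destruct (HPQ x y) as [al [be [ga H]]].
  destruct (H 1 Rlt_0_1) as [d [Hd Hx]].
  apply linear_approx_continuous with ga; exists d; split; auto; intros t Ht.
  destruct (Hx x t) as [_ H1]; auto; [rewrite Rminus_diag, Rabs_R0; auto|].
  rewrite Rminus_diag, Rabs_R0, Rmult_0_r, !Rplus_0_l in H1; exact H1.
Qed.

(** The integral of P dx + Q dy taken counterclockwise around the square with lower left corner (a,
    b). *)
Definition square_int (a b s : R) : R :=
  (RInt (fun x => P x b) a (a + s) - RInt (fun x => P x (b + s)) a (a + s))
  + (RInt (fun y => Q (a + s) y) b (b + s) - RInt (fun y => Q a y) b (b + s)).

Lemma square_int_split (a b h : R) :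
  square_int a b (2 * h) = square_int a b h + square_int (a + h) b h
    + square_int a (b + h) h + square_int (a + h) (b + h) h.
Proof.
  unfold square_int.
  replace (a + 2 * h) with (a + h + h) by ring.
  replace (b + 2 * h) with (b + h + h) by ring.
  rewrite (RInt_split (fun x => P x b) a (a + h) (a + h + h))
    by (intros; apply closed_continuous_Px).
  rewrite (RInt_split (fun x => P x (b + h + h)) a (a + h) (a + h + h))
    by (intros; apply closed_continuous_Px).
  rewrite (RInt_split (fun y => Q (a + h + h) y) b (b + h) (b + h + h))
    by (intros; apply closed_continuous_Qy).
  rewrite (RInt_split (fun y => Q a y) b (b + h) (b + h + h))
    by (intros; apply closed_continuous_Qy).
  ring.
Qed.

Lemma Rabs_RInt_minus_const_le (f : R -> R) (a s k B : R) :
  (forall x, continuous f x) -> 0 <= s ->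
  (forall x, a <= x <= a + s -> Rabs (f x - k) <= B) ->
  Rabs (RInt f a (a + s) - k * s) <= B * s.
Proof.
  intros Cf Hs Hf.
  assert (E : forall c, RInt (fun _ => c) a (a + s) = c * s).
  { intros c; rewrite (RInt_const (V := R_CompleteNormedModule)).
    unfold scal; simpl; unfold mult; simpl; ring. }
  assert (Cc : forall c x : R, continuous (fun _ : R => c) x) by (intros; apply continuous_const).
  apply Rabs_le; split.
  - cut (RInt (fun _ => k - B) a (a + s) <= RInt f a (a + s)); [rewrite E; lra|].
    apply RInt_le_on; auto; [lra|]; intros x Hx.
    assert (H := Hf x ltac:(lra)); apply Rabs_le_between in H; lra.
  - cut (RInt f a (a + s) <= RInt (fun _ => k + B) a (a + s)); [rewrite E; lra|].
    apply RInt_le_on; auto; [lra|]; intros x Hx.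
    assert (H := Hf x ltac:(lra)); apply Rabs_le_between in H; lra.
Qed.

(** The linear parts contribute - be s^2 and be s^2, which cancel by closedness. The remaining error
    is at most 2 eta s at each point of the boundary, and four sides of length s make 8 eta s^2. *)
Lemma square_int_small (x0 y0 eta : R) :
  0 < eta -> exists d, 0 < d /\ forall a b s, 0 <= s -> s < d ->
    a <= x0 <= a + s -> b <= y0 <= b + s -> Rabs (square_int a b s) <= 8 * eta * s ^ 2.
Proof.
  intros Heta; destruct (HPQ x0 y0) as [al [be [ga H]]].
  destruct (H eta Heta) as [d [Hd Hx]].
  exists d; split; auto; intros a b s Hs Hsd Ha Hb.
  assert (Hin : forall x y, a <= x <= a + s -> b <= y <= b + s ->
    Rabs (P x y - P x0 y0 - (al * (x - x0) + be * (y - y0))) <= eta * (2 * s) /\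
    Rabs (Q x y - Q x0 y0 - (be * (x - x0) + ga * (y - y0))) <= eta * (2 * s)).
  { intros x y Hxx Hyy.
    assert (H1 : Rabs (x - x0) <= s) by (apply Rabs_le; lra).
    assert (H2 : Rabs (y - y0) <= s) by (apply Rabs_le; lra).
    destruct (Hx x y) as [H3 H4]; try lra.
    assert (eta * (Rabs (x - x0) + Rabs (y - y0)) <= eta * (2 * s))
      by (apply Rmult_le_compat_l; lra).
    split; lra. }
  assert (HP : Rabs (RInt (fun x => P x b - P x (b + s)) a (a + s) - (- be * s) * s)
               <= (4 * eta * s) * s).
  { apply Rabs_RInt_minus_const_le; auto.
    - intros; apply (continuous_minus (V := R_NormedModule)); apply closed_continuous_Px.
    - intros x Hxx.
      destruct (Hin x b Hxx ltac:(lra)) as [H1 _].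
      destruct (Hin x (b + s) Hxx ltac:(lra)) as [H2 _].
      apply Rabs_le_between in H1; apply Rabs_le_between in H2; apply Rabs_le; lra. }
  assert (HQ : Rabs (RInt (fun y => Q (a + s) y - Q a y) b (b + s) - (be * s) * s)
               <= (4 * eta * s) * s).
  { apply Rabs_RInt_minus_const_le; auto.
    - intros; apply (continuous_minus (V := R_NormedModule)); apply closed_continuous_Qy.
    - intros y Hyy.
      destruct (Hin a y ltac:(lra) Hyy) as [_ H1].
      destruct (Hin (a + s) y ltac:(lra) Hyy) as [_ H2].
      apply Rabs_le_between in H1; apply Rabs_le_between in H2; apply Rabs_le; lra. }
  rewrite (RInt_sub (fun x => P x b) (fun x => P x (b + s))) in HP
    by (intros; apply closed_continuous_Px).
  rewrite (RInt_sub (fun y => Q (a + s) y) (fun y => Q a y)) in HQ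
    by (intros; apply closed_continuous_Qy).
  unfold square_int.
  apply Rabs_le_between in HP; apply Rabs_le_between in HQ; apply Rabs_le; simpl in *; split; lra.
Qed.

(** Looks for a quarter whose integral is at least [e] times its area. If the parent square has this
    property and three quarters fail, the triangle inequality leaves the fourth. *)
Definition next_square (e : R) (p : R * R) (h : R) : R * R :=
  let (a, b) := p in
  if Rle_dec (e * h ^ 2) (Rabs (square_int a b h)) then (a, b)
  else if Rle_dec (e * h ^ 2) (Rabs (square_int (a + h) b h)) then (a + h, b)
  else if Rle_dec (e * h ^ 2) (Rabs (square_int a (b + h) h)) then (a, b + h)
  else (a + h, b + h).

Fixpoint nested_square (e : R) (p : R * R) (s : R) (n : nat) : R * R :=
  match n with
  | O => p
  | S m => next_square e (nested_square e p s m) (s / 2 ^ S m)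
  end.

Lemma next_square_spec (e h a b : R) :
  0 <= h -> e * (2 * h) ^ 2 <= Rabs (square_int a b (2 * h)) ->
  let p := next_square e (a, b) h in
  e * h ^ 2 <= Rabs (square_int (fst p) (snd p) h) /\
  a <= fst p <= a + h /\ b <= snd p <= b + h.
Proof.
  intros Hh H; rewrite square_int_split in H; unfold next_square.
  destruct Rle_dec as [H1|H1]; [simpl; repeat split; auto; lra|].
  destruct Rle_dec as [H2|H2]; [simpl; repeat split; auto; lra|].
  destruct Rle_dec as [H3|H3]; [simpl; repeat split; auto; lra|].
  simpl; repeat split; try lra.
  apply Rnot_le_lt in H1; apply Rnot_le_lt in H2; apply Rnot_le_lt in H3.
  match type of H with _ <= Rabs (?x1 + ?x2 + ?x3 + ?x4) =>
    assert (T1 := Rabs_triang (x1 + x2 + x3) x4);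
    assert (T2 := Rabs_triang (x1 + x2) x3);
    assert (T3 := Rabs_triang x1 x2) end.
  simpl in *; lra.
Qed.

Lemma nested_intervals (u l : nat -> R) :
  (forall n, u n <= u (S n)) -> (forall n, u (S n) + l (S n) <= u n + l n) ->
  (forall n, 0 <= l n) -> exists x, forall n, u n <= x <= u n + l n.
Proof.
  intros Hu Hl H0.
  assert (Hmono : forall n k, u n <= u (n + k)%nat /\ u (n + k)%nat + l (n + k)%nat <= u n + l n).
  { intros n k; induction k as [|k [I1 I2]].
    - rewrite Nat.add_0_r; lra.
    - rewrite Nat.add_succ_r; generalize (Hu (n + k)%nat) (Hl (n + k)%nat); lra. }
  assert (Hle : forall m n, u m <= u n + l n).
  { intros m n; destruct (Hmono m n) as [I1 _]; destruct (Hmono n m) as [_ I2].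
    rewrite (Nat.add_comm n m) in I2; generalize (H0 (m + n)%nat); lra. }
  destruct (completeness (fun y => exists n, y = u n)) as [x [Hx1 Hx2]].
  - exists (u O + l O); intros y [n ->]; auto.
  - exists (u O), O; auto.
  - exists x; intros n; split.
    + apply Hx1; exists n; auto.
    + apply Hx2; intros y [m ->]; auto.
Qed.

(* Bisection as in Goursat's theorem: only pointwise differentiability is available. *)
Lemma square_int_zero (a b s : R) : 0 < s -> square_int a b s = 0.
Proof.
  intros Hs.
  destruct (Req_dec (square_int a b s) 0) as [H0|H0]; auto; exfalso.
  (* The integral per unit area, which the bisection never lets fall. *)
  set (e := Rabs (square_int a b s) / s ^ 2).
  assert (Hs2 : 0 < s ^ 2) by (apply pow_lt; auto).
  assert (He : 0 < e) by (apply Rdiv_lt_0_compat; auto; apply Rabs_pos_lt; auto).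
  set (l := fun n => s / 2 ^ n).
  set (p := nested_square e (a, b) s).
  assert (Hl : forall n, 0 < l n) by (intros; apply Rdiv_lt_0_compat; auto; apply pow_lt; lra).
  assert (Hl2 : forall n, l n = 2 * l (S n)).
  { intros n; unfold l; simpl; field; apply pow_nonzero; lra. }
  assert (Hstep : forall n, e * l n ^ 2 <= Rabs (square_int (fst (p n)) (snd (p n)) (l n)) ->
     e * l (S n) ^ 2 <= Rabs (square_int (fst (p (S n))) (snd (p (S n))) (l (S n))) /\
     fst (p n) <= fst (p (S n)) <= fst (p n) + l (S n) /\
     snd (p n) <= snd (p (S n)) <= snd (p n) + l (S n)).
  { intros n Hn; rewrite Hl2 in Hn.
    assert (H := next_square_spec e (l (S n)) (fst (p n)) (snd (p n)) (Rlt_le _ _ (Hl (S n))) Hn).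
    rewrite <- surjective_pairing in H; exact H. }
  assert (Hinv : forall n, e * l n ^ 2 <= Rabs (square_int (fst (p n)) (snd (p n)) (l n))).
  { induction n as [|n IH]; [|apply Hstep; auto].
    unfold l, p, e; simpl; right; rewrite !Rdiv_1_r; field; lra. }
  destruct (nested_intervals (fun n => fst (p n)) l) as [x0 Hx0].
  { intros n; apply (Hstep n (Hinv n)). }
  { intros n; destruct (Hstep n (Hinv n)) as [_ [H _]]; rewrite (Hl2 n); lra. }
  { intros; left; auto. }
  destruct (nested_intervals (fun n => snd (p n)) l) as [y0 Hy0].
  { intros n; apply (Hstep n (Hinv n)). }
  { intros n; destruct (Hstep n (Hinv n)) as [_ [_ H]]; rewrite (Hl2 n); lra. }
  { intros; left; auto. }
  (* The local bound becomes 8 (e / 16) = e / 2 times the area, against the invariant e times the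
     area. *)
  destruct (square_int_small x0 y0 (e / 16)) as [d [Hd Hsm]]; [lra|].
  destruct (pow_lt_1_zero (/ 2)) with (y := d / s) as [N HN].
  { rewrite Rabs_pos_eq; lra. }
  { apply Rdiv_lt_0_compat; auto. }
  specialize (HN N (Nat.le_refl N)).
  assert (HlN : l N < d).
  { rewrite Rabs_pos_eq in HN by (apply pow_le; lra).
    unfold l, Rdiv; rewrite <- pow_inv.
    apply Rmult_lt_compat_l with (r := s) in HN; auto.
    replace (s * (d / s)) with d in HN by (field; lra); exact HN. }
  specialize (Hsm (fst (p N)) (snd (p N)) (l N) (Rlt_le _ _ (Hl N)) HlN (Hx0 N) (Hy0 N)).
  specialize (Hinv N).
  assert (0 < e * l N ^ 2) by (apply Rmult_lt_0_compat; auto; apply pow_lt; auto).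
  lra.
Qed.

End Goursat.

(** An epsilon-delta form that depends on [Cmod] alone, so that it can mediate between the two
    normed-module structures on the complex numbers. *)
Definition C_deriv (F : C -> C) (z l : C) : Prop :=
  forall eps, 0 < eps -> exists d, 0 < d /\ forall w, Cmod (w - z) < d ->
    Cmod (F w - F z - (w - z) * l) <= eps * Cmod (w - z).

Lemma C_deriv_of_ex_derive (F : C -> C) (z : C) :
  @ex_derive C_AbsRing C_NormedModule F z -> exists l, C_deriv F z l.
Proof.
  intros [l [_ H]]; exists l; intros eps Heps.
  destruct (H z (fun P HP => HP) (mkposreal eps Heps)) as [d Hd].
  exists d; split; [apply cond_pos|].
  intros w Hw; exact (Hd w Hw).
Qed.

Lemma ex_derive_of_C_deriv (F : C -> C) (z l : C) :
  C_deriv F z l -> @ex_derive C_AbsRing C_NormedModule F z.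
Proof.
  intros H; exists l; split.
  - apply (is_linear_scal_l (V := C_NormedModule)).
  - intros z' Hz'.
    apply (is_filter_lim_locally_unique (V := AbsRing_NormedModule C_AbsRing)) in Hz'.
    rewrite <- Hz'; intros eps.
    destruct (H eps (cond_pos eps)) as [d [Hd Hw]].
    exists (mkposreal d Hd); intros w Hwz; exact (Hw w Hwz).
Qed.

Lemma entire_C_deriv (F : C -> C) :
  entire F <-> forall z, exists l, C_deriv F z l.
Proof.
  split; intros H z.
  - apply C_deriv_of_ex_derive, H.
  - destruct (H z) as [l Hl]; apply ex_derive_of_C_deriv with l; auto.
Qed.

Lemma Cmod_le_Rabs_add (x y : R) : Cmod (x, y) <= Rabs x + Rabs y.
Proof.
  replace (x, y) with (RtoC x + (0, y))%C
    by (unfold RtoC, Cplus; simpl; f_equal; ring).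
  eapply Rle_trans; [apply Cmod_triangle|]; rewrite Cmod_R.
  apply Rplus_le_compat_l.
  unfold Cmod; simpl; replace (0 * (0 * 1) + y * (y * 1)) with (y²) by (unfold Rsqr; ring).
  rewrite sqrt_Rsqr_abs; lra.
Qed.

Lemma Rabs_fst_le_Cmod (z : C) : Rabs (fst z) <= Cmod z.
Proof. eapply Rle_trans; [apply Rmax_l | apply Rmax_Cmod]. Qed.

Lemma Rabs_snd_le_Cmod (z : C) : Rabs (snd z) <= Cmod z.
Proof. eapply Rle_trans; [apply Rmax_r | apply Rmax_Cmod]. Qed.

(** The form is the real part of F dz, and the Cauchy-Riemann equations are the symmetry of its
    Jacobian. *)
Lemma entire_is_closed_at (F : C -> C) :
  entire F -> forall x y,
  is_closed_at (fun x y => fst (F (x, y))) (fun x y => - snd (F (x, y))) x y.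
Proof.
  intros HF x y; destruct (C_deriv_of_ex_derive F (x, y) (HF (x, y))) as [[l1 l2] Hl].
  exists l1, (- l2), (- l1); intros eta Heta.
  destruct (Hl eta Heta) as [d [Hd H]].
  (* The radius is halved because [Cmod] is estimated by the sum of the two coordinates. *)
  exists (d / 2); split; [lra|]; intros u v Hu Hv.
  assert (E : ((u, v) - (x, y))%C = (u - x, v - y)) by reflexivity.
  assert (Hm := Cmod_le_Rabs_add (u - x) (v - y)).
  specialize (H (u, v)); rewrite E in H; specialize (H ltac:(lra)).
  assert (Hm' : eta * Cmod (u - x, v - y) <= eta * (Rabs (u - x) + Rabs (v - y)))
    by (apply Rmult_le_compat_l; lra).
  assert (H1 := Rle_trans _ _ _ (Rabs_fst_le_Cmod _) H).
  assert (H2 := Rle_trans _ _ _ (Rabs_snd_le_Cmod _) H).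
  destruct (F (u, v)) as [p q]; destruct (F (x, y)) as [p0 q0]; simpl in *.
  split.
  - replace (p - p0 - (l1 * (u - x) + - l2 * (v - y)))
      with (p + - p0 + - ((u - x) * l1 - (v - y) * l2)) by ring; lra.
  - rewrite <- Rabs_Ropp.
    replace (- (- q - - q0 - (- l2 * (u - x) + - l1 * (v - y))))
      with (q + - q0 + - ((u - x) * l2 + (v - y) * l1)) by ring; lra.
Qed.

Lemma entire_square_int (F : C -> C) (s : R) :
  entire F -> 0 < s ->
  RInt (fun x => fst (F (x, 0))) 0 s - RInt (fun x => fst (F (x, s))) 0 s
  - RInt (fun y => snd (F (s, y))) 0 s + RInt (fun y => snd (F (0, y))) 0 s = 0.
Proof.
  intros HF Hs.
  assert (H := square_int_zero _ _ (entire_is_closed_at F HF) 0 0 s Hs).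
  unfold square_int in H; rewrite !Rplus_0_l in H.
  assert (E : forall f : R -> R, (forall t, continuous (fun y => - f y) t) ->
            RInt (fun y => - f y) 0 s = - RInt f 0 s).
  { intros f Cf; rewrite <- (Rmult_1_l (RInt (fun y => - f y) 0 s)).
    replace (1 * RInt (fun y => - f y) 0 s) with (- (-1 * RInt (fun y => - f y) 0 s)) by ring.
    rewrite <- RInt_mulc by auto; apply f_equal, RInt_ext; intros; eq_in_R; ring. }
  rewrite !E in H by (intros t; apply (closed_continuous_Qy _ _ (entire_is_closed_at F HF))).
  lra.
Qed.

Lemma entire_continuous_fst_h (F : C -> C) (x y : R) :
  entire F -> continuous (fun t => fst (F (t, y))) x.
Proof. intros HF; exact (closed_continuous_Px _ _ (entire_is_closed_at F HF) x y). Qed.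

Lemma entire_continuous_snd_v (F : C -> C) (x y : R) :
  entire F -> continuous (fun t => snd (F (x, t))) y.
Proof.
  intros HF; apply continuous_ext with (fun t => - - snd (F (x, t))).
  - intros; apply Ropp_involutive.
  - apply (continuous_opp (V := R_NormedModule)).
    exact (closed_continuous_Qy _ _ (entire_is_closed_at F HF) x y).
Qed.

(** * The complex exponential *)

(* [C_NormedModule] and [AbsRing_NormedModule C_AbsRing] share the norm but not the balls. *)
Lemma C_deriv_is_derive (F : C -> C) (z l : C) :
  C_deriv F z l <-> @is_derive C_AbsRing (AbsRing_NormedModule C_AbsRing) F z l.
Proof.
  split.
  - intros H; split.
    + apply (is_linear_scal_l (V := AbsRing_NormedModule C_AbsRing)).
    + intros z' Hz'.
      apply (is_filter_lim_locally_unique (V := AbsRing_NormedModule C_AbsRing)) in Hz'.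
      rewrite <- Hz'; intros eps.
      destruct (H eps (cond_pos eps)) as [d [Hd Hw]].
      exists (mkposreal d Hd); intros w Hwz; exact (Hw w Hwz).
  - intros [_ H] eps Heps.
    destruct (H z (fun P HP => HP) (mkposreal eps Heps)) as [d Hd].
    exists d; split; [apply cond_pos|].
    intros w Hw; exact (Hd w Hw).
Qed.

Lemma entire_const (c : C) : entire (fun _ => c).
Proof.
  apply entire_C_deriv; intros z; eexists; apply C_deriv_is_derive.
  apply (is_derive_const (V := AbsRing_NormedModule C_AbsRing)).
Qed.

Lemma entire_id : entire (fun z => z).
Proof.
  apply entire_C_deriv; intros z; eexists; apply C_deriv_is_derive; apply is_derive_id.
Qed.

Lemma entire_plus (F G : C -> C) : entire F -> entire G -> entire (fun z => (F z + G z)%C).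
Proof.
  rewrite !entire_C_deriv; intros HF HG z.
  destruct (HF z) as [l Hl]; destruct (HG z) as [m Hm]; eexists.
  apply C_deriv_is_derive in Hl; apply C_deriv_is_derive in Hm; apply C_deriv_is_derive.
  exact (is_derive_plus (V := AbsRing_NormedModule C_AbsRing) F G z l m Hl Hm).
Qed.

Lemma C_deriv_mult (F G : C -> C) (z l m : C) :
  C_deriv F z l -> C_deriv G z m ->
  C_deriv (fun w => (F w * G w)%C) z (l * G z + F z * m)%C.
Proof.
  rewrite !C_deriv_is_derive; intros Hl Hm.
  exact (is_derive_mult F G z l m Hl Hm Cmult_comm).
Qed.

Lemma entire_mult (F G : C -> C) : entire F -> entire G -> entire (fun z => (F z * G z)%C).
Proof.
  rewrite !entire_C_deriv; intros HF HG z.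
  destruct (HF z) as [l Hl]; destruct (HG z) as [m Hm]; eexists.
  apply C_deriv_mult; eassumption.
Qed.

Lemma entire_comp (F G : C -> C) : entire F -> entire G -> entire (fun z => F (G z)).
Proof.
  rewrite !entire_C_deriv; intros HF HG z.
  destruct (HF (G z)) as [l Hl]; destruct (HG z) as [m Hm]; eexists.
  apply C_deriv_is_derive in Hl; apply C_deriv_is_derive in Hm; apply C_deriv_is_derive.
  exact (is_derive_comp (V := AbsRing_NormedModule C_AbsRing) F G z l m Hl Hm).
Qed.

Lemma entire_affine (a b : C) : entire (fun z => (a * z + b)%C).
Proof.
  apply entire_plus; [apply entire_mult|]; try apply entire_const; apply entire_id.
Qed.

(** Schwarz reflection; combined with z -> - z it produces functions that are real on both axes. *)
Lemma entire_conj (F : C -> C) : entire F -> entire (fun z => Cconj (F (Cconj z))).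
Proof.
  rewrite !entire_C_deriv; intros HF z.
  destruct (HF (Cconj z)) as [l Hl]; exists (Cconj l); intros eps Heps.
  destruct (Hl eps Heps) as [d [Hd H]]; exists d; split; auto; intros w Hw.
  assert (E : (Cconj w - Cconj z)%C = Cconj (w - z)) by (symmetry; apply Cminus_conj).
  specialize (H (Cconj w)); rewrite E, Cmod_conj in H; specialize (H Hw).
  rewrite <- Cmod_conj, !Cminus_conj, Cmult_conj, !Cconj_conj; exact H.
Qed.

Lemma entire_ext (F G : C -> C) : (forall z, F z = G z) -> entire F -> entire G.
Proof.
  rewrite !entire_C_deriv; intros E HF z; destruct (HF z) as [l Hl]; exists l.
  intros eps Heps; destruct (Hl eps Heps) as [d [Hd H]]; exists d; split; auto.
  intros w; rewrite <- !E; auto.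
Qed.

Definition Cexp (z : C) : C := (exp (fst z) * cos (snd z), exp (fst z) * sin (snd z)).

Lemma Cexp_plus (z w : C) : Cexp (z + w) = (Cexp z * Cexp w)%C.
Proof.
  destruct z as [a b]; destruct w as [c d]; unfold Cexp, Cplus, Cmult; simpl.
  rewrite exp_plus, cos_plus, sin_plus; f_equal; ring.
Qed.

Lemma Cmod_Cexp (z : C) : Cmod (Cexp z) = exp (fst z).
Proof.
  unfold Cmod, Cexp; simpl.
  replace (exp (fst z) * cos (snd z) * (exp (fst z) * cos (snd z) * 1)
           + exp (fst z) * sin (snd z) * (exp (fst z) * sin (snd z) * 1))
    with ((exp (fst z))² * ((sin (snd z))² + (cos (snd z))²)) by (unfold Rsqr; ring).
  rewrite sin2_cos2, Rmult_1_r; apply sqrt_Rsqr; left; apply exp_pos.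
Qed.

(* The mean value theorem applied to the inner product of [f (x, y)] and [f (t x, t y)]. *)
Lemma Cmod_radial_le (f g : C -> C) (x y B : R) :
  f 0 = 0 ->
  (forall t, is_derive (fun t : R => fst (f (t * x, t * y))) t (fst ((x, y) * g (t * x, t * y)%R)%C)) ->
  (forall t, is_derive (fun t : R => snd (f (t * x, t * y))) t (snd ((x, y) * g (t * x, t * y)%R)%C)) ->
  (forall t : R, 0 <= t <= 1 -> Cmod (g (t * x, t * y)) <= B) ->
  Cmod (f (x, y)) <= Cmod (x, y) * B.
Proof.
  intros H0 H1 H2 HB.

  set (u := f (x, y)).
  destruct (MVT_gen (fun t : R => fst u * fst (f (t * x, t * y)) + snd u * snd (f (t * x, t * y))) 0 1
              (fun t : R => fst u * fst ((x, y) * g (t * x, t * y)%R)%C + snd u * snd ((x, y) * g (t * x, t * y)%R)%C))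
    as [c [Hc E]].
  - intros t _; apply (is_derive_plus (V := R_NormedModule)); apply is_derive_scal; auto.
  - intros t _; apply continuity_pt_derivable; eexists.
    apply (is_derive_plus (V := R_NormedModule)); apply is_derive_scal; auto.
  - rewrite Rmin_left, Rmax_right in Hc by lra.
    rewrite !Rmult_1_l, !Rmult_0_l in E; change (0, 0) with (RtoC 0) in E; rewrite H0 in E; fold u in E.
    assert (HCS : forall a b : C, fst a * fst b + snd a * snd b <= Cmod a * Cmod b).
    { intros a b; rewrite <- (Cmod_conj a), <- Cmod_mult.
      eapply Rle_trans; [|apply Rabs_fst_le_Cmod].
      eapply Rle_trans; [|apply Rle_abs]; right; destruct a, b; simpl; ring. }
    assert (Hu := HCS u ((x, y) * g (c * x, c * y)%R)%C).
    rewrite Cmod_mult in Hu.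
    assert (Hsq : Cmod u ^ 2 = fst u * fst u + snd u * snd u).
    { rewrite Cmod2_alt; unfold Re, Im; ring. }
    change (fst (RtoC 0)) with 0 in E; change (snd (RtoC 0)) with 0 in E.
    destruct (Cmod_ge_0 u) as [Hpos| <-].
    + apply Rmult_le_reg_l with (Cmod u); auto.
      apply Rle_trans with (Cmod u * (Cmod (x, y) * Cmod (g (c * x, c * y)))); [lra|].
      apply Rmult_le_compat_l; [lra|]; apply Rmult_le_compat_l; [apply Cmod_ge_0 | auto].
    + apply Rmult_le_pos; [apply Cmod_ge_0|].
      eapply Rle_trans; [apply Cmod_ge_0 | apply (HB 0); lra].
Qed.

Lemma Cmod_scal_le (t x y : R) : 0 <= t <= 1 -> Cmod (t * x, t * y) <= Cmod (x, y).
Proof.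
  intros Ht; replace (t * x, t * y) with (t * (x, y))%C
    by (unfold Cmult; simpl; f_equal; ring).
  rewrite Cmod_mult, Cmod_R, Rabs_pos_eq by lra.
  generalize (Cmod_ge_0 (x, y)); nra.
Qed.

(** Each remainder is the derivative of the next, so [Cmod_radial_le] gains one factor [Cmod w] at
    every stage. The second one yields the derivative of [Cexp], the third the behaviour of [Csinc]
    at 0. *)
Definition Cexp_rem1 (z : C) : C := (Cexp z - 1)%C.
Definition Cexp_rem2 (z : C) : C := (Cexp z - 1 - z)%C.
Definition Cexp_rem3 (z : C) : C := (Cexp z - 1 - z - z * z / 2)%C.

Ltac radial_tac := intros t; unfold Cexp_rem3, Cexp_rem2, Cexp_rem1, Cexp; simpl;
  auto_derive; auto; eq_in_R; field.

Lemma exp_Cmod_scal_le (t x y : R) :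
  0 <= t <= 1 -> exp (Cmod (t * x, t * y)) <= exp (Cmod (x, y)).
Proof.
  intros Ht; destruct (Cmod_scal_le t x y Ht) as [H| ->]; [left; apply exp_increasing; auto | lra].
Qed.

Lemma Cexp_le (w : C) : Cmod (Cexp w) <= exp (Cmod w).
Proof.
  rewrite Cmod_Cexp.
  assert (H := Rle_trans _ _ _ (Rle_abs _) (Rabs_fst_le_Cmod w)).
  destruct H as [H| ->]; [left; apply exp_increasing; auto | lra].
Qed.

Lemma Cexp_0 : Cexp 0 = 1.
Proof. unfold Cexp; simpl; rewrite exp_0, cos_0, sin_0; unfold RtoC; f_equal; ring. Qed.

Lemma Cexp_rem1_le (w : C) : Cmod (Cexp_rem1 w) <= Cmod w * exp (Cmod w).
Proof.
  destruct w as [x y].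
  apply (Cmod_radial_le Cexp_rem1 Cexp x y (exp (Cmod (x, y)))).
  - unfold Cexp_rem1; rewrite Cexp_0; ring.
  - radial_tac.
  - radial_tac.
  - intros t Ht; eapply Rle_trans; [apply Cexp_le | apply exp_Cmod_scal_le; auto].
Qed.

Lemma Cexp_rem2_le (w : C) : Cmod (Cexp_rem2 w) <= Cmod w ^ 2 * exp (Cmod w).
Proof.
  destruct w as [x y].
  replace (Cmod (x, y) ^ 2 * exp (Cmod (x, y)))
    with (Cmod (x, y) * (Cmod (x, y) * exp (Cmod (x, y)))) by ring.
  apply (Cmod_radial_le Cexp_rem2 Cexp_rem1 x y).
  - unfold Cexp_rem2; rewrite Cexp_0; ring.
  - radial_tac.
  - radial_tac.
  - intros t Ht; eapply Rle_trans; [apply Cexp_rem1_le|].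
    apply Rmult_le_compat; try apply Cmod_ge_0; try (left; apply exp_pos).
    + apply Cmod_scal_le; auto.
    + apply exp_Cmod_scal_le; auto.
Qed.

Lemma Cexp_rem3_le (w : C) : Cmod (Cexp_rem3 w) <= Cmod w ^ 3 * exp (Cmod w).
Proof.
  destruct w as [x y].
  replace (Cmod (x, y) ^ 3 * exp (Cmod (x, y)))
    with (Cmod (x, y) * (Cmod (x, y) ^ 2 * exp (Cmod (x, y)))) by ring.
  apply (Cmod_radial_le Cexp_rem3 Cexp_rem2 x y).
  - unfold Cexp_rem3; rewrite Cexp_0; unfold Cdiv; ring.
  - radial_tac.
  - radial_tac.
  - intros t Ht; eapply Rle_trans; [apply Cexp_rem2_le|].
    apply Rmult_le_compat; try (left; apply exp_pos).
    + apply pow_le, Cmod_ge_0.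
    + apply pow_incr; split; [apply Cmod_ge_0 | apply Cmod_scal_le; auto].
    + apply exp_Cmod_scal_le; auto.
Qed.

Lemma C_deriv_Cexp (z : C) : C_deriv Cexp z (Cexp z).
Proof.
  intros eps Heps.
  set (K := Cmod (Cexp z) * exp 1).
  assert (HK : 0 < K).
  { apply Rmult_lt_0_compat; [rewrite Cmod_Cexp|]; apply exp_pos. }
  exists (Rmin 1 (eps / K)); split.
  { apply Rmin_pos; [lra | apply Rdiv_lt_0_compat; auto]. }
  intros w Hw; set (h := (w - z)%C) in *.
  assert (H1 := Rlt_le_trans _ _ _ Hw (Rmin_l _ _)).
  assert (H2 := Rlt_le_trans _ _ _ Hw (Rmin_r _ _)).
  replace (Cexp w - Cexp z - h * Cexp z)%C with (Cexp z * Cexp_rem2 h)%C.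
  2:{ replace w with (z + h)%C by (unfold h; ring); rewrite Cexp_plus; unfold Cexp_rem2; ring. }
  rewrite Cmod_mult.
  assert (Hh := Cmod_ge_0 h).
  assert (He : exp (Cmod h) <= exp 1) by (left; apply exp_increasing; auto).
  apply Rle_trans with (Cmod (Cexp z) * (Cmod h ^ 2 * exp 1)).
  - apply Rmult_le_compat_l; [apply Cmod_ge_0|].
    eapply Rle_trans; [apply Cexp_rem2_le|]; apply Rmult_le_compat_l; auto; apply pow2_ge_0.
  - replace (Cmod (Cexp z) * (Cmod h ^ 2 * exp 1)) with (Cmod h * K * Cmod h) by (unfold K; ring).
    apply Rmult_le_compat_r; auto.
    apply Rmult_lt_compat_r with (r := K) in H2; auto.
    unfold Rdiv in H2; rewrite Rmult_assoc, Rinv_l, Rmult_1_r in H2; lra.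
Qed.

Lemma entire_Cexp : entire Cexp.
Proof. apply entire_C_deriv; intros z; exists (Cexp z); apply C_deriv_Cexp. Qed.

(** * The quadrant identity *)

Lemma exp_le (x y : R) : x <= y -> exp x <= exp y.
Proof. intros [H| ->]; [left; apply exp_increasing; auto | lra]. Qed.

Lemma Rabs_exp_sin_le (x y : R) : Rabs (exp x * sin y) <= exp x.
Proof.
  rewrite Rabs_mult, (Rabs_pos_eq (exp x)) by (left; apply exp_pos).
  assert (Rabs (sin y) <= 1) by (apply Rabs_le, SIN_bound).
  generalize (exp_pos x); nra.
Qed.

Lemma growth_constant_nonneg (F : C -> C) (M tau : R) :
  (forall z, Cmod (F z) <= M * exp (tau * Cmod z)) -> 0 <= M.
Proof.
  intros H; specialize (H 0); rewrite Cmod_0, Rmult_0_r, exp_0, Rmult_1_r in H.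
  eapply Rle_trans; [apply Cmod_ge_0 | exact H].
Qed.

(** Closedness gives continuity of real parts along horizontals and of imaginary parts along
    verticals; multiplication by i exchanges the parts. *)
Lemma entire_continuous_fst_v (F : C -> C) (x y : R) :
  entire F -> continuous (fun t => fst (F (x, t))) y.
Proof.
  intros HF.
  assert (HG : entire (fun z => (Ci * F z)%C)) by (apply entire_mult; auto; apply entire_const).
  apply continuous_ext with (fun t => snd (Ci * F (x, t))%C).
  - intros t; simpl; ring.
  - apply (entire_continuous_snd_v _ _ _ HG).
Qed.

(** Real part of the integral of F z exp (- (u - i v) z - i phi) around [0, s]^2. Since |z| <= x + y
    in the quadrant, the integrand is at most M exp (- k (x + y)) with k = min (u, v) - tau, and the
    two far sides disappear as s -> oo. The phase [phi] later moves the centre of the kernels in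
    [quadrant_zero]. *)
Lemma quadrant_identity_large (F : C -> C) (M tau u v phi : R) :
  entire F -> (forall z, Cmod (F z) <= M * exp (tau * Cmod z)) ->
  0 <= tau -> tau < u -> tau < v ->
  (forall x, snd (F (x, 0)) = 0) -> (forall y, snd (F (0, y)) = 0) ->
  half_int (fun x => fst (F (x, 0)) * (exp (- u * x) * cos (v * x - phi)))
  = half_int (fun y => fst (F (0, y)) * (exp (- v * y) * sin (u * y + phi))).
Proof.
  intros HF HM Ht Hu Hv Hre Him.
  assert (HM0 := growth_constant_nonneg F M tau HM).
  set (k := Rmin u v - tau).
  assert (Hk : 0 < k) by (unfold k; generalize (Rmin_glb_lt u v tau Hu Hv); lra).
  assert (Hku : k <= u - tau) by (unfold k; generalize (Rmin_l u v); lra).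
  assert (Hkv : k <= v - tau) by (unfold k; generalize (Rmin_r u v); lra).
  set (f := fun z : C => (F z * Cexp (((- u)%R, v) * z + (0%R, (- phi)%R)))%C).
  assert (Hf : entire f).
  { apply entire_mult; auto.
    apply (entire_comp Cexp (fun z => (((- u)%R, v) * z + (0%R, (- phi)%R))%C));
      [apply entire_Cexp | apply entire_affine]. }
  assert (Hfm : forall x y, 0 <= x -> 0 <= y -> Cmod (f (x, y)) <= M * exp (- k * (x + y))).
  { intros x y Hx Hy; unfold f; rewrite Cmod_mult, Cmod_Cexp; simpl.
    assert (Hxy := Cmod_le_Rabs_add x y); rewrite !Rabs_pos_eq in Hxy by auto.
    apply Rle_trans with (M * exp (tau * (x + y)) * exp (- u * x - v * y + 0)).
    - apply Rmult_le_compat_r; [left; apply exp_pos|].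
      eapply Rle_trans; [apply HM|]; apply Rmult_le_compat_l; auto.
      apply exp_le, Rmult_le_compat_l; auto.
    - rewrite Rmult_assoc, <- exp_plus; apply Rmult_le_compat_l; auto.
      apply exp_le; nra. }
  set (A := fun x => fst (F (x, 0)) * (exp (- u * x) * cos (v * x - phi))).
  set (B := fun y => fst (F (0, y)) * (exp (- v * y) * sin (u * y + phi))).
  assert (EA : forall x, fst (f (x, 0)) = A x).
  { intros x; unfold f, A, Cexp; simpl; rewrite Hre.
    replace (- u * x - v * 0 + 0) with (- u * x) by ring.
    replace (- u * 0 + v * x + - phi) with (v * x - phi) by ring; ring. }
  assert (EB : forall y, snd (f (0, y)) = - B y).
  { intros y; unfold f, B, Cexp; simpl; rewrite Him.
    replace (- u * 0 - v * y + 0) with (- v * y) by ring.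
    replace (- u * y + v * 0 + - phi) with (- (u * y + phi)) by ring.
    rewrite sin_neg; ring. }
  assert (CA : forall x, continuous A x).
  { intros x; apply continuous_ext with (fun x => fst (f (x, 0))); auto.
    apply entire_continuous_fst_h; auto. }
  assert (CB : forall x, continuous B x).
  { intros x; apply (continuous_mult (K := R_AbsRing)).
    - apply entire_continuous_fst_v; auto.
    - apply continuous_derivable; auto_derive; auto. }
  assert (Hexp : half_integrable (fun x => M * exp (- k * x)))
    by (apply half_integrable_scal, half_integrable_exp; auto).
  assert (IA : half_integrable A).
  { apply half_integrable_dom with (fun x => M * exp (- k * x)); auto.
    intros x Hx; rewrite <- EA; eapply Rle_trans; [apply Rabs_fst_le_Cmod|].
    rewrite <- (Rplus_0_r x) at 2; apply Hfm; lra. }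
  assert (IB : half_integrable B).
  { apply half_integrable_dom with (fun x => M * exp (- k * x)); auto.
    intros x Hx; rewrite <- (Rabs_Ropp (B x)), <- EB.
    eapply Rle_trans; [apply Rabs_snd_le_Cmod|].
    rewrite <- (Rplus_0_l x) at 2; apply Hfm; lra. }
  set (K := 2 * M / (k / 2)).
  assert (Hlim0 : is_lim (fun s => RInt A 0 s - RInt B 0 s) p_infty 0).
  { apply is_lim_le_le_loc with (fun s => - K * exp (- (k / 2) * s))
      (fun s => K * exp (- (k / 2) * s)).
    - exists 0; intros s Hs.
      assert (H := entire_square_int f s Hf Hs).
      rewrite (RInt_ext (fun x => fst (f (x, 0))) A) in H by auto.
      rewrite (RInt_ext (fun y => snd (f (0, y))) (fun y => -1 * B y)) in H
        by (intros; rewrite EB; eq_in_R; ring).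
      rewrite RInt_mulc in H by auto.
      (* Half of the decay pays for the length s of the far sides. *)
      assert (Hs1 : s * exp (- k * s) <= / (k / 2) * exp (- (k / 2) * s)).
      { replace (- k * s) with (- (k / 2) * s + - (k / 2) * s) by field.
        rewrite exp_plus, <- Rmult_assoc; apply Rmult_le_compat_r; [left; apply exp_pos|].
        assert (Hp := pow_exp_le 1 (k / 2) s ltac:(lra) ltac:(lra)); simpl in Hp.
        rewrite !Rmult_1_r in Hp; unfold Rdiv in Hp at 2; lra. }
      assert (H1 : Rabs (RInt (fun x => fst (f (x, s))) 0 (0 + s) - 0 * s)
                   <= M * exp (- k * s) * s).
      { apply Rabs_RInt_minus_const_le; [| lra |].
        - intros; apply entire_continuous_fst_h; auto.
        - intros x Hx; rewrite Rminus_0_r; eapply Rle_trans; [apply Rabs_fst_le_Cmod|].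
          eapply Rle_trans; [apply Hfm; lra|].
          apply Rmult_le_compat_l; auto; apply exp_le; nra. }
      assert (H2 : Rabs (RInt (fun y => snd (f (s, y))) 0 (0 + s) - 0 * s)
                   <= M * exp (- k * s) * s).
      { apply Rabs_RInt_minus_const_le; [| lra |].
        - intros; apply entire_continuous_snd_v; auto.
        - intros x Hx; rewrite Rminus_0_r; eapply Rle_trans; [apply Rabs_snd_le_Cmod|].
          eapply Rle_trans; [apply Hfm; lra|].
          apply Rmult_le_compat_l; auto; apply exp_le; nra. }
      rewrite Rplus_0_l, Rmult_0_l, Rminus_0_r in H1, H2.
      apply Rabs_le_between in H1; apply Rabs_le_between in H2.
      assert (HK : 2 * (M * exp (- k * s) * s) <= K * exp (- (k / 2) * s)).
      { apply Rle_trans with (2 * M * (/ (k / 2) * exp (- (k / 2) * s))).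
        - replace (2 * (M * exp (- k * s) * s)) with (2 * M * (s * exp (- k * s))) by ring.
          apply Rmult_le_compat_l; lra.
        - unfold K, Rdiv; right; ring. }
      lra.
    - evar_last; [apply is_lim_scal_l, is_lim_exp_neg; lra | simpl; f_equal; ring].
    - evar_last; [apply is_lim_scal_l, is_lim_exp_neg; lra | simpl; f_equal; ring]. }
  assert (Hlim1 : is_lim (fun s => RInt A 0 s - RInt B 0 s) p_infty (half_int A - half_int B)).
  { apply (is_lim_minus' _ _ _ (half_int A) (half_int B)); apply half_int_lim; auto. }
  apply is_lim_unique in Hlim0; apply is_lim_unique in Hlim1.
  rewrite Hlim0 in Hlim1; injection Hlim1; fold A B; lra.
Qed.

(** The weight [p] carries the integrability and the kernels [q n] the bounds n! rho^n; the two
    conclusions are the input of [analytic_jet_zero]. *)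
Lemma half_int_jet (p : R -> R) (q : nat -> R -> R -> R) (a rho : R) :
  half_integrable p -> 0 < rho ->
  (forall n y x, continuous (fun x => q n x y) x) ->
  (forall n x y, 0 <= x -> a < y -> is_derive (q n x) y (q (S n) x y)) ->
  (forall n x y, 0 <= x -> a < y -> Rabs (q n x y) <= INR (fact n) * rho ^ n) ->
  forall n y, a < y ->
  is_derive (fun y => half_int (fun x => p x * q n x y)) y
    (half_int (fun x => p x * q (S n) x y)) /\
  Rabs (half_int (fun x => p x * q n x y))
    <= half_int (fun x => Rabs (p x)) * INR (fact n) * rho ^ n.
Proof.
  intros Hp Hrho Cq Dq Bq n y Hy.
  assert (Hi : forall m z, a < z -> half_integrable (fun x => p x * q m x z)).
  { intros m z Hz; apply half_integrable_mult with (INR (fact m) * rho ^ m); auto. }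
  split.
  - set (K := INR (fact (S (S n))) * rho ^ S (S n)).
    apply half_int_derive with (r := fun x y => p x * q n x y) (d := y - a)
      (b := fun x => K * Rabs (p x)).
    + lra.
    + intros z Hz; apply Hi; apply Rabs_def2 in Hz; lra.
    + apply Hi; auto.
    + apply half_integrable_scal, half_integrable_abs; auto.
    + intros x s Hx Hs.
      replace (p x * q n x (y + s) - p x * q n x y - s * (p x * q (S n) x y))
        with (p x * (q n x (y + s) - q n x y - s * q (S n) x y)) by ring.
      rewrite Rabs_mult.
      replace (s ^ 2 * (K * Rabs (p x))) with (Rabs (p x) * (s ^ 2 * K)) by ring.
      apply Rmult_le_compat_l; [apply Rabs_pos|].
      apply (quadratic_remainder (q n x) (q (S n) x) (q (S (S n)) x) y (y - a) K); auto;
        intros z Hz; apply Rabs_def2 in Hz; [apply Dq | apply Dq | apply Bq]; lra.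
  - rewrite Rmult_assoc, Rmult_comm, <- half_int_scal by (apply half_integrable_abs; auto).
    apply half_int_abs_le; auto.
    + apply half_integrable_scal, half_integrable_abs; auto.
    + intros x Hx; rewrite Rabs_mult, Rmult_comm; apply Rmult_le_compat_r; auto; apply Rabs_pos.
Qed.

(** From |g w| <= g^2 + w^2 with w = x^n exp (- k x): an exponential weight turns
    square-integrability into integrability. *)
Lemma half_integrable_sqr_exp (g : R -> R) (n : nat) (k : R) :
  half_integrable (fun x => g x ^ 2) -> (forall x, continuous g x) -> 0 < k ->
  half_integrable (fun x => g x * (x ^ n * exp (- k * x))).
Proof.
  intros Hg Cg Hk.
  assert (H2 := half_integrable_pow_exp (2 * n) (2 * k) ltac:(lra)).
  apply half_integrable_dom with
    (fun x => g x ^ 2 + x ^ (2 * n) * exp (- (2 * k) * x)).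
  - apply half_integrable_plus; auto.
  - intros x; apply (continuous_mult (K := R_AbsRing)); auto.
    apply continuous_derivable; auto_derive; auto.
  - intros x Hx.
    replace (x ^ (2 * n) * exp (- (2 * k) * x)) with ((x ^ n * exp (- k * x)) ^ 2).
    + set (w := x ^ n * exp (- k * x)); apply Rabs_le.
      generalize (pow2_ge_0 (g x + w)) (pow2_ge_0 (g x - w)) (pow2_ge_0 (g x)) (pow2_ge_0 w).
      simpl; lra.
    + rewrite Rpow_mult_distr, Nat.mul_comm, pow_mult; f_equal.
      replace (- (2 * k) * x) with (- k * x + - k * x) by ring.
      rewrite exp_plus; simpl; ring.
Qed.

(** Lets a single formula with phase n PI / 2 describe all derivatives of the sine factor. *)
Lemma cos_sin_shift (n : nat) (t : R) :
  sin (t + INR (S n) * (PI / 2)) = cos (t + INR n * (PI / 2)).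
Proof.
  rewrite S_INR; replace (t + (INR n + 1) * (PI / 2)) with (PI / 2 + (t + INR n * (PI / 2))) by ring.
  rewrite sin_plus, sin_PI2, cos_PI2; ring.
Qed.

(* Both sides are real-analytic in [u > 0] and agree for large [u]; this replaces the
   Phragmen-Lindelof principle. *)
Lemma quadrant_identity (F : C -> C) (M tau u v phi : R) :
  entire F -> (forall z, Cmod (F z) <= M * exp (tau * Cmod z)) ->
  0 <= tau -> 0 < u -> tau < v ->
  (forall x, snd (F (x, 0)) = 0) -> (forall y, snd (F (0, y)) = 0) ->
  half_integrable (fun x => fst (F (x, 0)) ^ 2) ->
  half_int (fun x => fst (F (x, 0)) * (exp (- u * x) * cos (v * x - phi)))
  = half_int (fun y => fst (F (0, y)) * (exp (- v * y) * sin (u * y + phi))).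
Proof.
  intros HF HM Ht Hu Hv Hre Him Hg.
  assert (HM0 := growth_constant_nonneg F M tau HM).
  set (g := fun x => fst (F (x, 0))) in *. set (h := fun y => fst (F (0, y))).
  (* A reserve of decay split off from both exponentials. On the left exp (- al x) makes the weight
     integrable and exp (- (y - al) x), for y > 2 al, controls the derivatives in y; on the right
     exp (- (v - al) x) still beats the growth tau and exp (- al x) controls the derivatives. The
     first bound on [al] puts [u] above [2 * al]. *)
  set (al := Rmin (u / 4) ((v - tau) / 2)).
  assert (Hal : 0 < al) by (apply Rmin_pos; lra).
  assert (Hal1 : al <= u / 4) by apply Rmin_l.
  assert (Hal2 : al <= (v - tau) / 2) by apply Rmin_r.
  assert (Cg : forall x, continuous g x) by (intros; apply entire_continuous_fst_h; auto).
  assert (Ch : forall x, continuous h x) by (intros; apply entire_continuous_fst_v; auto).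
  set (p1 := fun x => g x * (x ^ 0 * exp (- al * x)) * cos (v * x - phi)).
  set (q1 := fun n x y => (- x) ^ n * exp (- (y - al) * x)).
  set (p2 := fun x => h x * exp (- (v - al) * x)).
  set (q2 := fun (n : nat) x y => x ^ n * exp (- al * x) * sin (y * x + phi + INR n * (PI / 2))).
  assert (Hp1 : half_integrable p1).
  { apply half_integrable_mult with 1.
    - apply half_integrable_sqr_exp; auto.
    - intros; apply continuous_derivable; auto_derive; auto.
    - intros; apply Rabs_le, COS_bound. }
  assert (Hp2 : half_integrable p2).
  { apply half_integrable_dom with (fun x => M * exp (- (v - al - tau) * x)).
    - apply half_integrable_scal, half_integrable_exp; lra.
    - intros x; apply (continuous_mult (K := R_AbsRing)); auto.
      apply continuous_derivable; auto_derive; auto.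
    - intros x Hx; unfold p2; rewrite Rabs_mult, (Rabs_pos_eq (exp _)) by (left; apply exp_pos).
      replace (- (v - al - tau) * x) with (tau * x + - (v - al) * x) by ring.
      rewrite exp_plus, <- Rmult_assoc; apply Rmult_le_compat_r; [left; apply exp_pos|].
      unfold h; eapply Rle_trans; [apply Rabs_fst_le_Cmod|]; eapply Rle_trans; [apply HM|].
      apply Rmult_le_compat_l; auto; apply exp_le, Rmult_le_compat_l; auto.
      eapply Rle_trans; [apply Cmod_le_Rabs_add|].
      rewrite Rabs_R0, Rabs_pos_eq by auto; lra. }
  assert (Hfact : forall n x, 0 <= x -> x ^ n * exp (- al * x) <= INR (fact n) * (/ al) ^ n).
  { intros n x Hx; rewrite pow_inv; apply pow_exp_le; auto. }
  assert (J1 := half_int_jet p1 q1 (2 * al) (/ al) Hp1 (Rinv_0_lt_compat _ Hal)).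
  assert (J2 := half_int_jet p2 q2 (2 * al) (/ al) Hp2 (Rinv_0_lt_compat _ Hal)).
  specialize (J1 ltac:(intros; apply continuous_derivable; unfold q1; auto_derive; auto)).
  specialize (J2 ltac:(intros; apply continuous_derivable; unfold q2; auto_derive; auto)).
  assert (D1 : forall n x y, 0 <= x -> 2 * al < y -> is_derive (q1 n x) y (q1 (S n) x y)).
  { intros n x y _ _; unfold q1; auto_derive; auto; eq_in_R; simpl; unfold Rminus; ring. }
  assert (D2 : forall n x y, 0 <= x -> 2 * al < y -> is_derive (q2 n x) y (q2 (S n) x y)).
  { intros n x y _ _; unfold q2; rewrite cos_sin_shift.
    auto_derive; auto; eq_in_R; simpl; ring. }
  specialize (J1 D1); specialize (J2 D2).
  assert (B1 : forall n x y, 0 <= x -> 2 * al < y ->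
            Rabs (q1 n x y) <= INR (fact n) * (/ al) ^ n).
  { intros n x y Hx Hy; unfold q1; eapply Rle_trans; [|apply (Hfact n x Hx)].
    rewrite Rabs_mult, (Rabs_pos_eq (exp _)) by (left; apply exp_pos).
    rewrite <- RPow_abs, Rabs_Ropp, Rabs_pos_eq by auto.
    apply Rmult_le_compat_l; [apply pow_le; auto|]; apply exp_le; nra. }
  assert (B2 : forall n x y, 0 <= x -> 2 * al < y ->
            Rabs (q2 n x y) <= INR (fact n) * (/ al) ^ n).
  { intros n x y Hx Hy; unfold q2; eapply Rle_trans; [|apply (Hfact n x Hx)].
    rewrite Rmult_assoc, Rabs_mult, Rabs_pos_eq by (apply pow_le; auto).
    apply Rmult_le_compat_l; [apply pow_le; auto | apply Rabs_exp_sin_le]. }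
  specialize (J1 B1); specialize (J2 B2).
  assert (E1 : forall y, half_int (fun x => p1 x * q1 O x y)
            = half_int (fun x => g x * (exp (- y * x) * cos (v * x - phi)))).
  { intros y; apply half_int_ext; intros x _; unfold p1, q1.
    replace (- y * x) with (- al * x + - (y - al) * x) by ring; rewrite exp_plus; simpl; ring. }
  assert (E2 : forall y, half_int (fun x => p2 x * q2 O x y)
            = half_int (fun x => h x * (exp (- v * x) * sin (y * x + phi)))).
  { intros y; apply half_int_ext; intros x _; unfold p2, q2.
    replace (- v * x) with (- (v - al) * x + - al * x) by ring; rewrite exp_plus; simpl.
    replace (y * x + phi + 0 * (PI / 2)) with (y * x + phi) by ring; ring. }
  rewrite <- E1, <- E2; apply Rminus_diag_uniq.
  (* For y > tau the difference vanishes by the contour argument; its zeros then spread down to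
     [2 * al], hence to [u]. *)
  apply (analytic_jet_zero (fun n y => half_int (fun x => p1 x * q1 n x y)
                                  - half_int (fun x => p2 x * q2 n x y))
           (2 * al) tau
           (half_int (fun x => Rabs (p1 x)) + half_int (fun x => Rabs (p2 x))) (/ al)).
  - apply Rinv_0_lt_compat; auto.
  - intros n y Hy; apply (is_derive_minus (V := R_NormedModule));
      [apply (J1 n y Hy) | apply (J2 n y Hy)].
  - intros n y Hy; unfold Rminus at 1; eapply Rle_trans; [apply Rabs_triang|].
    rewrite Rabs_Ropp, !Rmult_plus_distr_r.
    apply Rplus_le_compat; [apply (J1 n y Hy) | apply (J2 n y Hy)].
  - intros y Hy Hty; rewrite E1, E2; apply Rminus_diag_eq.
    apply (quadrant_identity_large F M tau y v phi); auto.
  - lra.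
Qed.

(** * Point evaluation and uniqueness in a quadrant *)

Lemma half_integrable_ext (f g : R -> R) :
  (forall x, f x = g x) -> half_integrable f -> half_integrable g.
Proof.
  intros E [C [B HB]]; split.
  - intros x; apply continuous_ext with f; auto.
  - exists B; intros r Hr; rewrite (RInt_ext _ (fun x => Rabs (f x))); auto.
    intros x _; rewrite E; reflexivity.
Qed.

Lemma half_int_exp_le (k : R) : 0 < k -> half_int (fun x => exp (- k * x)) <= / k.
Proof.
  intros Hk; apply half_int_le_bound; [apply half_integrable_exp; auto|].
  intros r Hr; apply RInt_exp_le; auto.
Qed.

Lemma half_int_mul_exp_le (k : R) :
  0 < k -> half_int (fun x => x ^ 1 * exp (- k * x)) <= 4 / k ^ 2.
Proof.
  intros Hk.
  assert (Hk2 : 0 < k / 2) by lra.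
  apply Rle_trans with (half_int (fun x => 2 / k * exp (- (k / 2) * x))).
  - apply half_int_le.
    + apply half_integrable_pow_exp; auto.
    + apply half_integrable_scal, half_integrable_exp; auto.
    + intros x Hx.
      replace (- k * x) with (- (k / 2) * x + - (k / 2) * x) by field.
      rewrite exp_plus, <- Rmult_assoc; apply Rmult_le_compat_r; [left; apply exp_pos|].
      replace (2 / k) with (INR (fact 1) / (k / 2) ^ 1) by (simpl; field; lra).
      apply pow_exp_le; auto.
  - rewrite half_int_scal by (apply half_integrable_exp; auto).
    apply Rle_trans with (2 / k * / (k / 2)); [|right; field; lra].
    apply Rmult_le_compat_l; [left; apply Rdiv_lt_0_compat; lra | apply half_int_exp_le; auto].
Qed.

Lemma half_integrable_growth_exp (h : R -> R) (M tau v : R) (n : nat) :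
  (forall x, continuous h x) -> tau < v ->
  (forall x, 0 <= x -> Rabs (h x) <= M * exp (tau * x)) ->
  half_integrable (fun x => x ^ n * (h x * exp (- v * x))).
Proof.
  intros Ch Hv Hh.
  apply half_integrable_dom with (fun x => M * (x ^ n * exp (- (v - tau) * x))).
  - apply half_integrable_scal, half_integrable_pow_exp; lra.
  - intros x; apply (continuous_mult (K := R_AbsRing)).
    + apply continuous_derivable; auto_derive; auto.
    + apply (continuous_mult (K := R_AbsRing)); auto.
      apply continuous_derivable; auto_derive; auto.
  - intros x Hx.
    rewrite !Rabs_mult, (Rabs_pos_eq (exp _)) by (left; apply exp_pos).
    rewrite (Rabs_pos_eq (x ^ n)) by (apply pow_le; auto).
    replace (- (v - tau) * x) with (tau * x + - v * x) by ring; rewrite exp_plus.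
    replace (M * (x ^ n * (exp (tau * x) * exp (- v * x))))
      with (x ^ n * (M * exp (tau * x) * exp (- v * x))) by ring.
    apply Rmult_le_compat_l; [apply pow_le; auto|].
    apply Rmult_le_compat_r; [left; apply exp_pos | auto].
Qed.

Lemma growth_fst_v (F : C -> C) (M tau : R) :
  (forall z, Cmod (F z) <= M * exp (tau * Cmod z)) ->
  forall y, 0 <= y -> Rabs (fst (F (0, y))) <= M * exp (tau * y).
Proof.
  intros HM y Hy; eapply Rle_trans; [apply Rabs_fst_le_Cmod|].
  replace y with (Cmod (0, y)) at 2; auto.
  unfold Cmod; simpl; replace (0 * (0 * 1) + y * (y * 1)) with (y²) by (unfold Rsqr; ring).
  apply sqrt_Rsqr; auto.
Qed.

(** On the imaginary axis |sin (u y)| <= u y. This yields the factor [u], which sends the bound to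
    0, together with a decay in [A] that is integrable up to infinity. *)
Lemma quadrant_cosine_int_le (F : C -> C) (M tau u A : R) :
  entire F -> (forall z, Cmod (F z) <= M * exp (tau * Cmod z)) ->
  0 <= tau -> 0 < u -> tau < A ->
  (forall x, snd (F (x, 0)) = 0) -> (forall y, snd (F (0, y)) = 0) ->
  half_integrable (fun x => fst (F (x, 0)) ^ 2) ->
  cosine_int (fun x => fst (F (x, 0)) * exp (- u * x)) 0 A <= 4 * u * M / (A - tau) ^ 2.
Proof.
  intros HF HM Ht Hu HA Hre Him Hg.
  assert (HM0 := growth_constant_nonneg F M tau HM).
  assert (Hh := growth_fst_v F M tau HM).
  unfold cosine_int.
  rewrite (half_int_ext _ (fun x => fst (F (x, 0)) * (exp (- u * x) * cos (A * x - 0))))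
    by (intros x _; rewrite !Rminus_0_r; ring).
  rewrite (quadrant_identity F M tau u A 0); auto.
  apply Rle_trans with (half_int (fun y => u * M * (y ^ 1 * exp (- (A - tau) * y)))).
  - eapply Rle_trans; [apply Rle_abs|].
    apply half_int_abs_le.
    + apply half_integrable_ext with
        (fun y => y ^ 0 * (fst (F (0, y)) * exp (- A * y)) * sin (u * y + 0)).
      { intros; simpl; ring. }
      apply half_integrable_mult with 1.
      * apply half_integrable_growth_exp with M tau; auto.
        intros; apply entire_continuous_fst_v; auto.
      * intros; apply continuous_derivable; auto_derive; auto.
      * intros; apply Rabs_le, SIN_bound.
    + apply half_integrable_scal, half_integrable_pow_exp; lra.
    + intros y Hy; rewrite !Rabs_mult, (Rabs_pos_eq (exp _)) by (left; apply exp_pos).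
      assert (Hs : Rabs (sin (u * y + 0)) <= u * y).
      { rewrite Rplus_0_r; eapply Rle_trans; [apply Rabs_sin_le|].
        rewrite Rabs_pos_eq; [lra | apply Rmult_le_pos; lra]. }
      replace (- (A - tau) * y) with (tau * y + - A * y) by ring; rewrite exp_plus.
      replace (u * M * (y ^ 1 * (exp (tau * y) * exp (- A * y))))
        with (M * exp (tau * y) * (exp (- A * y) * (u * y))) by ring.
      apply Rmult_le_compat; auto; try apply Rabs_pos.
      * apply Rmult_le_pos; [left; apply exp_pos | apply Rabs_pos].
      * apply Rmult_le_compat_l; auto; left; apply exp_pos.
  - rewrite half_int_scal by (apply half_integrable_pow_exp; lra).
    replace (4 * u * M / (A - tau) ^ 2) with (u * M * (4 / (A - tau) ^ 2)) by (field; lra).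
    apply Rmult_le_compat_l; [apply Rmult_le_pos; lra | apply half_int_mul_exp_le; lra].
Qed.

(** Past T, the Dirichlet integral of g x exp (- u x) exceeds its value at T by at most O(u), and
    that value is bounded by a weighted Cauchy-Schwarz inequality. [fejer_upper] passes the bound on
    to g 0, which the exponential factor leaves unchanged, and then u -> 0. *)
Lemma quadrant_point_bound (F : C -> C) (M tau T L : R) :
  entire F -> (forall z, Cmod (F z) <= M * exp (tau * Cmod z)) ->
  0 <= tau -> tau < T ->
  (forall x, snd (F (x, 0)) = 0) -> (forall y, snd (F (0, y)) = 0) ->
  half_integrable (fun x => fst (F (x, 0)) ^ 2) ->
  half_int (fun x => fst (F (x, 0)) ^ 2) <= L -> 0 < fst (F (0, 0)) ->
  PI / 2 * fst (F (0, 0)) ^ 2 <= T * L.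
Proof.
  intros HF HM Ht HT Hre Him Hg HL Hpos.
  assert (HM0 := growth_constant_nonneg F M tau HM).
  assert (HPI := PI_RGT_0).
  set (g := fun x => fst (F (x, 0))) in *.
  assert (Cg : forall x, continuous g x) by (intros; apply entire_continuous_fst_h; auto).
  set (g0 := fst (F (0, 0))) in *.
  (* Weight in a b <= lam a^2 / 2 + b^2 / (2 lam). It is the optimal weight in the case of equality
     PI / 2 g0^2 = T L, and it avoids a square root. *)
  set (lam := T / g0).
  assert (Hlam : 0 < lam) by (apply Rdiv_lt_0_compat; lra).
  set (Y := lam / 2 * L + / (2 * lam) * (T * (PI / 2))).
  assert (Hu : forall u, 0 < u -> PI / 2 * g0 <= Y + 4 * u * M / (T - tau)).
  { intros u Hu.
    set (G := fun x => g x * exp (- u * x)).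
    assert (HG : half_integrable G).
    { apply half_integrable_ext with (fun x => g x * (x ^ 0 * exp (- u * x))).
      - intros; unfold G; simpl; ring.
      - apply half_integrable_sqr_exp; auto. }
    assert (HxG : half_integrable (fun x => x * G x)).
    { apply half_integrable_ext with (fun x => g x * (x ^ 1 * exp (- u * x))).
      - intros; unfold G; simpl; ring.
      - apply half_integrable_sqr_exp; auto. }
    assert (HTY : dirichlet_int G 0 T <= Y).
    { unfold dirichlet_int.
      assert (Hk := half_integrable_fejer_kernel 0 (2 * T) ltac:(lra)).
      apply Rle_trans with (half_int (fun x => lam / 2 * g x ^ 2
                                + / (2 * lam) * T * fejer_kernel 0 (2 * T) x)).
      - apply half_int_le.
        + apply half_integrable_dirichlet; auto.
        + apply half_integrable_plus; apply half_integrable_scal; auto.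
        + intros x Hx; unfold G, fejer_kernel.
          replace (2 * T / 2) with T by field.
          set (S := T * sinc (T * (x - 0))).
          replace (/ (2 * lam) * T * (T * sinc (T * (x - 0)) ^ 2)) with (/ (2 * lam) * S ^ 2)
            by (unfold S; field; lra).
          assert (He : 0 < exp (- u * x) <= 1).
          { split; [apply exp_pos|]; rewrite <- exp_0; apply exp_le; nra. }
          set (e := exp (- u * x)) in *.
          apply Rle_trans with (lam / 2 * (g x * e) ^ 2 + / (2 * lam) * S ^ 2).
          * apply Rmult_le_reg_l with (2 * lam); [lra|].
            replace (2 * lam * (lam / 2 * (g x * e) ^ 2 + / (2 * lam) * S ^ 2))
              with (lam ^ 2 * (g x * e) ^ 2 + S ^ 2) by (field; lra).
            generalize (pow2_ge_0 (lam * (g x * e) - S)); lra.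
          * apply Rplus_le_compat_r, Rmult_le_compat_l; [lra|].
            rewrite Rpow_mult_distr; rewrite <- (Rmult_1_r (g x ^ 2)) at 2.
            apply Rmult_le_compat_l; [apply pow2_ge_0 | nra].
      - rewrite half_int_plus, !half_int_scal; auto; try (apply half_integrable_scal; assumption).
        rewrite half_int_fejer_kernel_0, sinc_sqr_int_eq by lra.
        unfold Y; rewrite (Rmult_assoc (/ (2 * lam))).
        apply Rplus_le_compat_r, Rmult_le_compat_l; [lra | exact HL]. }
    replace g0 with (G 0) by (unfold G; rewrite Rmult_0_r, exp_0; unfold g, g0; ring).
    rewrite <- sinc_sqr_int_eq; apply (fejer_upper G _ T); auto.
    intros A HA.
    destruct HA as [HA| <-].
    2:{ assert (0 <= 4 * u * M / (T - tau)); [|lra].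
        apply Rmult_le_pos; [nra | left; apply Rinv_0_lt_compat; lra]. }
    set (K := 4 * u * M).
    assert (HK : 0 <= K) by (unfold K; nra).
    (* The added term has derivative - K / (a - tau)^2, which compensates the bound on the cosine
       integral, so the sum does not increase past T. *)
    destruct (MVT_gen (fun a => dirichlet_int G 0 a + K / (a - tau)) T A
                (fun a => cosine_int G 0 a + - K / (a - tau) ^ 2)) as [c [Hc E]].
    - intros a Ha; rewrite Rmin_left, Rmax_right in Ha by lra.
      apply (is_derive_plus (V := R_NormedModule)).
      + apply is_derive_dirichlet_int; auto.
      + auto_derive; [lra|]; eq_in_R; field; lra.
    - intros a Ha; rewrite Rmin_left, Rmax_right in Ha by lra.
      apply continuity_pt_derivable; eexists; apply (is_derive_plus (V := R_NormedModule)).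
      + apply is_derive_dirichlet_int; auto.
      + auto_derive; [lra | reflexivity].
    - rewrite Rmin_left, Rmax_right in Hc by lra.
      assert (Hcos := quadrant_cosine_int_le F M tau u c HF HM Ht Hu ltac:(lra) Hre Him Hg).
      fold g K in Hcos; change (fun x => fst (F (x, 0)) * exp (- u * x)) with G in Hcos.
      assert (Hdc : cosine_int G 0 c + - K / (c - tau) ^ 2 <= 0) by (unfold Rdiv in *; lra).
      assert (0 <= K / (A - tau)) by (apply Rmult_le_pos; auto; left; apply Rinv_0_lt_compat; lra).
      assert ((cosine_int G 0 c + - K / (c - tau) ^ 2) * (A - T) <= 0) by nra.
      lra. }
  assert (H : PI / 2 * g0 <= Y).
  { apply le_epsilon; intros e He.
    assert (HD : 0 < 4 * M + 1) by lra.
    (* This [u] makes the error at most [e]; the added 1 covers M = 0. *)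
    specialize (Hu (e * (T - tau) / (4 * M + 1))).
    assert (Hup : 0 < e * (T - tau) / (4 * M + 1)).
    { apply Rdiv_lt_0_compat; auto; apply Rmult_lt_0_compat; lra. }
    specialize (Hu Hup).
    replace (4 * (e * (T - tau) / (4 * M + 1)) * M / (T - tau))
      with (e * (4 * M / (4 * M + 1))) in Hu by (field; lra).
    assert (4 * M / (4 * M + 1) <= 1).
    { apply Rmult_le_reg_r with (4 * M + 1); auto.
      unfold Rdiv; rewrite Rmult_assoc, Rinv_l by lra; lra. }
    assert (e * (4 * M / (4 * M + 1)) <= e * 1) by (apply Rmult_le_compat_l; lra).
    lra. }
  unfold Y, lam in H.
  apply Rmult_le_compat_r with (r := 2 * g0) in H; [|lra].
  replace ((T / g0 / 2 * L + / (2 * (T / g0)) * (T * (PI / 2))) * (2 * g0))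
    with (T * L + PI / 2 * g0 ^ 2) in H by (field; lra).
  simpl in *; lra.
Qed.

Lemma half_int_0 (f : R -> R) : (forall x, 0 < x -> f x = 0) -> half_int f = 0.
Proof.
  intros H; rewrite (half_int_ext f (fun x => 0 * 0)) by (intros; rewrite H; auto; ring).
  apply half_int_of_lim, is_lim_ext with (fun _ => 0); [|apply is_lim_const].
  intros r; rewrite (RInt_const (V := R_CompleteNormedModule)).
  unfold scal; simpl; unfold mult; simpl; ring.
Qed.

Lemma zero_derive_from_0 (f : R -> R) (A : R) :
  f 0 = 0 -> (forall x, ex_derive f x) -> (forall x, 0 < x -> is_derive f x 0) ->
  0 <= A -> f A = 0.
Proof.
  intros H0 He Hd HA.
  destruct (MVT_gen f 0 A (fun _ => 0)) as [c [_ E]].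
  - intros x Hx; rewrite Rmin_left in Hx by auto; apply Hd; lra.
  - intros; apply continuity_pt_derivable; auto.
  - rewrite H0 in E; lra.
Qed.

(** With F = 0 on the real axis the sine integral over the imaginary axis vanishes for every
    frequency A > 0 and every phase. The phase PI / 2 - A t turns it into the cosine integral
    centred at t; the Dirichlet and Fejer integrals then vanish too, and the latter recover the
    value at t. *)
Lemma quadrant_zero (F : C -> C) (M tau t : R) :
  entire F -> (forall z, Cmod (F z) <= M * exp (tau * Cmod z)) ->
  0 <= tau -> (forall x, F (x, 0) = 0) -> (forall y, snd (F (0, y)) = 0) ->
  0 <= t -> fst (F (0, t)) = 0.
Proof.
  intros HF HM Ht HR Him Htp.
  set (h := fun y => fst (F (0, y))).
  set (v := tau + 1).
  set (G := fun y => h y * exp (- v * y)).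
  assert (Hh := growth_fst_v F M tau HM).
  assert (Ch : forall x, continuous h x) by (intros; apply entire_continuous_fst_v; auto).
  assert (HG : half_integrable G).
  { apply half_integrable_ext with (fun x => x ^ 0 * (h x * exp (- v * x))).
    - intros; unfold G; simpl; ring.
    - apply half_integrable_growth_exp with M tau; auto; unfold v; lra. }
  assert (HxG : half_integrable (fun x => x * G x)).
  { apply half_integrable_ext with (fun x => x ^ 1 * (h x * exp (- v * x))).
    - intros; unfold G; simpl; ring.
    - apply half_integrable_growth_exp with M tau; auto; unfold v; lra. }
  assert (Hcos : forall A, 0 < A -> cosine_int G t A = 0).
  { intros A HA; unfold cosine_int.
    rewrite (half_int_ext _ (fun y => fst (F (0, y))
               * (exp (- v * y) * sin (A * y + (PI / 2 - A * t))))).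
    - rewrite <- (quadrant_identity F M tau A v (PI / 2 - A * t)); auto.
      + apply half_int_0; intros x _; rewrite HR; simpl; ring.
      + unfold v; lra.
      + intros x; rewrite HR; reflexivity.
      + apply half_integrable_ext with (fun x => 0 * exp (- (1) * x)).
        * intros x; rewrite HR; simpl; ring.
        * apply half_integrable_scal, half_integrable_exp; lra.
    - intros y _; unfold G, h.
      replace (A * y + (PI / 2 - A * t)) with (PI / 2 + A * (y - t)) by ring.
      rewrite (sin_plus (PI / 2)), sin_PI2, cos_PI2; ring. }
  assert (HD : forall A, 0 <= A -> dirichlet_int G t A = 0).
  { intros A HA; apply zero_derive_from_0; auto.
    - apply dirichlet_int_0.
    - intros x; eexists; apply is_derive_dirichlet_int; auto.
    - intros x Hx; rewrite <- (Hcos x Hx); apply is_derive_dirichlet_int; auto. }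
  assert (HFe : forall A, 0 <= A -> fejer_int G t A = 0).
  { intros A HA; apply zero_derive_from_0; auto.
    - apply fejer_int_0.
    - intros x; eexists; apply is_derive_fejer_int; auto.
    - intros x Hx; rewrite <- (HD x (Rlt_le _ _ Hx)); apply is_derive_fejer_int; auto. }
  assert (HG0 : G t = 0).
  { destruct (Req_dec (G t) 0) as [E|E]; auto; exfalso.
    assert (Hp := Rabs_pos_lt _ E).
    (* The mass of the kernel is at least PI / 2 > 1, so already an error of |G t| is
       contradictory. *)
    destruct (fejer_approx G t (Rabs (G t)) HG Hp) as [A [HA0 HA]].
    specialize (HA A (Rle_refl A)).
    rewrite HFe in HA by lra.
    replace (0 / A - G t * half_int (fejer_kernel t A))
      with (- (G t * half_int (fejer_kernel t A))) in HA by (field; lra).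
    assert (HK := half_int_fejer_kernel_ge t A HA0 Htp).
    rewrite sinc_sqr_int_eq in HK.
    assert (HPI := PI2_1).
    rewrite Rabs_Ropp, Rabs_mult, (Rabs_pos_eq (half_int _)) in HA by lra.
    nra. }
  unfold G, h in HG0; generalize (exp_pos (- v * t)); intros He.
  apply Rmult_integral in HG0; destruct HG0; auto; lra.
Qed.

(** * The Paley-Wiener space *)

Definition exp_bounded (tau : R) (F : C -> C) : Prop :=
  exists M, forall z, Cmod (F z) <= M * exp (tau * Cmod z).

Lemma exp_bounded_plus (tau : R) (F G : C -> C) :
  exp_bounded tau F -> exp_bounded tau G -> exp_bounded tau (fun z => (F z + G z)%C).
Proof.
  intros [M HM] [N HN]; exists (M + N); intros z.
  eapply Rle_trans; [apply Cmod_triangle|]; specialize (HM z); specialize (HN z); lra.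
Qed.

Lemma exp_bounded_scal (tau : R) (c : C) (F : C -> C) :
  exp_bounded tau F -> exp_bounded tau (fun z => (c * F z)%C).
Proof.
  intros [M HM]; exists (Cmod c * M); intros z.
  rewrite Cmod_mult, Rmult_assoc; apply Rmult_le_compat_l; auto; apply Cmod_ge_0.
Qed.

Lemma exp_bounded_opp (tau : R) (F : C -> C) :
  exp_bounded tau F -> exp_bounded tau (fun z => F (- z)%C).
Proof. intros [M HM]; exists M; intros z; rewrite <- (Cmod_opp z); auto. Qed.

Lemma exp_bounded_conj (tau : R) (F : C -> C) :
  exp_bounded tau F -> exp_bounded tau (fun z => Cconj (F (Cconj z))).
Proof.
  intros [M HM]; exists M; intros z; rewrite Cmod_conj, <- (Cmod_conj z); auto.
Qed.

Lemma exp_bounded_shift (tau : R) (a : C) (F : C -> C) :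
  0 <= tau -> exp_bounded tau F -> exp_bounded tau (fun z => F (z + a)%C).
Proof.
  intros Ht [M HM]; exists (M * exp (tau * Cmod a)); intros z.
  eapply Rle_trans; [apply HM|]; rewrite Rmult_assoc, <- exp_plus.
  apply Rmult_le_compat_l; [apply (growth_constant_nonneg F M tau HM)|].
  apply exp_le; rewrite <- Rmult_plus_distr_l; apply Rmult_le_compat_l; auto.
  rewrite Rplus_comm; apply Cmod_triangle.
Qed.

Lemma entire_opp (F : C -> C) : entire F -> entire (fun z => F (- z)%C).
Proof.
  intros HF; apply (entire_comp F (fun z => (- z)%C)); auto.
  apply entire_ext with (fun z => (- (1) * z + 0)%C); [intros; ring | apply entire_affine].
Qed.

Lemma entire_shift (a : C) (F : C -> C) : entire F -> entire (fun z => F (z + a)%C).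
Proof.
  intros HF; apply (entire_comp F (fun z => (z + a)%C)); auto.
  apply entire_ext with (fun z => (1 * z + a)%C); [intros; ring | apply entire_affine].
Qed.

Lemma entire_scal (c : C) (F : C -> C) : entire F -> entire (fun z => (c * F z)%C).
Proof. intros HF; apply entire_mult; auto; apply entire_const. Qed.

(** Adding the reflection of F in the imaginary axis gives a function that still vanishes on the
    real line and whose value at i y is twice the real part of F (i y). *)
Lemma entire_real_zero_fst (F : C -> C) (tau y : R) :
  entire F -> exp_bounded tau F -> 0 <= tau -> (forall x : R, F (x, 0) = 0) -> 0 <= y ->
  fst (F (0, y)) = 0.
Proof.
  intros HF HB Ht HR Hy.
  set (G := fun z => (F z + Cconj (F (- Cconj z)))%C).
  assert (HGe : entire G).
  { apply entire_plus; auto; apply (entire_conj (fun z => F (- z)%C)), entire_opp; auto. }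
  assert (HGb : exp_bounded tau G).
  { apply exp_bounded_plus; auto.
    apply (exp_bounded_conj tau (fun z => F (- z)%C)), exp_bounded_opp; auto. }
  destruct HGb as [M HM].
  assert (E : forall x t, (- Cconj (x, t))%C = (- x, t)).
  { intros; unfold Copp, Cconj; simpl; f_equal; ring. }
  assert (H := quadrant_zero G M tau y HGe HM Ht).
  unfold G in H; rewrite E, Ropp_0 in H; simpl in H.
  cut (fst (F (0, y)) + fst (F (0, y)) = 0); [lra|].
  apply H; auto.
  - intros x; rewrite E, !HR; unfold RtoC, Cconj, Cplus; simpl; f_equal; ring.
  - intros t; rewrite E, Ropp_0; ring.
Qed.

(** Real translations bring every vertical line to the imaginary axis, multiplication by i gives the
    imaginary part, and z -> - z the lower half-plane. *)
Lemma entire_real_zero (F : C -> C) (tau : R) :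
  entire F -> exp_bounded tau F -> 0 <= tau -> (forall x : R, F (x, 0) = 0) ->
  forall z, F z = 0.
Proof.
  assert (Hup : forall F, entire F -> exp_bounded tau F -> 0 <= tau ->
            (forall x : R, F (x, 0) = 0) -> forall x y, 0 <= y -> F (x, y) = 0).
  { clear F; intros F HF HB Ht HR x y Hy.
    set (G := fun z => F (z + (x, 0%R))%C).
    assert (HG : entire G) by (apply entire_shift; auto).
    assert (HGb : exp_bounded tau G) by (apply exp_bounded_shift; auto).
    assert (HGR : forall t : R, G (t, 0) = 0).
    { intros t; unfold G, Cplus; simpl; rewrite Rplus_0_r; auto. }
    assert (E : G (0, y) = F (x, y)).
    { unfold G, Cplus; simpl; rewrite Rplus_0_l, Rplus_0_r; reflexivity. }
    assert (H1 := entire_real_zero_fst G tau y HG HGb Ht HGR Hy).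
    assert (H2 := entire_real_zero_fst (fun z => (Ci * G z)%C) tau y (entire_scal Ci G HG)
                    (exp_bounded_scal tau Ci G HGb) Ht).
    simpl in H2; specialize (H2 ltac:(intros t; rewrite HGR; ring) Hy).
    rewrite E in H1, H2; apply injective_projections; simpl; lra. }
  intros HF HB Ht HR [x y].
  destruct (Rle_dec 0 y) as [Hy|Hy]; [apply Hup; auto|].
  assert (H := Hup (fun z => F (- z)%C) (entire_opp F HF) (exp_bounded_opp tau F HB) Ht).
  replace (x, y) with (- (- x, - y)%R)%C by (unfold Copp; simpl; f_equal; ring).
  apply H; [|lra].
  intros t; unfold Copp; simpl; rewrite Ropp_0; auto.
Qed.

Lemma RInt_le_RInt_gen (f : R -> R) (l a b : R) :
  (forall x, continuous f x) -> (forall x, 0 <= f x) ->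
  is_RInt_gen f (Rbar_locally m_infty) (Rbar_locally p_infty) l -> a <= b ->
  RInt f a b <= l.
Proof.
  intros Cf Hf Hl Hab; apply le_epsilon; intros eps Heps.
  destruct (Hl (ball l (mkposreal eps Heps)) (locally_ball l (mkposreal eps Heps)))
    as [Q S [m HQ] [M HS] H].
  assert (Ha : Rmin a (m - 1) < m) by (generalize (Rmin_r a (m - 1)); lra).
  assert (Hb : M < Rmax b (M + 1)) by (generalize (Rmax_r b (M + 1)); lra).
  destruct (H _ _ (HQ _ Ha) (HS _ Hb)) as [y [Hy Hby]]; simpl in Hy.
  apply (is_RInt_unique (V := R_CompleteNormedModule)) in Hy.
  assert (Hle : RInt f a b <= y).
  { rewrite <- Hy; apply RInt_mono_interval; auto.
    - apply Rmin_l.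
    - apply Rmax_l. }
  unfold ball in Hby; simpl in Hby; unfold AbsRing_ball, abs, minus, plus, opp in Hby.
  simpl in Hby; apply Rabs_def2 in Hby; lra.
Qed.

(** For nonnegative functions the integral grows with the interval, so the supremum over all
    intervals is the two-sided limit. *)
Lemma is_RInt_gen_bounded (f : R -> R) (B : R) :
  (forall x, continuous f x) -> (forall x, 0 <= f x) ->
  (forall a b, a <= b -> RInt f a b <= B) ->
  exists l, is_RInt_gen f (Rbar_locally m_infty) (Rbar_locally p_infty) l /\ l <= B.
Proof.
  intros Cf Hf HB.
  destruct (completeness (fun y => exists a b, a <= b /\ y = RInt f a b)) as [l [Hl1 Hl2]].
  - exists B; intros y [a [b [Hab ->]]]; auto.
  - exists (RInt f 0 0), 0, 0; split; auto; lra.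
  - exists l; split.
    + intros P [eps HP].
      destruct (Classical_Prop.classic
                  (exists a b, a <= b /\ l - eps < RInt f a b)) as [[a [b [Hab H]]]|H].
      * apply Filter_prod with (fun x => x < a) (fun x => b < x).
        { exists a; auto. }
        { exists b; auto. }
        intros x y Hx Hy; exists (RInt f x y); split.
        { apply (RInt_correct (V := R_CompleteNormedModule)), continuous_ex_RInt; auto. }
        apply HP; unfold ball; simpl; unfold AbsRing_ball, abs, minus, plus, opp; simpl.
        assert (RInt f a b <= RInt f x y) by (apply RInt_mono_interval; auto; lra).
        assert (RInt f x y <= l) by (apply Hl1; exists x, y; split; auto; lra).
        apply Rabs_def1; destruct eps as [e He]; simpl in *; lra.
      * exfalso; assert (l <= l - eps); [|destruct eps; simpl in *; lra].
        apply Hl2; intros y [a [b [Hab ->]]]; apply Rnot_lt_le; intros H'.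
        apply H; exists a, b; auto.
    + apply Hl2; intros y [a [b [Hab ->]]]; auto.
Qed.

Lemma RInt_reflect (f : R -> R) (r : R) :
  (forall x, continuous f x) -> RInt f (- r) 0 = RInt (fun x => f (- x)) 0 r.
Proof.
  intros Cf.
  assert (H := RInt_comp_lin (V := R_CompleteNormedModule) f (-1) 0 r 0).
  replace (-1 * r + 0) with (- r) in H by ring; replace (-1 * 0 + 0) with 0 in H by ring.
  rewrite <- H by (apply continuous_ex_RInt; auto).
  rewrite <- (opp_RInt_swap (V := R_CompleteNormedModule)).
  - rewrite (RInt_ext _ (fun x => -1 * f (- x))).
    + rewrite RInt_mulc; [unfold opp; simpl; ring|].
      intros x; apply (continuous_comp Ropp f); auto.
      apply continuous_derivable; auto_derive; auto.
    + intros x _; unfold scal; simpl; unfold mult; simpl; do 2 f_equal; ring.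
  - apply continuous_ex_RInt; intros x.
    apply (continuous_scal_r (V := R_NormedModule)).
    apply (continuous_comp (fun y => -1 * y + 0) f); auto.
    apply continuous_derivable; auto_derive; auto.
Qed.

Definition sqmod (F : C -> C) (x : R) : R := Cmod (F (RtoC x)) ^ 2.

Lemma sqmod_nonneg (F : C -> C) (x : R) : 0 <= sqmod F x.
Proof. apply pow2_ge_0. Qed.

Lemma continuous_sqmod (F : C -> C) (x : R) : entire F -> continuous (sqmod F) x.
Proof.
  intros HF.
  assert (HG : entire (fun z => (- Ci * F z)%C)) by (apply entire_scal; auto).
  assert (C1 : continuous (fun t => fst (F (t, 0))) x) by (apply entire_continuous_fst_h; auto).
  assert (C2 : continuous (fun t => fst (- Ci * F (t, 0%R))%C) x)
    by (apply (entire_continuous_fst_h _ _ _ HG)).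
  apply continuous_ext with
    (fun t => fst (F (t, 0)) * fst (F (t, 0))
              + fst (- Ci * F (t, 0%R))%C * fst (- Ci * F (t, 0%R))%C).
  - intros t; unfold sqmod; rewrite Cmod2_alt; unfold RtoC, Re, Im; simpl; ring.
  - apply (continuous_plus (V := R_NormedModule)); apply (continuous_mult (K := R_AbsRing)); auto.
Qed.

Lemma L2norm2_correct (F : C -> C) :
  sq_integrable F ->
  is_RInt_gen (sqmod F) (Rbar_locally m_infty) (Rbar_locally p_infty) (L2norm2 F).
Proof. intros H; apply (RInt_gen_correct (V := R_CompleteNormedModule)); exact H. Qed.

Lemma RInt_sqmod_le (F : C -> C) (a b : R) :
  entire F -> sq_integrable F -> a <= b -> RInt (sqmod F) a b <= L2norm2 F.
Proof.
  intros HF HS Hab; apply RInt_le_RInt_gen; auto.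
  - intros; apply continuous_sqmod; auto.
  - intros; apply sqmod_nonneg.
  - apply L2norm2_correct; auto.
Qed.

Lemma PW_exp_bounded (Delta eps : R) (F : C -> C) :
  PW Delta F -> 0 < eps -> exp_bounded (PI * Delta + eps) F.
Proof. intros [_ [H _]] He; exact (H eps He). Qed.

(** Makes [ratio] a genuine quotient. A vanishing norm forces F = 0 on the real line by continuity,
    and then everywhere by [entire_real_zero]. *)
Lemma L2norm2_pos (Delta : R) (F : C -> C) :
  0 < Delta -> PW Delta F -> F <> (fun _ => RtoC 0) -> 0 < L2norm2 F.
Proof.
  intros HD HP Hne; assert (HPI := PI_RGT_0).
  apply Rnot_le_lt; intros HL; apply Hne.
  assert (HF : entire F) by apply HP. assert (HS : sq_integrable F) by apply HP.
  apply FunctionalExtensionality.functional_extensionality.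
  apply (entire_real_zero F (PI * Delta + 1)); auto.
  - apply (PW_exp_bounded Delta 1 F); auto; lra.
  - nra.
  - intros x; apply Cmod_eq_0.
    assert (Hc := continuous_sqmod F x HF).
    destruct (Req_dec (sqmod F x) 0) as [H0|H0].
    { unfold sqmod in H0; change (x, 0) with (RtoC x).
      generalize (Cmod_ge_0 (F (RtoC x))); nra. }
    exfalso.
    assert (Hpos : 0 < sqmod F x) by (generalize (sqmod_nonneg F x); lra).
    apply continuity_pt_filterlim in Hc.
    destruct (Hc (sqmod F x / 2)) as [d [Hd Hcd]]; [lra|].
    simpl in Hcd; unfold R_dist in Hcd.
    assert (H := RInt_sqmod_le F x (x + d / 2) HF HS ltac:(lra)).
    assert (Hlow : Rabs (RInt (sqmod F) x (x + d / 2) - sqmod F x * (d / 2))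
                   <= sqmod F x / 2 * (d / 2)).
    { apply Rabs_RInt_minus_const_le; [intros; apply continuous_sqmod; auto | lra |].
      intros t Ht; destruct (Req_dec t x) as [->|Hne'].
      - rewrite Rminus_diag, Rabs_R0; lra.
      - left; apply Hcd; split; [split; [exact I | auto]|].
        apply Rabs_def1; lra. }
    apply Rabs_le_between in Hlow; nra.
Qed.

(** Reduction to [quadrant_point_bound] with L equal to half the squared norm of F: the two halves
    give PI |F(0)|^2 <= T ||F||^2 for every T > PI Delta. *)
Lemma PW_point_bound (Delta : R) (F : C -> C) :
  0 < Delta -> PW Delta F -> Cmod (F 0) ^ 2 <= Delta * L2norm2 F.
Proof.
  intros HD HP; assert (HPI := PI_RGT_0).
  assert (HF : entire F) by apply HP. assert (HS : sq_integrable F) by apply HP.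
  assert (HL0 : 0 <= L2norm2 F).
  { eapply Rle_trans; [|apply (RInt_sqmod_le F 0 0); auto; lra].
    rewrite (RInt_point (V := R_CompleteNormedModule)); apply Rle_refl. }
  set (n := Cmod (F 0)).
  destruct (Req_dec n 0) as [Hn|Hn]; [rewrite Hn; nra|].
  assert (Hnp : 0 < n) by (generalize (Cmod_ge_0 (F 0)); unfold n in *; lra).
  (* The unimodular factor that rotates F(0) to the positive number [n]. *)
  set (c := (Cconj (F 0) * RtoC (/ n))%C).
  assert (Hc : Cmod c = 1).
  { unfold c; rewrite Cmod_mult, Cmod_conj, Cmod_R, Rabs_pos_eq
      by (left; apply Rinv_0_lt_compat; auto).
    fold n; field; lra. }
  assert (Hc0 : fst (c * F 0)%C = n).
  { assert (Hsq := Cmod2_alt (F 0)); fold n in Hsq; unfold Re, Im in Hsq.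
    unfold c; simpl.
    transitivity ((fst (F 0) ^ 2 + snd (F 0) ^ 2) * / n); [ring|].
    rewrite <- Hsq; field; lra. }
  set (H := fun z => (c * F z)%C).
  assert (HH : entire H) by (apply entire_scal; auto).
  (* Average over the group generated by z -> - z and Schwarz reflection. On the real line it is the
     even part of Re H, so its square is at most the mean of |F|^2 at x and - x. *)
  set (E := fun z => (RtoC (/ 4) * ((H z + H (- z)) + (Cconj (H (Cconj z)) + Cconj (H (- Cconj z)))))%C).
  assert (HE : entire E).
  { apply entire_scal, entire_plus; apply entire_plus; auto.
    - apply entire_opp; auto.
    - apply entire_conj; auto.
    - apply (entire_conj (fun z => H (- z)%C)), entire_opp; auto. }
  assert (HEb : forall tau, exp_bounded tau F -> exp_bounded tau E).
  { intros tau Hb; assert (HHb : exp_bounded tau H) by (apply exp_bounded_scal; auto).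
    apply exp_bounded_scal, exp_bounded_plus; apply exp_bounded_plus; auto.
    - apply exp_bounded_opp; auto.
    - apply exp_bounded_conj; auto.
    - apply (exp_bounded_conj tau (fun z => H (- z)%C)), exp_bounded_opp; auto. }
  assert (ER : forall x, E (x, 0) = ((fst (H (x, 0)) + fst (H (- x, 0))) / 2, 0)).
  { intros x; unfold E.
    replace (- (x, 0%R))%C with (- x, 0) by (unfold Copp; simpl; f_equal; ring).
    replace (Cconj (x, 0)) with (x, 0) by (unfold Cconj; simpl; f_equal; ring).
    replace (- (x, 0%R))%C with (- x, 0) by (unfold Copp; simpl; f_equal; ring).
    apply injective_projections; simpl; field; lra. }
  assert (EI : forall y, snd (E (0, y)) = 0).
  { intros y; unfold E.
    replace (- Cconj (0%R, y))%C with (0, y) by (unfold Copp, Cconj; simpl; f_equal; ring).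
    replace (Cconj (0, y)) with (- (0%R, y))%C by (unfold Copp, Cconj; simpl; f_equal; ring).
    simpl; field; lra. }
  assert (E0 : fst (E (0, 0)) = n).
  { rewrite ER, Ropp_0; change (fst (H (0, 0))) with (fst (c * F 0)%C).
    rewrite Hc0; simpl; field. }
  set (g := fun x => fst (E (x, 0))).
  assert (Cg : forall x, continuous g x) by (intros; apply entire_continuous_fst_h; auto).
  assert (Cs := fun x => continuous_sqmod F x HF).
  assert (Cs' : forall x, continuous (fun t => sqmod F (- t)) x).
  { intros x; apply (continuous_comp Ropp (sqmod F)); auto.
    apply continuous_derivable; auto_derive; auto. }
  assert (Cg2 : forall x, continuous (fun t => g t ^ 2) x).
  { intros x; apply (continuous_comp g (fun t => t ^ 2)); auto.
    apply continuous_derivable; auto_derive; auto. }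
  assert (Hgle : forall x, g x ^ 2 <= / 2 * (sqmod F x + sqmod F (- x))).
  { intros x; unfold g; rewrite ER; simpl fst.
    assert (Hx : forall t, fst (H (t, 0)) ^ 2 <= sqmod F t).
    { intros t; unfold sqmod; change (t, 0) with (RtoC t).
      rewrite <- pow2_abs; apply pow_incr; split; [apply Rabs_pos|].
      eapply Rle_trans; [apply Rabs_fst_le_Cmod|].
      unfold H; rewrite Cmod_mult, Hc; lra. }
    generalize (Hx x) (Hx (- x)) (pow2_ge_0 (fst (H (x, 0)) - fst (H (- x, 0)))); simpl; lra. }
  assert (Hgi : forall r, 0 <= r -> RInt (fun x => g x ^ 2) 0 r <= L2norm2 F / 2).
  { intros r Hr.
    apply Rle_trans with (RInt (fun x => / 2 * (sqmod F x + sqmod F (- x))) 0 r).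
    - apply RInt_le_on; auto.
      intros x; apply (continuous_scal_r (V := R_NormedModule)).
      apply (continuous_plus (V := R_NormedModule)); auto.
    - rewrite RInt_mulc by (intros x; apply (continuous_plus (V := R_NormedModule)); auto).
      rewrite (RInt_add (sqmod F) (fun x => sqmod F (- x))), <- RInt_reflect by auto.
      assert (Hr2 := RInt_sqmod_le F (- r) r HF HS ltac:(lra)).
      rewrite (RInt_split (sqmod F) (- r) 0 r) in Hr2 by auto; lra. }
  assert (Hg : half_integrable (fun x => g x ^ 2)).
  { apply half_integrable_nonneg with (L2norm2 F / 2); auto; intros; apply pow2_ge_0. }
  assert (HT : forall T, PI * Delta < T -> PI * n ^ 2 <= T * L2norm2 F).
  { intros T HT.
    (* The midpoint is an admissible growth rate, above PI Delta, and still lies below T. *)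
    destruct (HEb (PI * Delta + (T - PI * Delta) / 2)) as [M HM].
    { apply PW_exp_bounded; auto; lra. }
    assert (HB := quadrant_point_bound E M _ T (L2norm2 F / 2) HE HM ltac:(nra) ltac:(lra)
                    ltac:(intros; rewrite ER; reflexivity) EI Hg
                    (half_int_le_bound _ _ Hg Hgi) ltac:(rewrite E0; auto)).
    rewrite E0 in HB; lra. }
  apply Rmult_le_reg_l with PI; auto; rewrite <- Rmult_assoc.
  apply le_epsilon; intros e He.
  specialize (HT (PI * Delta + e / (L2norm2 F + 1))).
  assert (Hq : 0 < e / (L2norm2 F + 1)) by (apply Rdiv_lt_0_compat; lra).
  specialize (HT ltac:(lra)).
  assert (Hle : e / (L2norm2 F + 1) * L2norm2 F <= e).
  { apply Rmult_le_reg_r with (L2norm2 F + 1); [lra|].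
    replace (e / (L2norm2 F + 1) * L2norm2 F * (L2norm2 F + 1)) with (e * L2norm2 F)
      by (field; lra); lra. }
  lra.
Qed.

(** * Extremal functions *)

Lemma C_deriv_ext_loc (F G : C -> C) (z l : C) (r : R) :
  0 < r -> (forall w, Cmod (w - z) < r -> F w = G w) -> C_deriv F z l -> C_deriv G z l.
Proof.
  intros Hr E H eps Heps; destruct (H eps Heps) as [d [Hd Hw]].
  exists (Rmin r d); split; [apply Rmin_pos; auto|].
  intros w Hwz.
  rewrite <- !E; [apply Hw| |]; try (eapply Rlt_le_trans; [apply Hwz|]).
  - apply Rmin_r.
  - replace (z - z)%C with (RtoC 0) by ring; rewrite Cmod_0; auto.
  - apply Rmin_l.
Qed.

Lemma C_deriv_Cinv (z : C) : z <> 0 -> C_deriv Cinv z (- / (z * z))%C.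
Proof.
  intros Hz eps Heps.
  assert (Hm : 0 < Cmod z) by (apply Cmod_gt_0; auto).
  assert (Hm3 : 0 < Cmod z ^ 3) by (apply pow_lt; auto).
  exists (Rmin (Cmod z / 2) (eps * Cmod z ^ 3 / 2)); split.
  { apply Rmin_pos; [lra|]; apply Rdiv_lt_0_compat; [apply Rmult_lt_0_compat|]; lra. }
  intros w Hw; set (h := (w - z)%C) in *.
  assert (H1 := Rlt_le_trans _ _ _ Hw (Rmin_l _ _)).
  assert (H2 := Rlt_le_trans _ _ _ Hw (Rmin_r _ _)).
  assert (Hwm : Cmod z / 2 < Cmod w).
  { assert (T := Cmod_triangle w (- h)%C); rewrite Cmod_opp in T.
    replace (w + - h)%C with z in T by (unfold h; ring); lra. }
  assert (Hw0 : w <> 0) by (apply Cmod_gt_0; lra).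
  replace (/ w - / z - h * - / (z * z))%C with (h * h * (/ (z * z) * / w))%C
    by (unfold h; field; auto).
  rewrite !Cmod_mult, !Cmod_inv, Cmod_mult; auto.
  2:{ apply Cmult_neq_0; auto. }
  rewrite (Rmult_comm eps), Rmult_assoc; apply Rmult_le_compat_l; [apply Cmod_ge_0|].
  assert (Hi : / Cmod w <= / (Cmod z / 2)) by (apply Rinv_le_contravar; lra).
  assert (Hzz : 0 < / (Cmod z * Cmod z)).
  { apply Rinv_0_lt_compat, Rmult_lt_0_compat; auto. }
  apply Rle_trans with (Cmod h * (/ (Cmod z * Cmod z) * / (Cmod z / 2))).
  - apply Rmult_le_compat_l; [apply Cmod_ge_0|]; apply Rmult_le_compat_l; lra.
  - replace (/ (Cmod z * Cmod z) * / (Cmod z / 2)) with (2 / Cmod z ^ 3) by (field; lra).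
    apply Rmult_le_reg_r with (Cmod z ^ 3 / 2); [lra|].
    replace (Cmod h * (2 / Cmod z ^ 3) * (Cmod z ^ 3 / 2)) with (Cmod h) by (field; lra).
    lra.
Qed.

(* The second factor is [1 / (2 i)]. *)
Definition Csin (z : C) : C := ((Cexp (Ci * z) - Cexp (- (Ci * z))) * (0%R, (- / 2)%R))%C.

Definition Csinc (z : C) : C := if Ceq_dec z 0 then 1 else (Csin z / z)%C.

(** In the difference of the remainders at i z and - i z the constant and quadratic terms cancel,
    leaving 2 i (sin z - z). *)
Lemma Csin_sub_le (z : C) : Cmod (Csin z - z) <= Cmod z ^ 3 * exp (Cmod z).
Proof.
  assert (Hi : Cmod (Ci * z) = Cmod z) by (rewrite Cmod_mult, Cmod_Ci; ring).
  replace (Csin z - z)%C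
    with ((Cexp_rem3 (Ci * z) - Cexp_rem3 (- (Ci * z))) * (0%R, (- / 2)%R))%C.
  - rewrite Cmod_mult.
    replace (Cmod (0, - / 2)) with (/ 2).
    2:{ unfold Cmod; simpl.
        replace (0 * (0 * 1) + - / 2 * (- / 2 * 1)) with ((/ 2)²) by (unfold Rsqr; field).
        rewrite sqrt_Rsqr; lra. }
    assert (H1 := Cexp_rem3_le (Ci * z)). assert (H2 := Cexp_rem3_le (- (Ci * z))).
    rewrite Cmod_opp in H2; rewrite Hi in H1, H2.
    assert (T := Cmod_triangle (Cexp_rem3 (Ci * z)) (- Cexp_rem3 (- (Ci * z)))).
    rewrite Cmod_opp in T; unfold Cminus; lra.
  - unfold Csin, Cexp_rem3.
    destruct (Cexp (Ci * z)) as [a b]; destruct (Cexp (- (Ci * z))) as [a' b'].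
    destruct z as [x y]; apply injective_projections; simpl; field.
Qed.

Lemma Csinc_0 : Csinc 0 = 1.
Proof. unfold Csinc; destruct Ceq_dec as [_|H]; [reflexivity | exfalso; apply H; reflexivity]. Qed.

Lemma Csinc_neq_0 (z : C) : z <> 0 -> Csinc z = (Csin z / z)%C.
Proof. intros H; unfold Csinc; destruct Ceq_dec; [contradiction | reflexivity]. Qed.

Lemma Csinc_sub_1_le (z : C) : Cmod (Csinc z - 1) <= Cmod z ^ 2 * exp (Cmod z).
Proof.
  destruct (Ceq_dec z 0) as [->|Hz].
  - rewrite Csinc_0; replace (1 - 1)%C with (RtoC 0) by ring; rewrite Cmod_0; simpl; lra.
  - rewrite Csinc_neq_0 by auto.
    assert (Hm : 0 < Cmod z) by (apply Cmod_gt_0; auto).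
    apply Rmult_le_reg_r with (Cmod z); auto.
    rewrite <- Cmod_mult.
    replace ((Csin z / z - 1) * z)%C with (Csin z - z)%C by (field; auto).
    eapply Rle_trans; [apply Csin_sub_le | right; ring].
Qed.

Lemma entire_Csinc : entire Csinc.
Proof.
  assert (HS : entire Csin).
  { apply entire_ext with (fun z => ((0%R, (- / 2)%R)
      * (Cexp (Ci * z + 0) + - (1) * Cexp (- Ci * z + 0)))%C).
    - intros z; unfold Csin; replace (Ci * z + 0)%C with (Ci * z)%C by ring.
      replace (- Ci * z + 0)%C with (- (Ci * z))%C by ring; ring.
    - apply entire_scal, entire_plus; [|apply entire_scal];
        apply (entire_comp Cexp (fun z => (_ * z + 0)%C)); try apply entire_Cexp;
        apply entire_affine. }
  apply entire_C_deriv; intros z.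
  destruct (Ceq_dec z 0) as [->|Hz].
  (* The estimate |Csinc w - 1| = O(|w|^2) gives derivative 0 at the removable singularity. *)
  - exists 0; intros eps Heps.
    assert (He : 0 < exp 1) by apply exp_pos.
    exists (Rmin 1 (eps / exp 1)); split; [apply Rmin_pos; [lra | apply Rdiv_lt_0_compat; auto]|].
    intros w Hw; replace (w - 0)%C with w in * by ring.
    assert (H1 := Rlt_le_trans _ _ _ Hw (Rmin_l _ _)).
    assert (H2 := Rlt_le_trans _ _ _ Hw (Rmin_r _ _)).
    rewrite Csinc_0; replace (Csinc w - 1 - w * 0)%C with (Csinc w - 1)%C by ring.
    eapply Rle_trans; [apply Csinc_sub_1_le|].
    assert (Hm := Cmod_ge_0 w).
    replace (Cmod w ^ 2 * exp (Cmod w)) with (Cmod w * exp (Cmod w) * Cmod w) by ring.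
    apply Rmult_le_compat_r; auto.
    apply Rle_trans with (Cmod w * exp 1).
    + apply Rmult_le_compat_l; auto; apply exp_le; lra.
    + apply Rmult_lt_compat_r with (r := exp 1) in H2; auto.
      unfold Rdiv in H2; rewrite Rmult_assoc, Rinv_l, Rmult_1_r in H2; lra.
  - destruct (proj1 (entire_C_deriv Csin) HS z) as [l Hl].
    eexists; apply C_deriv_ext_loc with (F := fun w => (Csin w * / w)%C) (r := Cmod z).
    + apply Cmod_gt_0; auto.
    + intros w Hw; rewrite Csinc_neq_0; [reflexivity|].
      intros ->; replace (0 - z)%C with (- z)%C in Hw by ring; rewrite Cmod_opp in Hw; lra.
    + apply C_deriv_mult; [exact Hl | apply C_deriv_Cinv; auto].
Qed.

Lemma Csinc_RtoC (x : R) : Csinc (RtoC x) = RtoC (sinc x).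
Proof.
  destruct (Req_dec x 0) as [->|Hx]; [rewrite Csinc_0, sinc_0; reflexivity|].
  assert (Hx' : RtoC x <> 0) by (intros E; apply Hx, RtoC_inj; auto).
  rewrite Csinc_neq_0, sinc_neq_0, RtoC_div by auto; f_equal.
  unfold Csin, Cexp; simpl.
  replace (0 * x - 1 * 0) with 0 by ring; replace (0 * 0 + 1 * x) with x by ring.
  rewrite Ropp_0, exp_0, cos_neg, sin_neg.
  apply injective_projections; simpl; field.
Qed.

Lemma exp_type_le_mult (F G : C -> C) (a b : R) :
  exp_type_le F a -> exp_type_le G b -> exp_type_le (fun z => (F z * G z)%C) (a + b).
Proof.
  intros HF HG eps Heps.
  destruct (HF (eps / 2)) as [M HM]; [lra|]. destruct (HG (eps / 2)) as [N HN]; [lra|].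
  exists (M * N); intros z; rewrite Cmod_mult.
  replace ((a + b + eps) * Cmod z)
    with ((a + eps / 2) * Cmod z + (b + eps / 2) * Cmod z) by field.
  rewrite exp_plus.
  replace (M * N * (exp ((a + eps / 2) * Cmod z) * exp ((b + eps / 2) * Cmod z)))
    with (M * exp ((a + eps / 2) * Cmod z) * (N * exp ((b + eps / 2) * Cmod z))) by ring.
  apply Rmult_le_compat; auto; apply Cmod_ge_0.
Qed.

Lemma exp_type_le_id : exp_type_le (fun z => z) 0.
Proof.
  intros eps Heps; exists (/ eps); intros z; rewrite Rplus_0_l.
  assert (H := exp_ineq1_le (eps * Cmod z)).
  apply Rmult_le_reg_l with eps; auto.
  rewrite <- Rmult_assoc, Rinv_r by lra; lra.
Qed.

(** The polynomial factor in [Csinc_sub_1_le] is absorbed by the margin, through (eps r)^2 / 2 <=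
    exp (eps r). *)
Lemma exp_type_le_Csinc (s : R) : 0 < s -> exp_type_le (fun z => Csinc (RtoC s * z)) s.
Proof.
  intros Hs eps Heps; exists (1 + 2 * s ^ 2 / eps ^ 2); intros z.
  set (r := Cmod z). assert (Hr : 0 <= r) by apply Cmod_ge_0.
  assert (Hsr : Cmod (RtoC s * z) = s * r)
    by (rewrite Cmod_mult, Cmod_R, Rabs_pos_eq; auto; lra).
  assert (H := Csinc_sub_1_le (RtoC s * z)); rewrite Hsr in H.
  assert (T := Cmod_triangle (Csinc (RtoC s * z) - 1) 1).
  replace (Csinc (RtoC s * z) - 1 + 1)%C with (Csinc (RtoC s * z)) in T by ring.
  rewrite Cmod_1 in T.
  assert (He1 : 1 <= exp ((s + eps) * r)) by (rewrite <- exp_0; apply exp_le; nra).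
  assert (He2 : (s * r) ^ 2 * exp (s * r) <= 2 * s ^ 2 / eps ^ 2 * exp ((s + eps) * r)).
  { replace ((s + eps) * r) with (eps * r + s * r) by ring; rewrite exp_plus, <- Rmult_assoc.
    apply Rmult_le_compat_r; [left; apply exp_pos|].
    assert (P := pow_div_fact_le_exp 2 (eps * r) ltac:(nra)).
    replace (INR (fact 2)) with 2 in P by (simpl; ring).
    replace ((s * r) ^ 2) with (2 * s ^ 2 / eps ^ 2 * ((eps * r) ^ 2 / 2)) by (field; lra).
    apply Rmult_le_compat_l; auto.
    apply Rmult_le_pos; [generalize (pow2_ge_0 s); lra|].
    left; apply Rinv_0_lt_compat, pow_lt; auto. }
  rewrite Rmult_plus_distr_r; lra.
Qed.

(** Over the whole line sinc (s x)^2 has integral PI / s, twice the mass of the Fejer kernel on the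
    half-line divided by s. *)
Lemma RInt_le_sinc_sqr (f : R -> R) (k s a b : R) :
  (forall x, continuous f x) -> 0 < s -> 0 <= k ->
  (forall x, f x <= k * sinc (s * x) ^ 2) -> a <= b -> RInt f a b <= k * (PI / s).
Proof.
  intros Cf Hs Hk Hf Hab.
  set (r := Rmax (Rabs a) (Rabs b)).
  assert (Ha : - r <= a).
  { generalize (Rmax_l (Rabs a) (Rabs b)) (Rle_abs (- a)); rewrite Rabs_Ropp; fold r; lra. }
  assert (Hb : b <= r) by (generalize (Rmax_r (Rabs a) (Rabs b)) (Rle_abs b); fold r; lra).
  set (K := fejer_kernel 0 (2 * s)).
  assert (CK : forall x, continuous K x) by apply continuous_fejer_kernel.
  assert (EK : forall x, K x = s * sinc (s * x) ^ 2).
  { intros x; unfold K, fejer_kernel; rewrite Rminus_0_r.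
    replace (2 * s / 2) with s by field; reflexivity. }
  assert (CkK : forall x, continuous (fun t => k / s * K t) x)
    by (intros; apply (continuous_scal_r (V := R_NormedModule)); auto).
  apply Rle_trans with (RInt (fun x => k / s * K x) a b).
  { apply RInt_le_on; auto; intros x _; rewrite EK.
    replace (k / s * (s * sinc (s * x) ^ 2)) with (k * sinc (s * x) ^ 2) by (field; lra); auto. }
  rewrite RInt_mulc by auto.
  replace (k * (PI / s)) with (k / s * PI) by (field; lra).
  apply Rmult_le_compat_l; [apply Rmult_le_pos; auto; left; apply Rinv_0_lt_compat; auto|].
  assert (HKp : forall x, 0 <= K x) by (intros; apply fejer_kernel_nonneg; lra).
  apply Rle_trans with (RInt K (- r) r); [apply RInt_mono_interval; auto|].
  rewrite (RInt_split K (- r) 0 r), RInt_reflect by auto.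
  rewrite (RInt_ext (fun x => K (- x)) K).
  - assert (H := RInt_le_half_int K 0 r (half_integrable_fejer_kernel 0 (2 * s) ltac:(lra))
                  ltac:(auto) ltac:(lra) ltac:(lra)).
    unfold K in H at 2; rewrite half_int_fejer_kernel_0, sinc_sqr_int_eq in H by lra; lra.
  - intros x _; rewrite !EK; replace (s * - x) with (- (s * x)) by ring.
    assert (Es : forall y, sinc (- y) = sinc y).
    { intros y; destruct (Req_dec y 0) as [->|Hy]; [rewrite Ropp_0; reflexivity|].
      rewrite !sinc_neq_0, sin_neg by lra; field; auto. }
    rewrite Es; reflexivity.
Qed.

Lemma PW_of_sinc_bound (Delta k s : R) (F : C -> C) :
  entire F -> exp_type_le F (PI * Delta) -> 0 < s -> 0 <= k ->
  (forall x, sqmod F x <= k * sinc (s * x) ^ 2) ->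
  PW Delta F /\ L2norm2 F <= k * (PI / s).
Proof.
  intros HF HT Hs Hk Hle.
  destruct (is_RInt_gen_bounded (sqmod F) (k * (PI / s))) as [l [Hl Hl']].
  - intros; apply continuous_sqmod; auto.
  - intros; apply sqmod_nonneg.
  - intros a b Hab; apply RInt_le_sinc_sqr; auto; intros; apply continuous_sqmod; auto.
  - split; [repeat split; auto; exists l; exact Hl|].
    unfold L2norm2.
    change (RInt_gen (sqmod F) (Rbar_locally m_infty) (Rbar_locally p_infty) <= k * (PI / s)).
    rewrite (is_RInt_gen_unique (V := R_CompleteNormedModule) _ l Hl); exact Hl'.
Qed.

Lemma entire_Csinc_scal (s : R) : entire (fun z => Csinc (RtoC s * z)).
Proof.
  apply entire_ext with (fun z => Csinc (RtoC s * z + 0)).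
  - intros z; f_equal; ring.
  - apply (entire_comp Csinc (fun z => (RtoC s * z + 0)%C)); [apply entire_Csinc|].
    apply entire_affine.
Qed.

(** Witness sinc (PI Delta z). An upper bound on the norm makes the ratio large, and by
    [PW_point_bound] the bound 1 / Delta is attained. *)
Lemma sinc_extremal (Delta : R) :
  0 < Delta -> exists F, PW Delta F /\ F <> (fun _ => RtoC 0) /\ F 0 = 1 /\
    L2norm2 F <= / Delta.
Proof.
  intros HD; assert (HPI := PI_RGT_0); set (s := PI * Delta).
  assert (Hs : 0 < s) by (apply Rmult_lt_0_compat; auto).
  set (F := fun z => Csinc (RtoC s * z)).
  assert (HF0 : F 0 = 1) by (unfold F; rewrite Cmult_0_r; apply Csinc_0).
  destruct (PW_of_sinc_bound Delta 1 s F) as [HP HL]; auto; try lra.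
  - apply entire_Csinc_scal.
  - apply exp_type_le_Csinc; auto.
  - intros x; unfold sqmod, F; rewrite <- RtoC_mult, Csinc_RtoC, Cmod_R, pow2_abs; lra.
  - exists F; repeat split; auto; try apply HP.
    + intros E; rewrite E in HF0; apply C1_nz; auto.
    + eapply Rle_trans; [exact HL|]; right; unfold s; field; lra.
Qed.

(** Witness z sinc (s z)^2 with s = PI Delta / 2: the two sinc factors use up the type PI Delta and
    the factor z adds none. One sinc compensates z on the real line, the other gives
    square-integrability. *)
Lemma PW_vanishing_at_0 (Delta : R) :
  0 < Delta -> exists F, PW Delta F /\ F <> (fun _ => RtoC 0) /\ F 0 = 0.
Proof.
  intros HD; assert (HPI := PI_RGT_0); set (s := PI * Delta / 2).
  assert (Hs : 0 < s) by (apply Rdiv_lt_0_compat; [apply Rmult_lt_0_compat|]; lra).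
  set (F := fun z => (z * (Csinc (RtoC s * z) * Csinc (RtoC s * z)))%C).
  assert (HFR : forall x : R, F (RtoC x) = RtoC (x * sinc (s * x) ^ 2)).
  { intros x; unfold F; rewrite <- RtoC_mult, Csinc_RtoC, <- !RtoC_mult; f_equal; ring. }
  destruct (PW_of_sinc_bound Delta (/ s ^ 2) s F) as [HP _]; auto.
  - apply entire_mult; [apply entire_id | apply entire_mult]; apply entire_Csinc_scal.
  - replace (PI * Delta) with (0 + (s + s)) by (unfold s; field).
    apply exp_type_le_mult; [apply exp_type_le_id | apply exp_type_le_mult];
      apply exp_type_le_Csinc; auto.
  - left; apply Rinv_0_lt_compat, pow_lt; auto.
  - intros x; unfold sqmod; rewrite HFR, Cmod_R, pow2_abs.
    assert (H := sqr_mul_sinc_sqr_le (s * x)).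
    replace ((x * sinc (s * x) ^ 2) ^ 2)
      with (/ s ^ 2 * (((s * x) ^ 2 * sinc (s * x) ^ 2) * sinc (s * x) ^ 2)) by (field; lra).
    apply Rmult_le_compat_l; [left; apply Rinv_0_lt_compat, pow_lt; auto|].
    rewrite <- (Rmult_1_l (sinc (s * x) ^ 2)) at 3.
    apply Rmult_le_compat_r; auto; apply pow2_ge_0.
  - exists F; repeat split; try apply HP.
    + intros E; assert (H := HFR (PI / 2 / s)); rewrite E in H; apply RtoC_inj in H.
      replace (s * (PI / 2 / s)) with (PI / 2) in H by (field; lra).
      rewrite sinc_neq_0, sin_PI2 in H by lra.
      assert (0 < PI / 2 / s * (1 / (PI / 2)) ^ 2); [|lra].
      apply Rmult_lt_0_compat; [|apply pow_lt]; apply Rdiv_lt_0_compat; lra.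
    + unfold F; apply Cmult_0_l.
Qed.

(** * The ratio as a function of the point value, and its extreme values *)

Lemma ratio_sqrt (F : C -> C) :
  0 < L2norm2 F -> ratio F = sqrt (1 + Cmod (F 0) ^ 2 / (2 * L2norm2 F)).
Proof.
  intros HL; unfold ratio, WOnorm2.
  rewrite <- sqrt_div; auto.
  - f_equal; field; lra.
  - generalize (pow2_ge_0 (Cmod (F 0))); lra.
Qed.

Theorem theorem15 (Delta : R) (hDelta : 0 < Delta) :
  is_glb_Rbar (fun r : R => exists F : C -> C,
      PW Delta F /\ F <> (fun _ => RtoC 0) /\ r = ratio F) (Finite 1) /\
  is_lub_Rbar (fun r : R => exists F : C -> C,
      PW Delta F /\ F <> (fun _ => RtoC 0) /\ r = ratio F)
    (Finite (sqrt (1 + Delta / 2))).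
Proof.
  split; split.
  - intros r [F [HP [Hne ->]]]; simpl.
    assert (HL := L2norm2_pos Delta F hDelta HP Hne).
    rewrite ratio_sqrt by auto; rewrite <- sqrt_1 at 1; apply sqrt_le_1_alt.
    assert (0 <= Cmod (F 0) ^ 2 / (2 * L2norm2 F)); [|lra].
    apply Rmult_le_pos; [apply pow2_ge_0 | left; apply Rinv_0_lt_compat; lra].
  - intros b Hb; destruct (PW_vanishing_at_0 Delta hDelta) as [F [HP [Hne H0]]].
    apply Hb; exists F; repeat split; try apply HP; auto.
    rewrite ratio_sqrt by (apply (L2norm2_pos Delta); auto).
    rewrite H0, Cmod_0; replace (1 + 0 ^ 2 / (2 * L2norm2 F)) with 1 by (unfold Rdiv; ring).
    rewrite sqrt_1; reflexivity.
  - intros r [F [HP [Hne ->]]]; simpl.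
    assert (HL := L2norm2_pos Delta F hDelta HP Hne).
    rewrite ratio_sqrt by auto; apply sqrt_le_1_alt, Rplus_le_compat_l.
    assert (H := PW_point_bound Delta F hDelta HP).
    apply Rmult_le_reg_r with (2 * L2norm2 F); [lra|].
    replace (Cmod (F 0) ^ 2 / (2 * L2norm2 F) * (2 * L2norm2 F)) with (Cmod (F 0) ^ 2)
      by (field; lra).
    lra.
  - intros b Hb; destruct (sinc_extremal Delta hDelta) as [F [HP [Hne [H0 HL]]]].
    apply Rbar_le_trans with (ratio F); [|apply Hb; exists F; auto].
    assert (HLp := L2norm2_pos Delta F hDelta HP Hne).
    rewrite ratio_sqrt by auto; simpl; apply sqrt_le_1_alt, Rplus_le_compat_l.
    rewrite H0, Cmod_1.
    apply Rmult_le_reg_r with (2 * L2norm2 F); [lra|].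
    replace (1 * (1 * 1) / (2 * L2norm2 F) * (2 * L2norm2 F)) with 1 by (field; lra).
    apply Rmult_le_compat_l with (r := Delta) in HL; [|lra].
    rewrite Rinv_r in HL; lra.
Qed.
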